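(* Let $q\in\mathbb{C}$, $q\neq0$, not be a root of unity, and $N\ge2$. Then the quantized enveloping algebra $U_q(\mathfrak{sl}_N)$ over $\mathbb{C}$ is $LD$-stable and $LD\,U_q(\mathfrak{sl}_N)=N^2-1$.
   Context: $U_q(\mathfrak{sl}_N)$ is the quantized enveloping algebra of $\mathfrak{sl}_N$ given by the quantum Chevalley–Serre relations. $GK$ is Gelfand–Kirillov dimension over $\mathbb{C}$: $GK\,A=\sup_V\limsup_m \log(\dim V^m)/\log m$ over subframes $V$ (finite-dimensional subspaces containing $1$). Lower transcendence degree $LD$: if every subframe $V$ admits a finite-dimensional nonzero $W$ with $\dim VW=\dim W$, then $LD\,A=0$; otherwise $LD\,A=\sup_V\sup\{d>0:\exists c>0,\ \dim VW\ge\dim W+c(\dim W)^{(d-1)/d}\text{ for all finite-dimensional }W\neq0\}$. $A$ is $LD$-stable if $LD\,A=GK\,A$. *)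

(* Defs.v *)
From HB Require Import structures.
From mathcomp Require Import all_boot all_order all_algebra.
From mathcomp Require Import boolp classical_sets reals ereal sequences exp.
From mathcomp Require Import Rstruct.
From mathcomp Require Import complex.
Set Implicit Arguments. Unset Strict Implicit. Unset Printing Implicit Defensive.
Import Order.TTheory GRing.Theory Num.Theory.
Local Open Scope ring_scope.
Local Open Scope classical_set_scope.

Definition C : fieldType := (Rdefinitions.R)[i].

Section LinAlg.
Variable A : algType C.

Definition inspan (x : A) (s : seq A) : Prop :=
  exists c : 'I_(size s) -> C, x = \sum_(i < size s) c i *: s`_i.

Definition lin_free (s : seq A) : Prop :=
  forall c : 'I_(size s) -> C, \sum_(i < size s) c i *: s`_i = 0 -> forall i, c i = 0.

Definition dimspan (s : seq A) : nat :=
  \max_(m : (size s).-tuple bool | `[< lin_free (mask m s) >]) size (mask m s).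

(* spanning family of the product subspace V W, for V = span s, W = span t *)
Definition prodspan (s t : seq A) : seq A := [seq v * w | v <- s, w <- t].

Fixpoint powspan (s : seq A) (m : nat) : seq A :=
  if m is m'.+1 then prodspan (powspan s m') s else [:: 1].

(* a subframe: finite-dimensional subspace containing 1 (given by a spanning family) *)
Definition subframe (s : seq A) : Prop := inspan 1 s.

Definition GKdim : \bar Rdefinitions.R :=
  ereal_sup [set limn_esup
      (fun m : nat => ((ln (dimspan (powspan s m))%:R) / ln m%:R)%:E) | s in subframe].

Definition LDdeg : \bar Rdefinitions.R :=
  if `[< forall s, subframe s ->
         exists t, (0 < dimspan t)%N /\ dimspan (prodspan s t) = dimspan t >]
  then 0%E
  else ereal_sup [set ereal_sup
         [set d%:E | d in [set d : Rdefinitions.R | 0 < d /\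
            exists2 c : Rdefinitions.R, 0 < c &
              forall t, (0 < dimspan t)%N ->
                (dimspan t)%:R + c * powR (dimspan t)%:R ((d - 1) / d)
                  <= (dimspan (prodspan s t))%:R]]
       | s in subframe].

Definition LD_stable : Prop := LDdeg = GKdim.

End LinAlg.

(* Cartan matrix of sl_N, indices i, j : 'I_n with n = N - 1 *)
Definition cartan n (i j : 'I_n) : int :=
  if i == j then 2 else if (i.+1 == j) || (j.+1 == i) then -1 else 0.

Definition Uq_relations (n : nat) (q : C) (B : algType C)
  (E F K Ki : 'I_n -> B) : Prop :=
  [/\ (forall i, (K i * Ki i = 1 /\ Ki i * K i = 1)) /\
      (forall i j, K i * K j = K j * K i),
      forall i j, K i * E j * Ki i = (q ^ cartan i j) *: E j,
      forall i j, K i * F j * Ki i = (q ^ (- cartan i j)) *: F j,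
      forall i j, E i * F j - F j * E i =
                  (if i == j then (q - q^-1)^-1 *: (K i - Ki i) else 0)
    & forall i j, (cartan i j = -1 ->
           (E i ^+ 2 * E j - (q + q^-1) *: (E i * E j * E i) + E j * E i ^+ 2 = 0
        /\ F i ^+ 2 * F j - (q + q^-1) *: (F i * F j * F i) + F j * F i ^+ 2 = 0))
      /\ (cartan i j = 0 -> (E i * E j = E j * E i /\ F i * F j = F j * F i))].

(* (A, E, F, K, Ki) is the algebra presented by generators and the relations above,
   i.e. U_q(sl_N), characterized by its universal property. *)
Definition is_Uq_sl (N : nat) (q : C) (A : algType C) (E F K Ki : 'I_N.-1 -> A) : Prop :=
  Uq_relations q E F K Ki /\
  forall (B : algType C) (E' F' K' Ki' : 'I_N.-1 -> B),
    Uq_relations q E' F' K' Ki' ->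
    exists f : A -> B,
      [/\ (forall (a : C) (x y : A), f (a *: x + y) = a *: f x + f y),
          (forall x y : A, f (x * y) = f x * f y), f 1 = 1,
          (forall i, [/\ f (E i) = E' i, f (F i) = F' i, f (K i) = K' i & f (Ki i) = Ki' i])
        & forall g : A -> B,
            (forall (a : C) (x y : A), g (a *: x + y) = a *: g x + g y) ->
            (forall x y : A, g (x * y) = g x * g y) -> g 1 = 1 ->
            (forall i, [/\ g (E i) = E' i, g (F i) = F' i, g (K i) = K' i & g (Ki i) = Ki' i]) ->
            forall x, g x = f x].

(* Main.v *)
Require Import Defs.
From HB Require Import structures.
From mathcomp Require Import all_boot all_order all_algebra.
From mathcomp Require Import boolp classical_sets reals ereal topology sequences exp.
From mathcomp Require Import Rstruct complex.
From mathcomp Require Import ring lra zify.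
Set Implicit Arguments. Unset Strict Implicit. Unset Printing Implicit Defensive.
Import Order.TTheory GRing.Theory Num.Theory.
Local Open Scope ring_scope.

(* The quantum Serre relations give q-commutation rules among quantum root
   vectors, so ordered monomials F^a K^c E^b span and GK <= N^2 - 1.

   Conversely, the algebra acts through an iterated coproduct of q-oscillator
   representations, that is, it maps to a quantum torus whose monomials are
   ordered by a translation-invariant total order on their exponents.  For a
   suitable order the root vectors and the K_i have leading exponents
   e_1, ..., e_d, d = N^2 - 1, which are linearly independent over Z.  Leading
   exponents add under multiplication, so those of a finite-dimensional space W
   form a set S with |S| = dim W, and the exponents of VW contain S and all
   translates S + e_p, where V is spanned by 1 and these elements.  The discrete
   isoperimetric inequality in Z^d then bounds dim VW from below and gives
   LD >= d.  Finally LD <= GK, because an inequality of this kind iterated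
   along W = V^m forces dim V^m to grow at least like m^d. *)

(** * Normal forms of noncommutative polynomials *)

(** Put n = N - 1. One oscillator representation offers only 2N exponents, fewer than N^2 - 1 once N
    >= 3, hence the iterated coproduct: n copies serve the E-root vectors and n more the F-root
    vectors. The order makes E_i dominant in copy c exactly when i + c < n. A q-commutator vanishes
    on letters in decreasing copies, so in the root vector with letters E_l, ..., E_(l+j) the copies
    increase weakly, and the last letter confines them to copies up to n - 1 - (l+j). The leading
    term has all letters in that copy: roots with different last letters are separated by the copy,
    roots with the same last letter by their first letter.

    The ordered monomials span and have distinct leading exponents in the lattice of e_1, ..., e_d,
    so every nonzero element has its leading exponent in that lattice; this is what places S in Z^d.
    Moreover a word of length L expands into ordered monomials with all exponents at most L, which
    turns spanning into a polynomial bound on dim V^m. *)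

Section NoncommutativeIdentities.
Variables (k : fieldType) (A : algType k).

Inductive nexp :=
  | NAtom of nat | NZero | NOne | NAdd of nexp & nexp | NOpp of nexp
  | NMul of nexp & nexp | NScale of k & nexp.

Fixpoint neval (env : seq A) (e : nexp) : A :=
  match e with
  | NAtom i => nth 0 env i
  | NZero => 0
  | NOne => 1
  | NAdd a b => neval env a + neval env b
  | NOpp a => - neval env a
  | NMul a b => neval env a * neval env b
  | NScale c a => c *: neval env a
  end.

(** Comparison and concatenation of words are private functions so that [cbv] in [ncpoly] can unfold
    them by name while the coefficients stay untouched field expressions. *)
Fixpoint word_eq (s t : list nat) : bool :=
  match s, t with
  | nil, nil => true
  | cons x s', cons y t' => if Nat.eqb x y then word_eq s' t' else false
  | _, _ => false
  end.

Fixpoint wcat (s t : list nat) : list nat :=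
  match s with nil => t | cons x s' => cons x (wcat s' t) end.

Fixpoint ninsert (c : k) (w : list nat) (l : list (k * list nat)) :=
  match l with
  | nil => cons (c, w) nil
  | cons (c', w') l' =>
      if word_eq w w' then cons (c + c', w') l' else cons (c', w') (ninsert c w l')
  end.

Fixpoint nadd (l1 l2 : list (k * list nat)) :=
  match l1 with nil => l2 | cons (c, w) l1' => ninsert c w (nadd l1' l2) end.

Fixpoint nscale (a : k) (u : list nat) (l : list (k * list nat)) :=
  match l with
  | nil => nil
  | cons (c, w) l' => cons (a * c, wcat u w) (nscale a u l')
  end.

Fixpoint nmul (l1 l2 : list (k * list nat)) :=
  match l1 with
  | nil => nil
  | cons (c, w) l1' => nadd (nscale c w l2) (nmul l1' l2)
  end.

Fixpoint nnorm (e : nexp) : list (k * list nat) :=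
  match e with
  | NAtom i => cons (1, cons i nil) nil
  | NZero => nil
  | NOne => cons (1, nil) nil
  | NAdd a b => nadd (nnorm a) (nnorm b)
  | NOpp a => nscale (-1) nil (nnorm a)
  | NMul a b => nmul (nnorm a) (nnorm b)
  | NScale c a => nscale c nil (nnorm a)
  end.

Fixpoint weval (env : seq A) (w : list nat) : A :=
  match w with nil => 1 | cons i w' => nth 0 env i * weval env w' end.

Fixpoint leval (env : seq A) (l : list (k * list nat)) : A :=
  match l with nil => 0 | cons (c, w) l' => c *: weval env w + leval env l' end.

(** The singleton case keeps a trivial last conjunct out of the goals left to [ring] and [field]. *)
Fixpoint all_zero (l : list (k * list nat)) : Prop :=
  match l with
  | nil => True
  | cons (c, _) nil => c = 0
  | cons (c, _) l' => c = 0 /\ all_zero l'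
  end.

Lemma word_eqP s t : word_eq s t -> s = t.
Proof.
elim: s t => [|x s IH] [|y t] //=.
by case: PeanoNat.Nat.eqb_spec => // -> /IH ->.
Qed.

Lemma weval_cat env s t : weval env (wcat s t) = weval env s * weval env t.
Proof. by elim: s => [|x s IH] /=; rewrite ?mul1r // IH mulrA. Qed.

Lemma leval_insert env c w l :
  leval env (ninsert c w l) = c *: weval env w + leval env l.
Proof.
elim: l => [|[c' w'] l IH] //=; case: ifP => [/word_eqP -> | _] /=.
  by rewrite scalerDl addrA.
by rewrite IH addrCA.
Qed.

Lemma leval_add env l1 l2 : leval env (nadd l1 l2) = leval env l1 + leval env l2.
Proof.
elim: l1 => [|[c w] l IH] /=; first by rewrite add0r.
by rewrite leval_insert IH addrA.
Qed.

Lemma leval_scale env a u l :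
  leval env (nscale a u l) = a *: (weval env u * leval env l).
Proof.
elim: l => [|[c w] l IH] /=; first by rewrite mulr0 scaler0.
by rewrite IH weval_cat mulrDr scalerDr -scalerAr scalerA.
Qed.

Lemma leval_mul env l1 l2 : leval env (nmul l1 l2) = leval env l1 * leval env l2.
Proof.
elim: l1 => [|[c w] l IH] /=; first by rewrite mul0r.
by rewrite leval_add leval_scale IH mulrDl scalerAl.
Qed.

Lemma leval_norm env e : leval env (nnorm e) = neval env e.
Proof.
elim: e => [i||| a IHa b IHb | a IHa | a IHa b IHb | c a IHa] //=.
- by rewrite mulr1 scale1r addr0.
- by rewrite scale1r addr0.
- by rewrite leval_add IHa IHb.
- by rewrite leval_scale IHa mul1r scaleN1r.
- by rewrite leval_mul IHa IHb.
- by rewrite leval_scale IHa mul1r.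
Qed.

Lemma all_zero_leval env l : all_zero l -> leval env l = 0.
Proof.
elim: l => [|[c w] l IH] //= H.
have [-> Hl] : c = 0 /\ all_zero l by case: l {IH} H => [|[? ?] ?].
by rewrite scale0r add0r IH.
Qed.

Lemma neval_eq env e1 e2 :
  all_zero (nnorm (NAdd e1 (NOpp e2))) -> neval env e1 = neval env e2.
Proof.
move=> /(all_zero_leval env); rewrite leval_norm /= => /eqP.
by rewrite subr_eq0 => /eqP.
Qed.

End NoncommutativeIdentities.

Ltac nlookup x env :=
  lazymatch env with
  | cons x _ => constr:(O)
  | cons _ ?env' => let i := nlookup x env' in constr:(S i)
  end.

Ltac nmem x env :=
  lazymatch env with
  | nil => constr:(false)
  | cons x _ => constr:(true)
  | cons _ ?env' => nmem x env'
  end.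

Ltac natoms env t :=
  lazymatch t with
  | (?a + ?b)%R => let env' := natoms env a in natoms env' b
  | (- ?a)%R => natoms env a
  | (?a * ?b)%R => let env' := natoms env a in natoms env' b
  | (_ *: ?a)%R => natoms env a
  | 0%R => env
  | 1%R => env
  | _ => lazymatch nmem t env with true => env | false => constr:(cons t env) end
  end.

Ltac nreify k env t :=
  lazymatch t with
  | (?a + ?b)%R =>
      let a' := nreify k env a in let b' := nreify k env b in constr:(@NAdd k a' b')
  | (- ?a)%R => let a' := nreify k env a in constr:(@NOpp k a')
  | (?a * ?b)%R =>
      let a' := nreify k env a in let b' := nreify k env b in constr:(@NMul k a' b')
  | (?c *: ?a)%R => let a' := nreify k env a in constr:(@NScale k c a')
  | 0%R => constr:(@NZero k)
  | 1%R => constr:(@NOne k)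
  | _ => let i := nlookup t env in constr:(@NAtom k i)
  end.

(* Reduces an identity between noncommutative polynomials over the field [k]
   to the vanishing of the coefficient of every word. *)
Ltac ncpoly k :=
  lazymatch goal with
  | |- @eq ?T ?l ?r =>
      let env0 := natoms (@nil T) l in
      let env := natoms env0 r in
      let l' := nreify k env l in
      let r' := nreify k env r in
      apply: (@neval_eq k _ env l' r');
      cbv [nnorm nadd nscale nmul ninsert word_eq wcat Nat.eqb all_zero];
      repeat split
  end.

(** * Quantum root vectors *)

Section QuantumSerre.
Variables (k : fieldType) (A : algType k) (t : k).
Hypotheses (t0 : t != 0) (t2 : t + t^-1 != 0).

Definition serre (x y : A) : Prop :=
  x * x * y - (t + t^-1) *: (x * y * x) + y * x * x = 0.

Definition qcomm (x y : A) : A := x * y - t *: (y * x).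

(** The Serre polynomial factors into two successive q-commutators with [x], with parameters t and
    t^-1. *)
Lemma serre_qcommP x y : serre x y <-> x * qcomm x y = t^-1 *: (qcomm x y * x).
Proof.
rewrite /serre /qcomm; split=> H; last first.
  move/eqP: H; rewrite -subr_eq0 => /eqP <-; ncpoly k; by field.
apply/eqP; rewrite -subr_eq0; apply/eqP; rewrite -[RHS]H; ncpoly k; by field.
Qed.

Lemma serre_qcommr x y : serre x y -> x * qcomm y x = t *: (qcomm y x * x).
Proof.
move=> H; apply/eqP; rewrite -subr_eq0; apply/eqP.
transitivity (- t *: (x * x * y - (t + t^-1) *: (x * y * x) + y * x * x)).
  rewrite /qcomm; ncpoly k; by field.
by rewrite H scaler0.
Qed.

(** The Serre polynomial is linear in its second argument and [z] commutes with [x], so the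
    polynomial of [qcomm y z] is the q-commutator with [z] of the polynomial of [y]. *)
Lemma serre_comm_qcomm x y z : serre x y -> x * z = z * x -> serre x (qcomm y z).
Proof.
rewrite /serre => H xz.
have xzr u : u * x * z = u * z * x by rewrite -mulrA xz mulrA.
transitivity ((x * x * y - (t + t^-1) *: (x * y * x) + y * x * x) * z
  - t *: (z * (x * x * y - (t + t^-1) *: (x * y * x) + y * x * x))
  - (t + t^-1) *: (x * y * (z * x - x * z)) + y * ((z * x - x * z) * x + x * (z * x - x * z))
  - t *: ((x * (x * z - z * x) + (x * z - z * x) * x) * y)
  + (t * (t + t^-1)) *: ((x * z - z * x) * y * x)).
  rewrite /qcomm; ncpoly k; by field.
by rewrite H xz !subrr !(mul0r, mulr0, scaler0, addr0, oppr0, subr0, addr0).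
Qed.

Lemma qcomm_scale x y z (a b : k) : x * y = a *: (y * x) -> x * z = b *: (z * x) ->
  x * qcomm y z = (a * b) *: (qcomm y z * x).
Proof.
move=> xy xz; apply/eqP; rewrite -subr_eq0; apply/eqP.
transitivity ((x * y - a *: (y * x)) * z + a *: (y * (x * z - b *: (z * x)))
  - t *: ((x * z - b *: (z * x)) * y + b *: (z * (x * y - a *: (y * x))))).
  rewrite /qcomm; ncpoly k; by ring.
by rewrite xy xz !subrr !(mul0r, mulr0, scaler0, addr0, subr0).
Qed.

Lemma comm_qcomm x y z : x * y = y * x -> x * z = z * x -> x * qcomm y z = qcomm y z * x.
Proof.
move=> xy xz; rewrite (@qcomm_scale x y z 1 1) ?scale1r ?mulr1 ?scale1r //.
Qed.

(* The four ways of multiplying a Serre relation by the third letter give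
   [bcba - cbab = babc - abcb] after division by [t + t^-1]. *)
Lemma serre_middle a b c : a * c = c * a -> serre b a -> serre b c ->
  b * qcomm c (qcomm b a) = qcomm c (qcomm b a) * b.
Proof.
rewrite /serre => ac ba bc.
have key : b * c * b * a - c * b * a * b - b * a * b * c + a * b * c * b = 0.
  apply: (scalerI t2); rewrite scaler0.
  transitivity (- (b * b * c - (t + t^-1) *: (b * c * b) + c * b * b) * a
     - a * (b * b * c - (t + t^-1) *: (b * c * b) + c * b * b)
     + c * (b * b * a - (t + t^-1) *: (b * a * b) + a * b * b)
     + (b * b * a - (t + t^-1) *: (b * a * b) + a * b * b) * c
     - b * b * (a * c - c * a) + (a * c - c * a) * b * b).
    ncpoly k; by field.
  by rewrite ba bc ac !subrr !(mul0r, mulr0, scaler0, addr0, oppr0, subr0).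
apply/eqP; rewrite -subr_eq0; apply/eqP; rewrite /qcomm.
transitivity ((b * c * b * a - c * b * a * b - b * a * b * c + a * b * c * b)
  + t *: (a * (b * b * c - (t + t^-1) *: (b * c * b) + c * b * b)
   - (b * b * a - (t + t^-1) *: (b * a * b) + a * b * b) * c)
  + t *: (b * (a * c - c * a) * b) - t *: ((a * c - c * a) * b * b)).
  ncpoly k; by field.
by rewrite key ba bc ac !subrr !(mul0r, mulr0, scaler0, addr0, oppr0, subr0).
Qed.

Variables (n : nat) (E : nat -> A).
Hypothesis far : forall i j, (i < n)%N -> (j < n)%N -> (i.+1 < j)%N -> E i * E j = E j * E i.
Hypothesis serre_up : forall i, (i.+1 < n)%N -> serre (E i) (E i.+1).
Hypothesis serre_dn : forall i, (i.+1 < n)%N -> serre (E i.+1) (E i).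

(** The quantum root vector of alpha_l + ... + alpha_(l+m), lengthened by one simple root at its
    upper end. *)
Fixpoint qroot (l m : nat) : A :=
  if m is m'.+1 then qcomm (E (l + m)%N) (qroot l m') else E l.

Lemma qroot_right i l m : (l + m < n)%N -> (i < n)%N -> ((l + m).+1 < i)%N ->
  E i * qroot l m = qroot l m * E i.
Proof.
elim: m => [|m IH] /= lmn ilt ilm.
  by symmetry; apply: far; lia.
by apply: comm_qcomm; [symmetry; apply: far; lia | apply: IH; lia].
Qed.

Lemma qroot_last l m : (l + m.+1 < n)%N ->
  E (l + m.+1)%N * qroot l m.+1 = t^-1 *: (qroot l m.+1 * E (l + m.+1)%N).
Proof.
move=> lmn /=; apply/serre_qcommP.
case: m lmn => [|m] lmn /=.
  by rewrite addn1; apply: serre_dn; lia.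
rewrite -[(l + m.+2)%N]/(l + m.+2)%N (addnS l m.+1).
apply: serre_comm_qcomm; first by apply: serre_dn; lia.
by apply: qroot_right; lia.
Qed.

Lemma qroot_middle i l m : (l < i)%N -> (i < l + m)%N -> (l + m < n)%N ->
  E i * qroot l m = qroot l m * E i.
Proof.
elim: m => [|m IH] li ilm lmn; first by lia.
case: (ltngtP i (l + m)%N) => [lt | gt | eqi]; last 2 first.
- by lia.
(* Here E_i is the last but one letter of the root vector: [serre_middle] applies with b = E_i, c
   the last letter and a the root vector on the letters before E_i. *)
- case: m {IH} ilm lmn eqi => [|m] ilm lmn eqi; first by lia.
  rewrite /= eqi; apply: serre_middle.
  + by rewrite -qroot_right //; lia.
  + case: m ilm lmn eqi => [|m] ilm lmn eqi /=.
      by rewrite addn1; apply: serre_dn; lia.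
    rewrite (addnS l m.+1); apply: serre_comm_qcomm; first by apply: serre_dn; lia.
    by apply: qroot_right; lia.
  + by rewrite (addnS l m.+1); apply: serre_up; lia.
- by rewrite /=; apply: comm_qcomm; [apply: far; lia | apply: IH; lia].
Qed.

Lemma qroot_first l m : (l + m.+1 < n)%N ->
  E l * qroot l m.+1 = t *: (qroot l m.+1 * E l).
Proof.
elim: m => [|m IH] lmn.
  by rewrite /= addn1; apply: serre_qcommr; apply: serre_up; lia.
rewrite [qroot l m.+2]/= (@qcomm_scale _ _ _ 1 t) ?mul1r ?scale1r //.
  by apply: far; lia.
by apply: IH; lia.
Qed.

(** The factor t comes from the common first letter, by [qroot_first]; every further letter of the
    shorter vector is interior to the longer one and commutes with it by [qroot_middle]. *)
Lemma qroot_root l m m' : (m < m')%N -> (l + m' < n)%N ->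
  qroot l m * qroot l m' = t *: (qroot l m' * qroot l m).
Proof.
elim: m => [|m IH] mm' lmn.
  by case: m' mm' lmn => // m' _ lmn; apply: qroot_first.
have H1 : E (l + m.+1)%N * qroot l m' = qroot l m' * E (l + m.+1)%N.
  by apply: qroot_middle; lia.
have H2 := IH (ltnW mm') lmn.
rewrite [qroot l m.+1]/= /qcomm; apply/eqP; rewrite -subr_eq0; apply/eqP.
set x := E _ in H1 *; set y := qroot l m in H2 *; set z := qroot l m' in H1 H2 *.
transitivity (x * (y * z - t *: (z * y)) + t *: ((x * z - z * x) * y)
  - t *: ((y * (x * z - z * x)) + (y * z - t *: (z * y)) * x)).
  ncpoly k; by ring.
by rewrite H1 H2 !subrr !(mul0r, mulr0, scaler0, addr0, subr0).
Qed.

End QuantumSerre.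

(** * Linear spans and ordered monomials *)

Section LinearSpan.
Variables (k : fieldType) (V : lmodType k).

(** As an inductive predicate the span makes sense for infinite sets, and linear maps are followed
    through it by induction. *)
Inductive lspan (Q : V -> Prop) : V -> Prop :=
  | lspan_zero : lspan Q 0
  | lspan_step (c : k) x y : Q x -> lspan Q y -> lspan Q (c *: x + y).

Variable Q : V -> Prop.

Lemma lspan_mem x : Q x -> lspan Q x.
Proof. by move=> Qx; rewrite -[x]addr0 -[x]scale1r; apply/lspan_step/lspan_zero. Qed.

Lemma lspanD x y : lspan Q x -> lspan Q y -> lspan Q (x + y).
Proof.
move=> Qx Qy; elim: Qx => [|c u v Qu _ IH]; first by rewrite add0r.
by rewrite -addrA; apply: lspan_step.
Qed.

Lemma lspanZ c x : lspan Q x -> lspan Q (c *: x).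
Proof.
elim=> [|a u v Qu _ IH]; first by rewrite scaler0; apply: lspan_zero.
by rewrite scalerDr scalerA; apply: lspan_step.
Qed.

Lemma lspanN x : lspan Q x -> lspan Q (- x).
Proof. by rewrite -scaleN1r; apply: lspanZ. Qed.

Lemma lspanB x y : lspan Q x -> lspan Q y -> lspan Q (x - y).
Proof. by move=> Qx /lspanN; apply: lspanD. Qed.

Lemma lspan_sum (I : Type) (r : seq I) (P : pred I) (F : I -> V) :
  (forall i, P i -> lspan Q (F i)) -> lspan Q (\sum_(i <- r | P i) F i).
Proof.
move=> H; apply: big_ind => //; [exact: lspan_zero | exact: lspanD].
Qed.

End LinearSpan.

Lemma lspan_map (k : fieldType) (V W : lmodType k) (Q : V -> Prop) (Q' : W -> Prop)
    (f : V -> W) (x : V) :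
  (forall (c : k) u v, f (c *: u + v) = c *: f u + f v) ->
  (forall u, Q u -> lspan Q' (f u)) -> lspan Q x -> lspan Q' (f x).
Proof.
move=> lf H; elim=> [|c u v Qu _ IH].
  by have := lf (-1) 0 0; rewrite scaler0 addr0 scaleN1r addNr => ->; apply: lspan_zero.
by rewrite lf; apply: lspanD => //; apply/lspanZ/H.
Qed.

Lemma lspan_sub (k : fieldType) (V : lmodType k) (Q Q' : V -> Prop) x :
  (forall u, Q u -> Q' u) -> lspan Q x -> lspan Q' x.
Proof. by move=> H; apply: (lspan_map (f := id)) => // u /H /lspan_mem. Qed.

Section LinearSpanAlgebra.
Variables (k : fieldType) (A : algType k) (Q Q' : A -> Prop).

Lemma lspan_mull z x : (forall u, Q u -> lspan Q' (z * u)) -> lspan Q x -> lspan Q' (z * x).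
Proof. by apply: lspan_map => c u v; rewrite mulrDr scalerAr. Qed.

Lemma lspan_mulr z x : (forall u, Q u -> lspan Q' (u * z)) -> lspan Q x -> lspan Q' (x * z).
Proof. by apply: (lspan_map (f := fun x => x * z)) => c u v; rewrite mulrDl scalerAl. Qed.

End LinearSpanAlgebra.

(** * Moving an element past powers and products *)

Section SkewPower.
Variables (k : fieldType) (A : algType k).

Lemma skew_exprr (x z : A) (a : k) m : x * z = a *: (z * x) ->
  x * z ^+ m = a ^+ m *: (z ^+ m * x).
Proof.
move=> H; elim: m => [|m IH]; first by rewrite !expr0 scale1r mulr1 mul1r.
by rewrite [z ^+ _]exprS mulrA H -scalerAl -[z * x * _]mulrA IH -scalerAr scalerA -[a * _]exprS mulrA.
Qed.

Lemma skew_prodr (x : A) (I : eqType) (r : seq I) (f : I -> A) :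
  (forall i, i \in r -> exists a : k, x * f i = a *: (f i * x)) ->
  exists a : k, x * \prod_(i <- r) f i = a *: (\prod_(i <- r) f i * x).
Proof.
elim: r => [|i r IH] H.
  by exists 1; rewrite big_nil scale1r mulr1 mul1r.
have [|a Ha] := IH; first by move=> j jr; apply: H; rewrite inE jr orbT.
have [b Hb] := H i (mem_head i r); exists (b * a).
by rewrite big_cons mulrA Hb -scalerAl -[f i * x * _]mulrA Ha -scalerAr scalerA mulrA.
Qed.

Lemma prod_insert (x : A) (f : nat -> A) i m : (i < m)%N ->
  (forall j, (j < m)%N -> x * f j = f j * x) ->
  x * \prod_(j < m) f j = \prod_(j < m) (if val j == i then x * f j else f j).
Proof.
have pass m' : (forall j, (j < m')%N -> x * f j = f j * x) ->
    x * \prod_(j < m') f j = \prod_(j < m') f j * x.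
  elim: m' => [|m' IH] H; first by rewrite big_ord0 mul1r mulr1.
  rewrite big_ord_recr /= mulrA IH; last by move=> j /ltnW; apply: H.
  by rewrite -mulrA H // mulrA.
elim: m => // m IH; rewrite ltnS leq_eqVlt => /orP[/eqP -> | im] H.
  rewrite !big_ord_recr /= eqxx mulrA pass; last by move=> j /ltnW; apply: H.
  rewrite -mulrA; congr (_ * _); apply: eq_bigr => j _.
  by rewrite ltn_eqF.
rewrite !big_ord_recr /= mulrA IH //; last by move=> j /ltnW; apply: H.
by rewrite gtn_eqF.
Qed.

End SkewPower.

(** * Ordered monomials in root vectors *)

Section PBW.
Variables (k : fieldType) (A : algType k) (t : k).
Hypotheses (t0 : t != 0) (t2 : t + t^-1 != 0).
Variables (n : nat) (E : nat -> A).
Hypothesis far : forall i j, (i < n)%N -> (j < n)%N -> (i.+1 < j)%N -> E i * E j = E j * E i.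
Hypothesis serre_up : forall i, (i.+1 < n)%N -> serre t (E i) (E i.+1).
Hypothesis serre_dn : forall i, (i.+1 < n)%N -> serre t (E i.+1) (E i).

Notation qroot := (qroot t E).

Definition rowmon (b : nat -> nat) l m := \prod_(j < m) qroot l j ^+ b j.

(** Root vectors are ordered by first letter, then by length. The leftmost factor of row [l] is thus
    a power of E_l, which absorbs a further E_l from the left. *)
Fixpoint umon (b : nat -> nat -> nat) l r :=
  if r is r'.+1 then rowmon (b l) l r * umon b l.+1 r' else 1.

Definition umon_le M l r (x : A) :=
  exists2 b : nat -> nat -> nat, (forall i j, (b i j <= M)%N) & x = umon b l r.

Lemma eq_umon b b' l r : (forall i j, (l <= i)%N -> b i j = b' i j) ->
  umon b l r = umon b' l r.
Proof.
elim: r l => //= r IH l H; congr (_ * _).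
  by apply: eq_bigr => j _; rewrite H.
by apply: IH => i j /ltnW /H.
Qed.

(** Crossing one factor creates the next root vector of the row, by the definition of [qroot]. That
    vector q-commutes with the remaining factors, so all the extra terms are proportional. *)
Lemma qroot_split_power l j a : (l + j.+1 < n)%N -> exists s : k,
  E (l + j.+1)%N * qroot l j ^+ a =
  t ^+ a *: (qroot l j ^+ a * E (l + j.+1)%N) +
  s *: (if a is a'.+1 then qroot l j ^+ a' * qroot l j.+1 else 0).
Proof.
move=> ln; set x := E _; set e := qroot l j; set e' := qroot l j.+1.
have xe : x * e = t *: (e * x) + e' by rewrite /e' /= /qcomm addrC subrK.
have ee' : e' * e = t^-1 *: (e * e').
  by rewrite /e (qroot_root t0 t2 far serre_up serre_dn (ltnSn j) ln) scalerA mulVf // scale1r.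
elim: a => [|a [s IH]].
  by exists 0; rewrite !expr0 scale1r scale0r addr0 mul1r mulr1.
(* The newest crossing contributes t^a; the earlier extra term, absent for a = 0, picks up t^-1 on
   passing one more factor. *)
exists (t ^+ a + s * t^-1 * (a != 0)%:R).
rewrite {1}exprSr mulrA IH mulrDl -scalerAl -[_ * x * e]mulrA xe mulrDr scalerDr -addrA.
congr (_ + _); first by rewrite -scalerAr scalerA -exprSr mulrA -exprSr.
rewrite scalerDl; congr (_ + _).
case: a {IH} => [|a] /=; first by rewrite scaler0 mul0r mulr0 scale0r.
by rewrite mulr1 -scalerAl -mulrA ee' -scalerAr scalerA [in RHS]exprSr mulrA.
Qed.

Definition shift_exp (b : nat -> nat) j x :=
  if x == j then (b j).-1 else if x == j.+1 then (b j.+1).+1 else b x.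

(** E_(l+j+1) commutes up to a scalar with every root vector of the row except [qroot l j], so
    crossing the row replaces at most one factor, by its right neighbour. *)
Lemma rowmon_split l m b j : (j.+1 < m)%N -> (l + m <= n)%N -> exists s s' : k,
  E (l + j.+1)%N * rowmon b l m =
  s *: (rowmon b l m * E (l + j.+1)%N) + s' *: (rowmon (shift_exp b j) l m).
Proof.
move=> jm lmn; have ljn : (l + j.+1 < n)%N by lia.
move: jm lmn; set x := E _.
have pass j' : (l + j' < n)%N -> (j' != j) -> exists a, x * qroot l j' ^+ b j' = a *: (qroot l j' ^+ b j' * x).
  move=> ln j'j; case: (ltngtP j' j.+1) => lt.
  - exists 1; rewrite -[1](expr1n k (b j')); apply: skew_exprr; rewrite scale1r.
    have lt' : (j' < j)%N by rewrite ltn_neqAle j'j -ltnS.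
    by rewrite -(qroot_right t0 t2 far) //; rewrite ?ltnS //; lia.
  - exists 1; rewrite -[1](expr1n k (b j')); apply: skew_exprr; rewrite scale1r.
    by rewrite (qroot_middle t0 t2 far serre_up serre_dn) //; lia.
  - exists (t^-1 ^+ b j'); apply: skew_exprr; rewrite lt.
    by rewrite (qroot_last t0 t2 far serre_dn) // -lt.
have pre m' : (m' <= j)%N -> (l + m' <= n)%N -> exists a, x * rowmon b l m' = a *: (rowmon b l m' * x).
  move=> m'j lm'.
  by apply: skew_prodr => i _; apply: pass; have := ltn_ord i; lia.
elim: m => // m IH jm lmn.
rewrite /rowmon !big_ord_recr /= -/(rowmon b l m) -/(rowmon (shift_exp b j) l m).
have [eqm|ltm] := eqVneq m j.+1; last first.
  case: IH => [||s [s' IH']]; [by lia | by lia |].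
  case: (pass m) => [||a Ha]; [by lia | by lia |].
  exists (s * a), s'.
  rewrite mulrA IH' mulrDl -!scalerAl -!mulrA Ha -!scalerAr !scalerA; congr (_ + _ *: (_ * _)).
  by rewrite /shift_exp; do 2 (case: ifP => [/eqP ?|_]; first by lia).
rewrite eqm /rowmon !big_ord_recr /= -/(rowmon b l j) -/(rowmon (shift_exp b j) l j).
case: (pre j) => [||a Ha]; [by lia | by lia |].
case: (@qroot_split_power l j (b j)) => [|s Hs]; first by lia.
case: (pass j.+1) => [||a' Ha']; [by lia | by lia |].
(* With exponent 0 there is nothing to split, and [shift_exp] would still raise the neighbour
   because the predecessor of 0 is 0; the coefficient must vanish. *)
exists (a * t ^+ b j * a'), (if b j is 0 then 0 else a * s).
rewrite -mulrA mulrA Ha -scalerAl -[_ * x * _]mulrA [x * _]mulrA Hs.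
rewrite mulrDl mulrDr scalerDr; congr (_ + _).
  by rewrite -!scalerAl -!mulrA Ha' -!scalerAr !scalerA !mulrA.
have -> : rowmon (shift_exp b j) l j = rowmon b l j.
  apply: eq_bigr => i _; have ij := ltn_ord i.
  by rewrite /shift_exp; do 2 (case: ifP => [/eqP ?|_]; first by lia).
rewrite /shift_exp !eqxx (gtn_eqF (ltnSn j)).
case: (b j) => [|c] /=; first by rewrite scaler0 mul0r mulr0 scaler0 scale0r.
by rewrite -scalerAl -scalerAr scalerA exprS !mulrA.
Qed.

Lemma rowmon_recl b l m : rowmon b l m.+1 = E l ^+ b 0 * \prod_(j < m) qroot l j.+1 ^+ b j.+1.
Proof. by rewrite /rowmon big_ord_recl. Qed.

(** A letter either merges into its own row, or changes one factor of the current row, or passes to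
    the rows below; in each case no exponent grows by more than one. *)
Lemma umon_step M l r i x : (l + r = n)%N -> (l <= i)%N -> (i < n)%N ->
  umon_le M l r x -> lspan (umon_le M.+1 l r) (E i * x).
Proof.
elim: r l x => [|r IH] l x lrn li ilt [b bM ->]; first by lia.
have [->|il] := eqVneq i l.
  apply: lspan_mem.
  exists (fun i' j => if (i' == l) && (j == 0%N) then (b l 0).+1 else b i' j).
    by move=> i' j; case: ifP => // _; rewrite ?ltnS // leqW.
  rewrite /= !rowmon_recl eqxx /= exprS -!mulrA; do 3 congr (_ * _).
  by apply: eq_umon => i' j; case: eqP => //; lia.
have [j ij] : exists j, i = (l + j.+1)%N by exists (i - l.+1)%N; lia.
rewrite /= mulrA.
case: (@rowmon_split l r.+1 (b l) j) => [||s [s' ]]; [by lia | by lia |].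
rewrite -ij => ->; rewrite mulrDl; apply: lspanD; rewrite -scalerAl; apply: lspanZ.
  rewrite -mulrA.
  have : lspan (umon_le M.+1 l.+1 r) (E i * umon b l.+1 r).
    by apply: IH; [lia | lia | lia | exists b].
  apply: lspan_mull => u [b' b'M ->]; apply: lspan_mem.
  exists (fun i' => if i' == l then b l else b' i').
    by move=> i' j'; case: ifP => // _; apply: leqW.
  rewrite /= eqxx; congr (_ * _).
  by apply: eq_umon => i' j'; case: eqP => //; lia.
apply: lspan_mem.
exists (fun i' => if i' == l then shift_exp (b l) j else b i').
  move=> i' j'; case: ifP => _; last exact: leqW.
  rewrite /shift_exp; have := bM l j; have := bM l j.+1; have := bM l j'.
  by case: (j' == j); case: (j' == j.+1); lia.
rewrite /= eqxx; congr (_ * _).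
by apply: eq_umon => i' j'; case: eqP => //; lia.
Qed.

Definition word (s : seq nat) := \prod_(i <- s) E i.

Lemma word_span s : all (fun i => i < n)%N s -> lspan (umon_le (size s) 0 n) (word s).
Proof.
elim: s => [_|i s IH /= /andP[ilt /IH H]]; rewrite /word.
  rewrite big_nil; apply: lspan_mem; exists (fun _ _ => 0%N) => //.
  have rm l m : rowmon (fun _ => 0%N) l m = 1.
    by rewrite /rowmon big1 // => j _; rewrite expr0.
  have um l r : umon (fun _ _ => 0%N) l r = 1.
    by elim: r l => //= r IH l; rewrite rm IH mulr1.
  by rewrite um.
rewrite big_cons; apply: lspan_mull H => u; exact: umon_step.
Qed.

End PBW.

(** * PBW spanning *)

Definition cartann (i j : nat) : int :=
  if i == j then 2 else if (i.+1 == j) || (j.+1 == i) then -1 else 0.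

Lemma cartannC i j : cartann i j = cartann j i.
Proof. by rewrite /cartann eq_sym orbC. Qed.

Lemma cartann_adj i j : (i.+1 == j) || (j.+1 == i) -> cartann i j = -1.
Proof. by rewrite /cartann => H; case: eqP => [ij|_]; [lia | rewrite H]. Qed.

Lemma cartann_far i j : (i.+1 < j)%N -> cartann i j = 0.
Proof. by rewrite /cartann => H; case: eqP => [ij|_]; [lia | case: orP => //; lia]. Qed.

Lemma word_cons (k : fieldType) (A : algType k) (E : nat -> A) i s :
  word E (i :: s) = E i * word E s.
Proof. exact: big_cons. Qed.

Section UqRelations.
Variables (k : fieldType) (q : k).

Definition serre_family n (A : algType k) (E : nat -> A) : Prop :=
  [/\ forall i j, (i < n)%N -> (j < n)%N -> (i.+1 < j)%N -> E i * E j = E j * E i,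
      forall i, (i.+1 < n)%N -> serre q (E i) (E i.+1)
    & forall i, (i.+1 < n)%N -> serre q (E i.+1) (E i)].

Record uqrel n (A : algType k) (E F K Ki : nat -> A) : Prop := UqRel {
  uq_KKi : forall i, (i < n)%N -> K i * Ki i = 1;
  uq_KiK : forall i, (i < n)%N -> Ki i * K i = 1;
  uq_KK : forall i j, (i < n)%N -> (j < n)%N -> K i * K j = K j * K i;
  uq_KE : forall i j, (i < n)%N -> (j < n)%N ->
    K i * E j = q ^ cartann i j *: (E j * K i);
  uq_KF : forall i j, (i < n)%N -> (j < n)%N ->
    K i * F j = q ^ (- cartann i j) *: (F j * K i);
  uq_EF : forall i j, (i < n)%N -> (j < n)%N ->
    E i * F j - F j * E i = if i == j then (q - q^-1)^-1 *: (K i - Ki i) else 0;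
  uq_E : serre_family n E;
  uq_F : serre_family n F }.

Hypothesis q0 : q != 0.

Lemma serre_familyV n (A : algType k) (E : nat -> A) :
  serre_family n E ->
  [/\ forall i j, (i < n)%N -> (j < n)%N -> (i.+1 < j)%N -> E i * E j = E j * E i,
      forall i, (i.+1 < n)%N -> serre q^-1 (E i) (E i.+1)
    & forall i, (i.+1 < n)%N -> serre q^-1 (E i.+1) (E i)].
Proof.
by case=> far up dn; split=> // i; [move=> /up | move=> /dn];
  rewrite /serre invrK [q^-1 + q]addrC.
Qed.

Lemma comm_scale_inv (A : algType k) (u v x : A) (a : k) : a != 0 -> u * v = 1 -> v * u = 1 ->
  u * x = a *: (x * u) -> v * x = a^-1 *: (x * v).
Proof.
move=> a0 uv vu ux; apply: (scalerI a0); rewrite scalerA mulfV // scale1r.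
rewrite -[LHS]mulr1 -uv -scalerAl !mulrA -[v * x * u]mulrA scalerAl scalerAr -ux.
by rewrite !mulrA vu mul1r.
Qed.

Section Words.
Variables (n : nat) (A : algType k) (E F K Ki : nat -> A).
Hypothesis rel : uqrel n E F K Ki.

Lemma uq_KiE i j : (i < n)%N -> (j < n)%N ->
  Ki i * E j = (q ^ cartann i j)^-1 *: (E j * Ki i).
Proof.
move=> il jl; apply: (comm_scale_inv _ (uq_KKi rel il) (uq_KiK rel il)).
  exact: expfz_neq0.
exact: (uq_KE rel).
Qed.

Lemma uq_KiF i j : (i < n)%N -> (j < n)%N ->
  Ki i * F j = (q ^ (- cartann i j))^-1 *: (F j * Ki i).
Proof.
move=> il jl; apply: (comm_scale_inv _ (uq_KKi rel il) (uq_KiK rel il)).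
  exact: expfz_neq0.
exact: (uq_KF rel).
Qed.

Lemma uq_KiKj i j : (i < n)%N -> (j < n)%N -> Ki i * K j = K j * Ki i.
Proof.
move=> il jl; rewrite (comm_scale_inv _ (uq_KKi rel il) (uq_KiK rel il) (a := 1)) ?oner_neq0 //.
  by rewrite invr1 scale1r.
by rewrite scale1r (uq_KK rel).
Qed.

Lemma uq_KiKi i j : (i < n)%N -> (j < n)%N -> Ki i * Ki j = Ki j * Ki i.
Proof.
move=> il jl; symmetry.
rewrite (comm_scale_inv _ (uq_KKi rel jl) (uq_KiK rel jl) (a := 1)) ?oner_neq0 //.
  by rewrite invr1 scale1r.
by rewrite scale1r uq_KiKj.
Qed.

(** [A] carries no inversion, so negative powers are powers of the given inverse [Ki i]; recall that
    [Negz m] is -(m+1). *)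
Definition kpow i (z : int) : A :=
  match z with Posz m => K i ^+ m | Negz m => Ki i ^+ m.+1 end.

Definition kmon (c : nat -> int) : A := \prod_(i < n) kpow i (c i).

Lemma kpowS i z : (i < n)%N -> K i * kpow i z = kpow i (z + 1).
Proof.
move=> il; case: z => [m | [|m]].
- by rewrite (_ : Posz m + 1 = Posz m.+1) /= ?exprS //; lia.
- by rewrite /= expr1 (uq_KKi rel).
- rewrite (_ : Negz m.+1 + 1 = Negz m); last by lia.
  by rewrite /= exprS mulrA (uq_KKi rel) // mul1r.
Qed.

Lemma kpowP i z : (i < n)%N -> Ki i * kpow i z = kpow i (z - 1).
Proof.
move=> il; case: z => [[|m] | m].
- by rewrite /= expr0 mulr1 expr1.
- rewrite (_ : Posz m.+1 - 1 = Posz m); last by lia.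
  by rewrite /= exprS mulrA (uq_KiK rel) // mul1r.
- rewrite (_ : Negz m - 1 = Negz m.+1); last by lia.
  by rewrite /= [in RHS]exprS.
Qed.

Lemma kpow_skew x i z (a : k) : (i < n)%N -> a != 0 -> x * K i = a *: (K i * x) ->
  exists b : k, x * kpow i z = b *: (kpow i z * x).
Proof.
move=> il a0 H; case: z => m.
  by exists (a ^+ m); apply: skew_exprr.
exists (a^-1 ^+ m.+1); apply: skew_exprr.
have H' : K i * x = a^-1 *: (x * K i) by rewrite H scalerA mulVf // scale1r.
have := comm_scale_inv (invr_neq0 a0) (uq_KKi rel il) (uq_KiK rel il) H'.
by rewrite invrK => ->; rewrite scalerA mulVf // scale1r.
Qed.

Lemma kpow_comm i j z : (i < n)%N -> (j < n)%N ->
  K i * kpow j z = kpow j z * K i /\ Ki i * kpow j z = kpow j z * Ki i.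
Proof.
move=> il jl; case: z => m /=; split; apply: commrX; rewrite /GRing.comm.
- exact: (uq_KK rel).
- exact: uq_KiKj.
- by rewrite uq_KiKj.
- exact: uq_KiKi.
Qed.

Definition add_at (c : nat -> int) i (z : int) j := if j == i then c j + z else c j.

Lemma kmonS i c : (i < n)%N -> K i * kmon c = kmon (add_at c i 1).
Proof.
move=> il; rewrite /kmon (@prod_insert _ _ _ (fun j => kpow j (c j)) i) //.
  apply: eq_bigr => j _; rewrite /add_at; case: eqP => // ji.
  by rewrite ji kpowS.
by move=> j jl; case: (kpow_comm (c j) il jl).
Qed.

Lemma kmonP i c : (i < n)%N -> Ki i * kmon c = kmon (add_at c i (-1)).
Proof.
move=> il; rewrite /kmon (@prod_insert _ _ _ (fun j => kpow j (c j)) i) //.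
  apply: eq_bigr => j _; rewrite /add_at; case: eqP => // ji.
  by rewrite ji kpowP.
by move=> j jl; case: (kpow_comm (c j) il jl).
Qed.

Lemma E_kmon i c : (i < n)%N -> exists a : k, E i * kmon c = a *: (kmon c * E i).
Proof.
move=> il; apply: skew_prodr => j _.
apply: (@kpow_skew _ _ _ (q ^ cartann j i)^-1) => //.
  by rewrite invr_eq0 expfz_neq0.
by rewrite (uq_KE rel) // scalerA mulVf ?scale1r // expfz_neq0.
Qed.

Notation below s := (all (fun i => i < n)%N s).

Lemma K_word i s : (i < n)%N -> below s -> exists a b : k,
  K i * word F s = a *: (word F s * K i) /\ Ki i * word F s = b *: (word F s * Ki i).
Proof.
move=> il /allP H.
have [j js|a Ha] := @skew_prodr _ _ (K i) _ s F.
  by eexists; apply: (uq_KF rel il); apply: H.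
have [j js|b Hb] := @skew_prodr _ _ (Ki i) _ s F.
  by eexists; apply: (uq_KiF il); apply: H.
by exists a, b.
Qed.

Definition fk_term m (x : A) := exists s i, [/\ below s, (size s <= m)%N, (i < n)%N
  & x = word F s * K i \/ x = word F s * Ki i].

(** Only the commutator of E_i with F_i is nonzero. It is a combination of K_i and its inverse,
    which move to the right end of the word up to a scalar. *)
Lemma E_word i s : (i < n)%N -> below s ->
  lspan (fk_term (size s)) (E i * word F s - word F s * E i).
Proof.
move=> il; elim: s => [_|j s IH /= /andP[jl sl]].
  by rewrite /word !big_nil mulr1 mul1r subrr; apply: lspan_zero.
rewrite word_cons.
have -> : E i * (F j * word F s) - F j * word F s * E i =
   F j * (E i * word F s - word F s * E i) + (E i * F j - F j * E i) * word F s.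
  by ncpoly k; ring.
apply: lspanD.
  apply: lspan_mull (IH sl) => u [s' [i' [s'l ss i'l H]]]; apply: lspan_mem.
  exists (j :: s'), i'; split=> //=; first by rewrite jl.
  by rewrite word_cons -!mulrA; case: H => ->; [left | right].
rewrite (uq_EF rel) //; case: ifP => _; last by rewrite mul0r; apply: lspan_zero.
rewrite -scalerAl mulrBl; apply: lspanZ; have [a [b [-> ->]]] := K_word il sl.
apply: lspanB; apply: lspanZ; apply: lspan_mem; exists s, i; split=> //.
- by left.
- by right.
Qed.

Definition fke_term M (x : A) := exists fs c es,
  [/\ below fs && below es, (size fs <= M)%N, (size es <= M)%N, (forall i, `|c i| <= M)%N
    & x = word F fs * kmon c * word E es].

Definition uq_gen (x : A) := exists i, (i < n)%N /\ [\/ x = E i, x = F i, x = K i | x = Ki i].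

Lemma absz_add_at c i z j M : (`|z| <= 1)%N -> (forall i, `|c i| <= M)%N ->
  (`|add_at c i z j| <= M.+1)%N.
Proof. by move=> z1 /(_ j); rewrite /add_at; case: ifP; lia. Qed.

Lemma fke_step M g x : uq_gen g -> fke_term M x -> lspan (fke_term M.+1) (g * x).
Proof.
move=> [i [il Hg]] [fs [c [es [/andP[fl el] fM eM cM ->]]]].
have cM' j : (`|c j| <= M.+1)%N by apply: leqW.
case: Hg => ->.
- have -> : E i * (word F fs * kmon c * word E es) =
     word F fs * (E i * kmon c) * word E es
     + (E i * word F fs - word F fs * E i) * (kmon c * word E es).
    by ncpoly k; ring.
  apply: lspanD.
    have [a ->] := E_kmon c il.
    rewrite -scalerAr -scalerAl; apply: lspanZ; apply: lspan_mem.
    exists fs, c, (i :: es); split=> //=; rewrite ?fl ?il ?leqW //.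
    by rewrite word_cons !mulrA.
  apply: lspan_mulr (E_word il fl) => u [s [j [sl ss jl H]]]; apply: lspan_mem.
  case: H => ->; rewrite -mulrA (mulrA _ (kmon c)) ?kmonS ?kmonP // mulrA.
    by exists s, (add_at c j 1), es; split=> //; [apply/andP | lia | lia | move=> ?; apply: absz_add_at].
  by exists s, (add_at c j (-1)), es; split=> //; [apply/andP | lia | lia | move=> ?; apply: absz_add_at].
- apply: lspan_mem; exists (i :: fs), c, es; split=> //=; rewrite ?fl ?el ?il ?leqW //.
  by rewrite word_cons !mulrA.
- have [a [b [Ha _]]] := K_word il fl.
  rewrite !mulrA Ha -!scalerAl; apply: lspanZ; apply: lspan_mem.
  rewrite -(mulrA (word F fs)) kmonS //.
  by exists fs, (add_at c i 1), es; split=> //; [apply/andP | lia | lia | move=> ?; apply: absz_add_at].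
- have [a [b [_ Hb]]] := K_word il fl.
  rewrite !mulrA Hb -!scalerAl; apply: lspanZ; apply: lspan_mem.
  rewrite -(mulrA (word F fs)) kmonP //.
  by exists fs, (add_at c i (-1)), es; split=> //; [apply/andP | lia | lia | move=> ?; apply: absz_add_at].
Qed.

(** The F-root vectors use q^-1, which the symmetry of the Serre relation under inversion of q
    allows: the dominant exponents of the F_i commute with signs opposite to those of the E_i
    ([Fexp_next], [Eexp_next]), and leading terms are found only if the parameter of [qcomm] matches
    that sign. *)
Definition pbwmon (a : nat -> nat -> nat) (c : nat -> int) (b : nat -> nat -> nat) : A :=
  umon q^-1 F a 0 n * kmon c * umon q E b 0 n.

Definition pbw_le M (x : A) := exists a c b, [/\ forall i j, (a i j <= M)%N,
  forall i, (`|c i| <= M)%N, forall i j, (b i j <= M)%N & x = pbwmon a c b].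

Hypothesis q2 : q + q^-1 != 0.

Lemma fke_pbw M x : fke_term M x -> lspan (pbw_le M) x.
Proof.
move=> [fs [c [es [/andP[fl el] fM eM cM ->]]]].
have [farE upE dnE] := uq_E rel; have [farF upF dnF] := serre_familyV (uq_F rel).
have q2' : q^-1 + q^-1^-1 != 0 by rewrite invrK addrC.
have qv0 : q^-1 != 0 by rewrite invr_eq0.
rewrite -mulrA.
apply: lspan_mulr (word_span qv0 q2' farF upF dnF fl) => v [a aM ->]; rewrite mulrA.
apply: lspan_mull (word_span q0 q2 farE upE dnE el) => u [b bM ->]; apply: lspan_mem.
exists a, c, b; split=> // i j; [exact: leq_trans (aM i j) fM | exact: leq_trans (bM i j) eM].
Qed.

Lemma gens_span (gs : seq A) : (forall g, g \in gs -> uq_gen g) ->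
  lspan (pbw_le (size gs)) (\prod_(g <- gs) g).
Proof.
move=> H; suff : lspan (fke_term (size gs)) (\prod_(g <- gs) g).
  by move=> Hs; rewrite -[X in lspan _ X]mul1r; apply: lspan_mull Hs => u; rewrite mul1r; apply: fke_pbw.
elim: gs H => [_|g gs IH H].
  rewrite big_nil; apply: lspan_mem; exists [::], (fun=> 0), [::]; split=> //.
  by rewrite /word !big_nil /kmon big1 ?mulr1 // => i _; rewrite /= expr0.
rewrite big_cons; apply: lspan_mull (IH _) => [u Hu|g' g'gs].
  by apply: fke_step Hu; apply: H; rewrite mem_head.
by apply: H; rewrite inE g'gs orbT.
Qed.

End Words.
End UqRelations.

(** * The coproduct *)

Section Coproduct.
Variables (k : fieldType) (q : k).
Hypothesis q0 : q != 0.

(** * Serre relations for products and sums *)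

Section Serre.
Variables (A : algType k).

Lemma mul_commACA (u x v y : A) : x * v = v * x -> (u * x) * (v * y) = (u * v) * (x * y).
Proof. by move=> xv; rewrite -mulrA (mulrA x) xv !mulrA. Qed.

(** The commuting factors come out of the Serre polynomial as u^2 v. *)
Lemma serre_mul (u v x y : A) : u * v = v * u -> x * u = u * x -> x * v = v * x ->
  y * u = u * y -> serre q x y -> serre q (u * x) (v * y).
Proof.
move=> uv xu xv yu H; rewrite /serre.
have xxv : x * x * v = v * (x * x) by rewrite -mulrA xv mulrA xv mulrA.
have xyu : x * y * u = u * (x * y) by rewrite -mulrA yu mulrA xu mulrA.
have yxu : y * x * u = u * (y * x) by rewrite -mulrA xu mulrA yu mulrA.
rewrite (mul_commACA u x xu) (mul_commACA _ _ xxv).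
rewrite (mul_commACA u y xv) (mul_commACA _ _ xyu).
rewrite (mul_commACA v x yu) (mul_commACA _ _ yxu).
have uvu : u * v * u = u * u * v by rewrite -!mulrA uv.
have vuu : v * u * u = u * u * v by rewrite -uv uvu.
by rewrite uvu vuu scalerAr -mulrBr -mulrDr H mulr0.
Qed.

(** The pure parts of the Serre polynomial of the sums vanish by hypothesis; the mixed parts lie in
    the ideal of the three q-commutation relations [R1], [R2], [R3], with the coefficients displayed
    below. *)
Lemma serre_add (a b a' b' : A) : serre q a a' -> serre q b b' ->
  b * a = q ^+ 2 *: (a * b) -> b * a' = q^-1 *: (a' * b) -> b' * a = q^-1 *: (a * b') ->
  serre q (a + b) (a' + b').
Proof.
rewrite /serre => Ha Hb r1 r2 r3.
pose R1 := b * a - q ^+ 2 *: (a * b).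
pose R2 := b * a' - q^-1 *: (a' * b).
pose R3 := b' * a - q^-1 *: (a * b').
have R10 : R1 = 0 by rewrite /R1 r1 subrr.
have R20 : R2 = 0 by rewrite /R2 r2 subrr.
have R30 : R3 = 0 by rewrite /R3 r3 subrr.
transitivity ((a * a * a' - (q + q^-1) *: (a * a' * a) + a' * a * a)
  + (b * b * b' - (q + q^-1) *: (b * b' * b) + b' * b * b)
  + (R3 * a - q *: (a * R3)) + (b * R2 - q *: (R2 * b))
  + (a * R2 + R1 * a' + q ^+ 2 *: (a * R2) - (q + q^-1) *: (R2 * a + q^-1 *: (a' * R1)) + a' * R1)
  + (R1 * b' - (q + q^-1) *: (b * R3 + q^-1 *: (R1 * b')) + R3 * b + b' * R1 + q ^+ 2 *: (R3 * b))).
  rewrite /R1 /R2 /R3; ncpoly k; by field.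
by rewrite Ha Hb R10 R20 R30 !(mul0r, mulr0, scaler0, addr0, subr0).
Qed.

End Serre.

Section Sum.
Variables (n : nat) (A : algType k) (E1 F1 K1 Ki1 E2 F2 K2 Ki2 : nat -> A).
Hypotheses (rel1 : uqrel q n E1 F1 K1 Ki1) (rel2 : uqrel q n E2 F2 K2 Ki2).
Hypothesis comm : forall x y,
  uq_gen n E1 F1 K1 Ki1 x -> uq_gen n E2 F2 K2 Ki2 y -> x * y = y * x.

Let gE1 i : (i < n)%N -> uq_gen n E1 F1 K1 Ki1 (E1 i). Proof. by exists i; split=> //; apply: Or41. Qed.
Let gF1 i : (i < n)%N -> uq_gen n E1 F1 K1 Ki1 (F1 i). Proof. by exists i; split=> //; apply: Or42. Qed.
Let gK1 i : (i < n)%N -> uq_gen n E1 F1 K1 Ki1 (K1 i). Proof. by exists i; split=> //; apply: Or43. Qed.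
Let gKi1 i : (i < n)%N -> uq_gen n E1 F1 K1 Ki1 (Ki1 i). Proof. by exists i; split=> //; apply: Or44. Qed.
Let gE2 i : (i < n)%N -> uq_gen n E2 F2 K2 Ki2 (E2 i). Proof. by exists i; split=> //; apply: Or41. Qed.
Let gF2 i : (i < n)%N -> uq_gen n E2 F2 K2 Ki2 (F2 i). Proof. by exists i; split=> //; apply: Or42. Qed.
Let gK2 i : (i < n)%N -> uq_gen n E2 F2 K2 Ki2 (K2 i). Proof. by exists i; split=> //; apply: Or43. Qed.
Let gKi2 i : (i < n)%N -> uq_gen n E2 F2 K2 Ki2 (Ki2 i). Proof. by exists i; split=> //; apply: Or44. Qed.

(** The coproduct of U_q, with two commuting families inside one algebra in the role of the two
    tensor factors. *)
Definition coE i := E1 i + K1 i * E2 i.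
Definition coF i := F2 i + F1 i * Ki2 i.
Definition coK i := K1 i * K2 i.
Definition coKi i := Ki1 i * Ki2 i.

Lemma coE_swap i j : (i < n)%N -> (j < n)%N ->
  K1 i * E2 i * E1 j = q ^ cartann i j *: (E1 j * (K1 i * E2 i)).
Proof.
move=> il jl; rewrite -mulrA -(comm (gE1 jl) (gE2 il)) mulrA (uq_KE rel1) //.
by rewrite -scalerAl -mulrA.
Qed.

Lemma coF_swap i j : (i < n)%N -> (j < n)%N ->
  F1 i * Ki2 i * F2 j = q ^ cartann i j *: (F2 j * (F1 i * Ki2 i)).
Proof.
move=> il jl; rewrite -mulrA (uq_KiF q0 rel2) // -scalerAr (mulrA (F1 i)) (comm (gF1 il) (gF2 jl)).
by rewrite -mulrA -invr_expz invrK.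
Qed.

Lemma coE_serre i j : (i < n)%N -> (j < n)%N -> (i.+1 == j) || (j.+1 == i) ->
  serre q (E1 i) (E1 j) -> serre q (E2 i) (E2 j) -> serre q (coE i) (coE j).
Proof.
move=> il jl ij s1 s2; have cij := cartann_adj ij.
have cji : cartann j i = -1 by rewrite cartannC.
apply: serre_add => //.
- apply: serre_mul s2; try by rewrite (comm (gK1 _) (gE2 _)).
  exact: (uq_KK rel1).
- by rewrite coE_swap // /cartann eqxx.
- by rewrite coE_swap // cij.
- by rewrite coE_swap // cji.
Qed.

Lemma coF_serre i j : (i < n)%N -> (j < n)%N -> (i.+1 == j) || (j.+1 == i) ->
  serre q (F1 i) (F1 j) -> serre q (F2 i) (F2 j) -> serre q (coF i) (coF j).
Proof.
move=> il jl ij s1 s2; have cij := cartann_adj ij.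
have cji : cartann j i = -1 by rewrite cartannC.
apply: serre_add => //.
- rewrite (comm (gF1 il) (gKi2 il)) (comm (gF1 jl) (gKi2 jl)).
  apply: serre_mul s1; try by rewrite (comm (gF1 _) (gKi2 _)).
  exact: (uq_KiKi rel2).
- by rewrite coF_swap // /cartann eqxx.
- by rewrite coF_swap // cij.
- by rewrite coF_swap // cji.
Qed.

Lemma add_comm (a b a' b' : A) : a * a' = a' * a -> b * b' = b' * b -> b * a' = a' * b ->
  b' * a = a * b' -> (a + b) * (a' + b') = (a' + b') * (a + b).
Proof. by move=> aa bb ba' b'a; rewrite !mulrDl !mulrDr aa bb ba' b'a addrACA. Qed.

Lemma coproduct_rel : uqrel q n coE coF coK coKi.
Proof.
have [farE1 upE1 dnE1] := uq_E rel1; have [farE2 upE2 dnE2] := uq_E rel2.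
have [farF1 upF1 dnF1] := uq_F rel1; have [farF2 upF2 dnF2] := uq_F rel2.
split.
- move=> i il; rewrite /coK /coKi mul_commACA ?(uq_KKi rel1) ?(uq_KKi rel2) ?mulr1 //.
  by rewrite (comm (gKi1 il) (gK2 il)).
- move=> i il; rewrite /coK /coKi mul_commACA ?(uq_KiK rel1) ?(uq_KiK rel2) ?mulr1 //.
  by rewrite (comm (gK1 il) (gKi2 il)).
- move=> i j il jl; rewrite /coK.
  have h1 := esym (comm (gK1 jl) (gK2 il)); have h2 := esym (comm (gK1 il) (gK2 jl)).
  by rewrite (mul_commACA _ _ h1) (mul_commACA _ _ h2) (uq_KK rel1) // (uq_KK rel2).
- move=> i j il jl; rewrite /coK /coE mulrDr mulrDl scalerDr; congr (_ + _).
    by rewrite -mulrA -(comm (gE1 jl) (gK2 il)) mulrA (uq_KE rel1) // -scalerAl mulrA.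
  rewrite mul_commACA; last by rewrite (comm (gK1 jl) (gK2 il)).
  rewrite (uq_KE rel2) // (uq_KK rel1) // -scalerAr; congr (_ *: _).
  by rewrite mul_commACA // (comm (gK1 il) (gE2 jl)).
- move=> i j il jl; rewrite /coK /coF mulrDr mulrDl scalerDr; congr (_ + _).
    rewrite -mulrA (uq_KF rel2) // -scalerAr (mulrA (K1 i)) (comm (gK1 il) (gF2 jl)).
    by rewrite -mulrA.
  rewrite mul_commACA; last by rewrite (comm (gF1 jl) (gK2 il)).
  rewrite (uq_KF rel1) // -(uq_KiKj rel2 jl il) -scalerAl; congr (_ *: _).
  by rewrite mul_commACA // (comm (gK1 il) (gKi2 jl)).
- move=> i j il jl.
  (* The terms are grouped by commutators. Those between the two families vanish, and the last
     bracket vanishes because its two powers of q cancel; only [E1, F1] Ki2 and K1 [E2, F2]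
     remain. *)
  have -> : coE i * coF j - coF j * coE i =
     (E1 i * F2 j - F2 j * E1 i)
     + (E1 i * F1 j - F1 j * E1 i) * Ki2 j
     + F1 j * (E1 i * Ki2 j - Ki2 j * E1 i)
     + (K1 i * F2 j - F2 j * K1 i) * E2 i * (-1)
     + K1 i * (E2 i * F2 j - F2 j * E2 i)
     + (K1 i * F2 j - F2 j * K1 i) * E2 i * 2%:R
     + (K1 i * E2 i * F1 j * Ki2 j - F1 j * Ki2 j * K1 i * E2 i).
    rewrite /coE /coF mulr2n; ncpoly k; by ring.
  rewrite (comm (gE1 il) (gF2 jl)) (comm (gE1 il) (gKi2 jl)) (comm (gK1 il) (gF2 jl)).
  rewrite !subrr !mul0r !mulr0 !addr0 add0r.
  have -> : K1 i * E2 i * F1 j * Ki2 j - F1 j * Ki2 j * K1 i * E2 i = 0.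
    rewrite -(mulrA (K1 i)) -(comm (gF1 jl) (gE2 il)) mulrA (uq_KF rel1) //.
    rewrite -(mulrA (F1 j) (Ki2 j)) -(comm (gK1 il) (gKi2 jl)) (mulrA (F1 j)).
    rewrite -(mulrA _ (Ki2 j)) (uq_KiE q0 rel2) // -!scalerAl -scalerAr (mulrA _ (E2 i)).
    by rewrite cartannC -invr_expz subrr.
  (* For i = j the sum (K1 - Ki1) Ki2 + K1 (K2 - Ki2) telescopes to K1 K2 - Ki1 Ki2. *)
  rewrite addr0 (uq_EF rel1) // (uq_EF rel2) //; case: eqP => [->|_]; last first.
    by rewrite mul0r mulr0 addr0.
  by rewrite -scalerAl -scalerAr -scalerDr mulrBl mulrBr [X in _ *: X]addrC addrA subrK.
- split.
  + move=> i j il jl ij; apply: add_comm.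
    * exact: farE1.
    * have h1 := esym (comm (gK1 jl) (gE2 il)); have h2 := esym (comm (gK1 il) (gE2 jl)).
      by rewrite (mul_commACA _ _ h1) (mul_commACA _ _ h2) farE2 // (uq_KK rel1).
    * by rewrite coE_swap // cartann_far // expr0z scale1r.
    * by rewrite coE_swap // cartannC cartann_far // expr0z scale1r.
  + by move=> i il; apply: coE_serre; rewrite ?eqxx //; [lia | apply: upE1 | apply: upE2].
  + by move=> i il; apply: coE_serre; rewrite ?eqxx ?orbT //; [lia | apply: dnE1 | apply: dnE2].
- split.
  + move=> i j il jl ij; apply: add_comm.
    * exact: farF2.
    * have h1 := comm (gF1 jl) (gKi2 il); have h2 := comm (gF1 il) (gKi2 jl).
      by rewrite (mul_commACA _ _ (esym h1)) (mul_commACA _ _ (esym h2)) farF1 // (uq_KiKi rel2).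
    * by rewrite coF_swap // cartann_far // expr0z scale1r.
    * by rewrite coF_swap // cartannC cartann_far // expr0z scale1r.
  + by move=> i il; apply: coF_serre; rewrite ?eqxx //; [lia | apply: upF1 | apply: upF2].
  + by move=> i il; apply: coF_serre; rewrite ?eqxx ?orbT //; [lia | apply: dnF1 | apply: dnF2].
Qed.

End Sum.
End Coproduct.

(** * Operators and leading exponents *)

Section FunctionEndomorphisms.
Variables (k : fieldType) (T : zmodType).

Record fendo := FEndo {
  fendo_fun :> (T -> k) -> (T -> k);
  fendo_lin : forall (a : k) (g h : T -> k) (x : T),
    fendo_fun (fun y => a * g y + h y) x = a * fendo_fun g x + fendo_fun h x }.

Lemma fendo_eq (u v : fendo) : (forall g x, u g x = v g x) -> u = v.
Proof.
case: u v => [u ul] [v vl] /= H.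
have uv : u = v by apply/funext => g; apply/funext => x; apply: H.
by move: ul vl; rewrite uv => ul vl; congr FEndo; apply: Prop_irrelevance.
Qed.

HB.instance Definition _ := gen_eqMixin fendo.
HB.instance Definition _ := gen_choiceMixin fendo.

Local Notation lin u := (forall (a : k) (g h : T -> k) (x : T),
  u (fun y => a * g y + h y) x = a * u g x + u h x).

Fact fendo0_lin : lin (fun (_ : T -> k) (_ : T) => 0 : k).
Proof. by move=> a g h x; rewrite mulr0 addr0. Qed.
Fact fendo1_lin : lin (fun g : T -> k => g). Proof. by []. Qed.
Fact fendo_add_lin (u v : fendo) : lin (fun g x => u g x + v g x).
Proof. by move=> a g h x /=; rewrite !fendo_lin; ring. Qed.
Fact fendo_opp_lin (u : fendo) : lin (fun g x => - u g x).
Proof. by move=> a g h x /=; rewrite !fendo_lin; ring. Qed.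
Fact fendo_scale_lin (c : k) (u : fendo) : lin (fun g x => c * u g x).
Proof. by move=> a g h x /=; rewrite !fendo_lin; ring. Qed.
Fact fendo_mul_lin (u v : fendo) : lin (fun g => u (v g)).
Proof.
move=> a g h x /=; rewrite -fendo_lin; congr (fendo_fun u _ x).
by apply/funext => y; rewrite fendo_lin.
Qed.

Definition fendo_add u v := FEndo (fendo_add_lin u v).
Definition fendo_opp u := FEndo (fendo_opp_lin u).
Definition fendo_scale c u := FEndo (fendo_scale_lin c u).
Definition fendo_mul u v := FEndo (fendo_mul_lin u v).

Fact fendo_addA : associative fendo_add.
Proof. by move=> u v w; apply: fendo_eq => g x /=; rewrite addrA. Qed.
Fact fendo_addC : commutative fendo_add.
Proof. by move=> u v; apply: fendo_eq => g x /=; rewrite addrC. Qed.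
Fact fendo_add0 : left_id (FEndo fendo0_lin) fendo_add.
Proof. by move=> u; apply: fendo_eq => g x /=; rewrite add0r. Qed.
Fact fendo_addN : left_inverse (FEndo fendo0_lin) fendo_opp fendo_add.
Proof. by move=> u; apply: fendo_eq => g x /=; rewrite addNr. Qed.
HB.instance Definition _ :=
  GRing.isZmodule.Build fendo fendo_addA fendo_addC fendo_add0 fendo_addN.

Fact fendo_mulA : associative fendo_mul.
Proof. by move=> u v w; apply: fendo_eq. Qed.
Fact fendo_mul1l : left_id (FEndo fendo1_lin) fendo_mul.
Proof. by move=> u; apply: fendo_eq. Qed.
Fact fendo_mul1r : right_id (FEndo fendo1_lin) fendo_mul.
Proof. by move=> u; apply: fendo_eq. Qed.
Fact fendo_mulDl : left_distributive fendo_mul +%R.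
Proof. by move=> u v w; apply: fendo_eq. Qed.
Fact fendo_mulDr : right_distributive fendo_mul +%R.
Proof.
move=> u v w; apply: fendo_eq => g x; rewrite /= -[X in _ = X + _]mul1r -fendo_lin.
by congr (fendo_fun u _ x); apply/funext => y; rewrite mul1r.
Qed.
Fact fendo_1neq0 : FEndo fendo1_lin != 0.
Proof.
apply/eqP => /(congr1 (fun u : fendo => u (fun _ => 1) 0)) /= /eqP.
by rewrite oner_eq0.
Qed.
HB.instance Definition _ := GRing.Zmodule_isNzRing.Build fendo
  fendo_mulA fendo_mul1l fendo_mul1r fendo_mulDl fendo_mulDr fendo_1neq0.

Fact fendo_scaleA c d u : fendo_scale c (fendo_scale d u) = fendo_scale (c * d) u.
Proof. by apply: fendo_eq => g x /=; rewrite mulrA. Qed.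
Fact fendo_scale1 : left_id 1 fendo_scale.
Proof. by move=> u; apply: fendo_eq => g x /=; rewrite mul1r. Qed.
Fact fendo_scaleDr : right_distributive fendo_scale +%R.
Proof. by move=> c u v; apply: fendo_eq => g x /=; rewrite mulrDr. Qed.
Fact fendo_scaleDl u : {morph fendo_scale^~ u : c d / c + d}.
Proof. by move=> c d; apply: fendo_eq => g x /=; rewrite mulrDl. Qed.
HB.instance Definition _ := GRing.Zmodule_isLmodule.Build k fendo
  fendo_scaleA fendo_scale1 fendo_scaleDr fendo_scaleDl.

Fact fendo_scaleAl (c : k) (u v : fendo) : c *: (u * v) = (c *: u) * v.
Proof. by apply: fendo_eq. Qed.
HB.instance Definition _ := GRing.Lmodule_isLalgebra.Build k fendo fendo_scaleAl.

Fact fendo_scaleAr (c : k) (u v : fendo) : c *: (u * v) = u * (c *: v).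
Proof.
apply: fendo_eq => g x /=; have u0 : u (fun=> 0) x = 0.
  have := fendo_lin u (-1) (fun=> 0) (fun=> 0) x.
  have -> : (fun _ : T => -1 * 0 + 0 : k) = (fun=> 0) by rewrite mulr0 addr0.
  by rewrite mulN1r addNr.
rewrite -[LHS]addr0 -u0 -fendo_lin; congr (fendo_fun u _ x).
by apply/funext => y; rewrite addr0.
Qed.
HB.instance Definition _ := GRing.Lalgebra_isAlgebra.Build k fendo fendo_scaleAr.

End FunctionEndomorphisms.

(** * Quantum torus and leading exponents *)

Section QuantumTorus.
Variables (k : fieldType) (q : k) (G : zmodType) (om : G -> G -> int).
Hypotheses (q0 : q != 0).
Hypotheses (omDl : forall a b c, om (a + b) c = om a c + om b c).
Hypotheses (omDr : forall a b c, om a (b + c) = om a b + om a c).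

Let om0r a : om a 0 = 0.
Proof. by apply: (addrI (om a 0)); rewrite -omDr !addr0. Qed.
Let om0l a : om 0 a = 0.
Proof. by apply: (addrI (om 0 a)); rewrite -omDl !addr0. Qed.

Fact tmon_lin (a : G) (c : k) (g h : G -> k) (x : G) :
  q ^ om a (x - a) * (c * g (x - a) + h (x - a)) =
  c * (q ^ om a (x - a) * g (x - a)) + q ^ om a (x - a) * h (x - a).
Proof. by ring. Qed.

(* Monomials of the quantum torus act as weighted translations on functions
   [G -> k], which spares the construction of the torus as an algebra. *)
Definition tmon (a : G) : fendo k G := FEndo (tmon_lin a).

Lemma tmonM a b : tmon a * tmon b = q ^ om a b *: tmon (a + b).
Proof.
apply: fendo_eq => g x /=; rewrite mulrA -expfzDr // mulrA -expfzDr //.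
have -> : x - a - b = x - (a + b) by rewrite opprD addrA.
congr (q ^ _ * _).
have -> : x - a = x - (a + b) + b by rewrite opprD addrA subrK.
by rewrite omDr omDl; ring.
Qed.

Lemma tmon0 : tmon 0 = 1.
Proof. by apply: fendo_eq => g x /=; rewrite subr0 om0l expr0z mul1r. Qed.

Lemma tmon_comm a b : tmon a * tmon b = q ^ (om a b - om b a) *: (tmon b * tmon a).
Proof. by rewrite !tmonM scalerA -expfzDr // subrK addrC. Qed.

(** The image of the delta function at 0 records the coefficients of [u] in the monomials. *)
Definition tcoef (u : fendo k G) (x : G) : k := u (fun y => (y == 0)%:R) x.

Lemma tcoef_mon a x : tcoef (tmon a) x = (x == a)%:R.
Proof.
rewrite /tcoef /= subr_eq0; case: eqP => [->|_]; last by rewrite mulr0.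
by rewrite subrr om0r expr0z mul1r.
Qed.

Lemma tcoefD u v x : tcoef (u + v) x = tcoef u x + tcoef v x. Proof. by []. Qed.
Lemma tcoefZ c u x : tcoef (c *: u) x = c * tcoef u x. Proof. by []. Qed.

Definition tsupp (Q : G -> Prop) : fendo k G -> Prop :=
  lspan (fun u => exists2 a, Q a & u = tmon a).

Lemma tsupp_coef Q u x : tsupp Q u -> ~ Q x -> tcoef u x = 0.
Proof.
move=> Qu nQ; elim: Qu => [//|c v w [a Qa ->] _ IH].
rewrite tcoefD tcoefZ tcoef_mon IH; case: eqP => [xa|_]; last by rewrite mulr0 addr0.
by case: nQ; rewrite xa.
Qed.

Lemma tsupp_mon (Q : G -> Prop) a : Q a -> tsupp Q (tmon a).
Proof. by move=> Qa; apply: lspan_mem; exists a. Qed.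

Lemma tsuppW (Q Q' : G -> Prop) u : (forall a, Q a -> Q' a) -> tsupp Q u -> tsupp Q' u.
Proof. by move=> H; apply: lspan_sub => v [a /H Qa ->]; exists a. Qed.

Lemma tsuppM (Q1 Q2 Q : G -> Prop) u v : (forall a b, Q1 a -> Q2 b -> Q (a + b)) ->
  tsupp Q1 u -> tsupp Q2 v -> tsupp Q (u * v).
Proof.
move=> H Hu Hv; apply: lspan_mulr Hu => _ [a Qa ->].
apply: lspan_mull Hv => _ [b Qb ->]; rewrite tmonM.
by apply/lspanZ/tsupp_mon/H.
Qed.

(* A translation-invariant total order on exponents, given by its positive cone. *)
Variable pos : G -> bool.
Hypotheses (pos0 : ~~ pos 0) (posD : forall a b, pos a -> pos b -> pos (a + b)).
Hypothesis pos_total : forall a, a != 0 -> pos a || pos (- a).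

Definition tlt a b := pos (b - a).

Lemma tlt_irr a : ~~ tlt a a. Proof. by rewrite /tlt subrr. Qed.
Lemma tlt_trans a b c : tlt a b -> tlt b c -> tlt a c.
Proof. by move=> ab bc; have := posD bc ab; rewrite addrA subrK. Qed.
Lemma tlt_total a b : a != b -> tlt a b || tlt b a.
Proof. by rewrite -subr_eq0 => /pos_total; rewrite /tlt opprB orbC. Qed.
Lemma tlt_add2l a b c : tlt (a + b) (a + c) = tlt b c.
Proof. by rewrite /tlt opprD addrACA subrr add0r. Qed.
Lemma tlt_add2r a b c : tlt (b + a) (c + a) = tlt b c.
Proof. by rewrite !(addrC _ a) tlt_add2l. Qed.

Definition lead a (u : fendo k G) :=
  exists2 c : k, c != 0 & exists2 r, tsupp (tlt^~ a) r & u = c *: tmon a + r.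

Lemma leadM a b u v : lead a u -> lead b v -> lead (a + b) (u * v).
Proof.
move=> [c c0 [r Hr ->]] [d d0 [s Hs ->]].
exists (c * d * q ^ om a b); first by rewrite !mulf_neq0 // expfz_neq0.
exists (c *: tmon a * s + r * (d *: tmon b) + r * s); last first.
  rewrite mulrDl !mulrDr -[_ *: tmon a * (_ *: _)]scalerAl -scalerAr tmonM !scalerA.
  by rewrite -!addrA.
have Ha e : tsupp (eq a) (e *: tmon a) by apply/lspanZ/tsupp_mon.
have Hb e : tsupp (eq b) (e *: tmon b) by apply/lspanZ/tsupp_mon.
apply: lspanD; first apply: lspanD.
- by apply: (tsuppM _ (Ha _) Hs) => x y <-; rewrite tlt_add2l.
- by apply: (tsuppM _ Hr (Hb _)) => x y xa <-; rewrite tlt_add2r.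
- apply: (tsuppM _ Hr Hs) => x y xa yb; apply: (@tlt_trans _ (a + y)).
    by rewrite tlt_add2r.
  by rewrite tlt_add2l.
Qed.

Lemma lead_mon a : lead a (tmon a).
Proof.
by exists 1; rewrite ?oner_neq0 //; exists 0; rewrite ?scale1r ?addr0 //; apply: lspan_zero.
Qed.

Lemma lead1 : lead 0 1. Proof. by rewrite -tmon0; apply: lead_mon. Qed.

Lemma leadX a u m : lead a u -> lead (a *+ m) (u ^+ m).
Proof.
move=> H; elim: m => [|m IH]; first exact: lead1.
by rewrite exprS mulrS; apply: leadM.
Qed.

Lemma lead_prod (I : Type) (r : seq I) (a : I -> G) (u : I -> fendo k G) :
  (forall i, lead (a i) (u i)) -> lead (\sum_(i <- r) a i) (\prod_(i <- r) u i).
Proof.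
move=> H; elim: r => [|i r IH]; first by rewrite !big_nil; apply: lead1.
by rewrite !big_cons; apply: leadM.
Qed.

Lemma lead_scale c a u : c != 0 -> lead a u -> lead a (c *: u).
Proof.
move=> c0 [d d0 [r Hr ->]]; exists (c * d); rewrite ?mulf_neq0 //.
by exists (c *: r); [apply: lspanZ | rewrite scalerDr scalerA].
Qed.

Lemma lead_supp a b u : lead a u -> tlt a b -> tsupp (tlt^~ b) u.
Proof.
move=> [c c0 [r Hr ->]] ab; apply: lspanD; first by apply/lspanZ/tsupp_mon.
by apply: tsuppW Hr => x xa; apply: tlt_trans ab.
Qed.

Lemma lead_add_supp a u r : lead a u -> tsupp (tlt^~ a) r -> lead a (u + r).
Proof.
move=> [c c0 [s Hs ->]] Hr; exists c => //; exists (s + r); first exact: lspanD.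
by rewrite addrA.
Qed.

Lemma lead_coef_neq0 a u : lead a u -> tcoef u a != 0.
Proof.
move=> [c c0 [r Hr ->]]; rewrite tcoefD tcoefZ tcoef_mon eqxx mulr1.
by rewrite (tsupp_coef Hr) ?addr0 //; apply/negP/tlt_irr.
Qed.

Lemma lead_neq0 a : ~ lead a 0.
Proof. by move=> /lead_coef_neq0; rewrite /tcoef /= eqxx. Qed.

Lemma lead_supp_lt a b u : lead a u -> tsupp (tlt^~ b) u -> tlt a b.
Proof.
move=> /lead_coef_neq0 H Hb; apply: contraNT H => ab.
by rewrite (tsupp_coef Hb) //; apply/negP.
Qed.

Lemma lead_cancel a u v : lead a u -> lead a v -> exists c, tsupp (tlt^~ a) (u - c *: v).
Proof.
move=> [c c0 [r Hr ->]] [d d0 [s Hs ->]]; exists (c / d).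
rewrite scalerDr scalerA divfK // opprD addrACA subrr add0r.
by apply: lspanB => //; apply: lspanZ.
Qed.

(** Distinct leading exponents cannot cancel: the largest one with a nonzero coefficient survives.
    Linear independence and the leading exponents of all combinations both follow from this. *)
Lemma lead_sum (I : eqType) (r : seq I) (a : I -> G) (u : I -> fendo k G) (c : I -> k) :
  uniq r -> {in r &, injective a} -> (forall i, i \in r -> lead (a i) (u i)) ->
  (forall i, i \in r -> c i = 0) \/
  exists2 i, i \in r & lead (a i) (\sum_(i <- r) c i *: u i).
Proof.
elim: r => [|i r IH] /=; first by left.
move=> /andP[ir ur] inj H.
have Hr j : j \in r -> j \in i :: r by rewrite inE orbC => ->.
have Hi := mem_head i r.
have IHr : (forall j, j \in r -> c j = 0) \/
    exists2 j, j \in r & lead (a j) (\sum_(j <- r) c j *: u j).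
  by apply: IH => // [j l /Hr jr /Hr|j /Hr]; [apply: inj | apply: H].
have [ci|ci] := eqVneq (c i) 0.
  rewrite big_cons ci scale0r add0r; case: IHr => [c0|[j jr Hj]].
    by left=> j; rewrite inE => /orP[/eqP->|/c0].
  by right; exists j => //; apply: Hr.
right; have li : lead (a i) (c i *: u i) by apply: lead_scale => //; apply: H.
rewrite big_cons; case: IHr => [c0|[j jr Hj]].
  exists i => //; rewrite big_seq big1 ?addr0 // => j /c0 ->; exact: scale0r.
have aij : a i != a j.
  by apply: contraNneq ir => /inj -> //; apply: Hr.
have /orP[lt|lt] := tlt_total aij.
  exists j; first exact: Hr.
  by rewrite addrC; apply: lead_add_supp => //; apply: lead_supp li lt.
by exists i => //; apply: lead_add_supp => //; apply: lead_supp Hj lt.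
Qed.

End QuantumTorus.

(** * Lexicographic orders on an abelian group *)

Section LexicographicCone.
Variables (G : zmodType).

Fixpoint lexpos (s : seq (G -> int)) (x : G) : bool :=
  if s is f :: s' then (0 < f x) || ((f x == 0) && lexpos s' x) else false.

Definition additive_fun (f : G -> int) := forall x y, f (x + y) = f x + f y.

Lemma additive_fun0 f : additive_fun f -> f 0 = 0.
Proof. by move=> H; apply: (addrI (f 0)); rewrite -H !addr0. Qed.

Lemma additive_funN f x : additive_fun f -> f (- x) = - f x.
Proof. by move=> H; apply: (addrI (f x)); rewrite -H !subrr additive_fun0. Qed.

Variable s : seq (G -> int).

Lemma lexpos0 : (forall f, List.In f s -> additive_fun f) -> ~~ lexpos s 0.
Proof.
elim: s => //= f s' IH H; rewrite additive_fun0 ?ltxx /=; last by apply: H; left.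
by apply: IH => g Hg; apply: H; right.
Qed.

Lemma lexposD x y : (forall f, List.In f s -> additive_fun f) ->
  lexpos s x -> lexpos s y -> lexpos s (x + y).
Proof.
elim: s => //= f s' IH H; rewrite (H f (or_introl erefl)).
move=> /orP[fx|/andP[/eqP-> px]] /orP[fy|/andP[/eqP-> py]].
- by rewrite addr_gt0.
- by rewrite addr0 fx.
- by rewrite add0r fy.
- by rewrite addr0 ltxx eqxx IH // => g Hg; apply: H; right.
Qed.

Lemma lexpos_total x : (forall f, List.In f s -> additive_fun f) ->
  ((forall f, List.In f s -> f x = 0) -> x = 0) -> x != 0 -> lexpos s x || lexpos s (- x).
Proof.
move=> H sep x0; have : exists2 f, List.In f s & f x != 0.
  apply: contrapT => nH; case/eqP: x0; apply: sep => f fs.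
  by apply: contrapT => /eqP fx; apply: nH; exists f.
elim: s H {sep} => [_ [] //|f s' IH H [g /= gs gx]].
have Hf := H f (or_introl erefl).
rewrite (additive_funN _ Hf) oppr_gt0 oppr_eq0.
case: (ltgtP (f x) 0) => fx; [by rewrite /= ?orbT | by rewrite /= ?orbT | rewrite /=].
apply: IH; first by move=> h Hh; apply: H; right.
by case: gs => [fg|gs]; [rewrite -fg fx eqxx in gx | exists g].
Qed.

End LexicographicCone.

(** * Oscillator representations *)

Section Oscillator.
Variables (k : fieldType) (q : k) (A : algType k) (n : nat) (x y T Ti : nat -> A).
Hypotheses (q0 : q != 0) (qq : q - q^-1 != 0).
Let kap := (q - q^-1)^-1.

Definition osc_gen p (z : A) := [\/ z = x p, z = y p, z = T p | z = Ti p].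

Hypothesis comm : forall p r u v, (p <= n)%N -> (r <= n)%N -> p != r ->
  osc_gen p u -> osc_gen r v -> u * v = v * u.
Hypothesis TTi : forall p, (p <= n)%N -> T p * Ti p = 1.
Hypothesis TiT : forall p, (p <= n)%N -> Ti p * T p = 1.
Hypothesis Tx : forall p, (p <= n)%N -> T p * x p = q *: (x p * T p).
Hypothesis Ty : forall p, (p <= n)%N -> T p * y p = q^-1 *: (y p * T p).
Hypothesis xy : forall p, (p <= n)%N -> x p * y p = kap *: (T p - Ti p).
Hypothesis yx : forall p, (p <= n)%N -> y p * x p = kap *: (q *: T p - q^-1 *: Ti p).

(** A q-analogue of E_i = x_i d/dx_(i+1): [y] plays the q-derivative and [T] plays q^(x d/dx), so
    that [x p * y p] is the q-number of the degree in x_p. *)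
Definition oscE i := x i * y i.+1.
Definition oscF i := x i.+1 * y i.
Definition oscK i := T i * Ti i.+1.
Definition oscKi i := Ti i * T i.+1.

Let gx p : osc_gen p (x p). Proof. exact: Or41. Qed.
Let gy p : osc_gen p (y p). Proof. exact: Or42. Qed.
Let gT p : osc_gen p (T p). Proof. exact: Or43. Qed.
Let gTi p : osc_gen p (Ti p). Proof. exact: Or44. Qed.

Let ne1 p : p != p.+1. Proof. by rewrite ltn_eqF. Qed.
Let ne2 p : p != p.+2. Proof. by rewrite ltn_eqF // ltnW. Qed.
Let ne3 p : p.+1 != p. Proof. by rewrite gtn_eqF. Qed.
Let ne4 p : p.+2 != p. Proof. by rewrite gtn_eqF // ltnW. Qed.

Let Tix p : (p <= n)%N -> Ti p * x p = q^-1 *: (x p * Ti p).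
Proof. by move=> pn; apply: (comm_scale_inv _ (TTi pn) (TiT pn)) => //; apply: Tx. Qed.

Let Tiy p : (p <= n)%N -> Ti p * y p = q *: (y p * Ti p).
Proof.
move=> pn; rewrite -[q in RHS]invrK; apply: (comm_scale_inv _ (TTi pn) (TiT pn)).
  by rewrite invr_eq0.
exact: Ty.
Qed.

(** Two neighbouring generators share a single site. Once [serre_mul] has taken out the factors at
    the other sites, their Serre relation is one between [x] and [y] at that site. *)
Lemma osc_serre_yx p : (p <= n)%N -> serre q (y p) (x p).
Proof.
move=> pn; rewrite /serre.
transitivity (y p * (y p * x p - kap *: (q *: T p - q^-1 *: Ti p))
  - (q + q^-1) *: ((y p * x p - kap *: (q *: T p - q^-1 *: Ti p)) * y p)
  + (x p * y p - kap *: (T p - Ti p)) * y p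
  + (kap * (1 - (q + q^-1) * q)) *: (T p * y p - q^-1 *: (y p * T p))
  + (kap * ((q + q^-1) * q^-1 - 1)) *: (Ti p * y p - q *: (y p * Ti p))).
  ncpoly k; by field.
by rewrite yx // xy // Ty // Tiy // !subrr !(mul0r, mulr0, scaler0, addr0, subr0).
Qed.

Lemma osc_serre_xy p : (p <= n)%N -> serre q (x p) (y p).
Proof.
move=> pn; rewrite /serre.
transitivity (x p * (x p * y p - kap *: (T p - Ti p))
  - (q + q^-1) *: ((x p * y p - kap *: (T p - Ti p)) * x p)
  + (y p * x p - kap *: (q *: T p - q^-1 *: Ti p)) * x p
  + (kap * (q - (q + q^-1))) *: (T p * x p - q *: (x p * T p))
  + (kap * ((q + q^-1) - q^-1)) *: (Ti p * x p - q^-1 *: (x p * Ti p))).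
  ncpoly k; by field.
by rewrite yx // xy // Tx // Tix // !subrr !(mul0r, mulr0, scaler0, addr0, subr0).
Qed.

Lemma osc_far ia ib jc jd (a b c d : A) :
  osc_gen ia a -> osc_gen ib b -> osc_gen jc c -> osc_gen jd d ->
  (ia <= n)%N -> (ib <= n)%N -> (jc <= n)%N -> (jd <= n)%N ->
  ia != jc -> ia != jd -> ib != jc -> ib != jd ->
  a * b * (c * d) = c * d * (a * b).
Proof.
move=> ga gb gc gd ian ibn jcn jdn n1 n2 n3 n4.
rewrite -mulrA (mulrA b) (comm ibn jcn n3 gb gc) -(mulrA c) (comm ibn jdn n4 gb gd).
rewrite (mulrA a) (comm ian jcn n1 ga gc) -(mulrA c) (mulrA a) (comm ian jdn n2 ga gd).
by rewrite !mulrA.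
Qed.

Lemma scale_pass (u v z : A) (a b : k) : u * v = a *: (v * u) -> u * z = b *: (z * u) ->
  u * (v * z) = (a * b) *: (v * z * u).
Proof.
by move=> uv uz; rewrite mulrA uv -scalerAl -[v * u * z]mulrA uz -scalerAr scalerA mulrA.
Qed.

Let Tcomm p r z : (p <= n)%N -> (r <= n)%N -> p != r -> osc_gen r z ->
  T p * z = 1 *: (z * T p) /\ Ti p * z = 1 *: (z * Ti p).
Proof. by move=> pn rn pr gz; rewrite !scale1r !(comm pn rn pr _ gz). Qed.

Lemma osc_KE i j : (i < n)%N -> (j < n)%N -> oscK i * oscE j = q ^ cartann i j *: (oscE j * oscK i).
Proof.
move=> il jl; have il' := ltnW il; have jl' := ltnW jl.
have Tpart p : (p <= n)%N -> T p * oscE j =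
    q ^ ((p == j)%:Z - (p == j.+1)%:Z) *: (oscE j * T p).
  move=> pn; have [->|pj] := eqVneq p j.
    rewrite ltn_eqF // subr0 expr1z -[q]mulr1; apply: scale_pass; first exact: Tx.
    by case: (@Tcomm j j.+1 (y j.+1)) => //; rewrite ltn_eqF.
  have [->|pj1] := eqVneq p j.+1.
    rewrite sub0r -invr_expz expr1z -[q^-1]mul1r; apply: scale_pass; last exact: Ty.
    by case: (@Tcomm j.+1 j (x j)) => //; rewrite gtn_eqF.
  rewrite subrr expr0z -[1]mulr1; apply: scale_pass.
    by case: (@Tcomm p j (x j)).
  by case: (@Tcomm p j.+1 (y j.+1)).
have Tipart p : (p <= n)%N -> Ti p * oscE j =
    q ^ ((p == j.+1)%:Z - (p == j)%:Z) *: (oscE j * Ti p).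
  move=> pn; rewrite -opprB -invr_expz.
  by apply: (comm_scale_inv _ (TTi pn) (TiT pn)); [apply: expfz_neq0 | apply: Tpart].
rewrite /oscK -[T i * _ * oscE j]mulrA Tipart // -scalerAr (mulrA (T i) (oscE j)) Tpart // -scalerAl.
rewrite scalerA -expfzDr // -(mulrA (oscE j)).
congr (q ^ _ *: _); rewrite /cartann; do !case: eqP => //=; lia.
Qed.

Lemma osc_KF i j : (i < n)%N -> (j < n)%N -> oscK i * oscF j = q ^ (- cartann i j) *: (oscF j * oscK i).
Proof.
move=> il jl; have il' := ltnW il; have jl' := ltnW jl.
have Tpart p : (p <= n)%N -> T p * oscF j =
    q ^ ((p == j.+1)%:Z - (p == j)%:Z) *: (oscF j * T p).
  move=> pn; have [->|pj] := eqVneq p j.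
    rewrite ltn_eqF // sub0r -invr_expz expr1z -[q^-1]mul1r; apply: scale_pass; last exact: Ty.
    by case: (@Tcomm j j.+1 (x j.+1)) => //; rewrite ltn_eqF.
  have [->|pj1] := eqVneq p j.+1.
    rewrite subr0 expr1z -[q]mulr1; apply: scale_pass; first exact: Tx.
    by case: (@Tcomm j.+1 j (y j)) => //; rewrite gtn_eqF.
  rewrite subrr expr0z -[1]mulr1; apply: scale_pass.
    by case: (@Tcomm p j.+1 (x j.+1)).
  by case: (@Tcomm p j (y j)).
have Tipart p : (p <= n)%N -> Ti p * oscF j =
    q ^ ((p == j)%:Z - (p == j.+1)%:Z) *: (oscF j * Ti p).
  move=> pn; rewrite -opprB -invr_expz.
  by apply: (comm_scale_inv _ (TTi pn) (TiT pn)); [apply: expfz_neq0 | apply: Tpart].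
rewrite /oscK -[T i * _ * oscF j]mulrA Tipart // -scalerAr (mulrA (T i) (oscF j)) Tpart // -scalerAl.
rewrite scalerA -expfzDr // -(mulrA (oscF j)).
congr (q ^ _ *: _); rewrite /cartann; do !case: eqP => //=; lia.
Qed.

Lemma osc_EF i j : (i < n)%N -> (j < n)%N ->
  oscE i * oscF j - oscF j * oscE i = if i == j then kap *: (oscK i - oscKi i) else 0.
Proof.
move=> il jl; have il' := ltnW il; have jl' := ltnW jl.
have [<-|ij] := eqVneq i j.
  have ii1 : i != i.+1 by rewrite ltn_eqF.
  have i1i : i.+1 != i by rewrite eq_sym.
  have -> : oscE i * oscF i = x i * y i * (y i.+1 * x i.+1).
    rewrite /oscE /oscF -!mulrA; congr (x i * _).
    by rewrite (mulrA (y i)) (@comm i i.+1 (y i) (y i.+1)) // -mulrA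
      (@comm i i.+1 (y i) (x i.+1)) // mulrA.
  have -> : oscF i * oscE i = y i * x i * (x i.+1 * y i.+1).
    rewrite /oscE /oscF -(mulrA (x i.+1)) (mulrA (y i)) (mulrA (x i.+1)).
    have h : x i.+1 * (y i * x i) = y i * x i * x i.+1.
      by rewrite mulrA (@comm i.+1 i (x i.+1) (y i)) // -mulrA (@comm i.+1 i (x i.+1) (x i)) // mulrA.
    by rewrite h -mulrA.
  (* With T_i = q^a and T_(i+1) = q^b this is the identity [a][b+1] - [a+1][b] = [a-b] of
     q-numbers. *)
  rewrite xy // yx // yx // xy // /oscK /oscKi /kap.
  have q2 : (q != 0) && (q * q - 1 != 0).
    rewrite q0 -expr2; by move: qq; apply: contraNneq => q2; rewrite subr_eq0 -(inj_eq (mulfI q0)) mulfV // -expr2 -subr_eq0 q2.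
  by ncpoly k; field.
have [ij1|ij1] := eqVneq i.+1 j.
  subst j; rewrite /oscE /oscF.
  have h1 : y i.+1 * x i.+2 = x i.+2 * y i.+1 by apply: (@comm i.+1 i.+2).
  have h2 : x i * x i.+2 = x i.+2 * x i by apply: (@comm i i.+2).
  have h3 : x i * y i.+1 = y i.+1 * x i by apply: (@comm i i.+1).
  transitivity (x i * (y i.+1 * x i.+2 - x i.+2 * y i.+1) * y i.+1
    + (x i * x i.+2 - x i.+2 * x i) * y i.+1 * y i.+1
    + x i.+2 * (x i * y i.+1 - y i.+1 * x i) * y i.+1).
    by ncpoly k; ring.
  by rewrite h1 h2 h3 !subrr !(mul0r, mulr0, addr0).
have [ji1|ji1] := eqVneq j.+1 i.
  subst i; rewrite /oscE /oscF.
  have h1 : y j.+2 * x j.+1 = x j.+1 * y j.+2 by apply: (@comm j.+2 j.+1).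
  have h2 : y j.+2 * y j = y j * y j.+2 by apply: (@comm j.+2 j).
  have h3 : x j.+1 * y j = y j * x j.+1 by apply: (@comm j.+1 j).
  transitivity (x j.+1 * (y j.+2 * x j.+1 - x j.+1 * y j.+2) * y j
    + x j.+1 * x j.+1 * (y j.+2 * y j - y j * y j.+2)
    + x j.+1 * (x j.+1 * y j - y j * x j.+1) * y j.+2).
    by ncpoly k; ring.
  by rewrite h1 h2 h3 !subrr !(mul0r, mulr0, addr0).
rewrite (@osc_far i i.+1 j.+1 j) ?subrr //.
by rewrite eq_sym.
Qed.

Lemma osc_rel : uqrel q n oscE oscF oscK oscKi.
Proof.
split.
- move=> i il; have il' := ltnW il; rewrite /oscK /oscKi mul_commACA.
    by rewrite TTi // TiT // mulr1.
  by rewrite (@comm i.+1 i (Ti i.+1) (Ti i)).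
- move=> i il; have il' := ltnW il; rewrite /oscK /oscKi mul_commACA.
    by rewrite TTi // TiT // mulr1.
  by rewrite (@comm i.+1 i (T i.+1) (T i)).
- have TT p r u v : (p <= n)%N -> (r <= n)%N -> (u = T p \/ u = Ti p) -> (v = T r \/ v = Ti r) ->
      u * v = v * u.
    move=> pn rn; have [<-|pr] := eqVneq p r.
      by case=> -> [] ->; rewrite ?TTi ?TiT.
    move=> Hu Hv; apply: (comm pn rn pr).
      by case: Hu => ->.
    by case: Hv => ->.
  move=> i j il jl; have il' := ltnW il; have jl' := ltnW jl.
  have h1 := TT i.+1 j _ _ il jl' (or_intror erefl) (or_introl erefl).
  have h2 := TT j.+1 i _ _ jl il' (or_intror erefl) (or_introl erefl).
  rewrite /oscK (mul_commACA _ _ h1) (mul_commACA _ _ h2).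
  by rewrite (TT i j (T i) (T j)) //; auto; rewrite (TT i.+1 j.+1 (Ti i.+1) (Ti j.+1)) //; auto.
- exact: osc_KE.
- exact: osc_KF.
- exact: osc_EF.
- split.
  + move=> i j il jl ij; apply: (@osc_far i i.+1 j j.+1) => //; lia.
  + move=> i il; rewrite /oscE (@comm i.+1 i.+2 (x i.+1) (y i.+2)) //; last by lia.
    by apply: serre_mul; [apply: (@comm i i.+2)|apply: (@comm i.+1 i)|apply: (@comm i.+1 i.+2)|apply: (@comm i.+1 i)|apply: osc_serre_yx] => //; lia.
  + move=> i il; rewrite /oscE (@comm i.+1 i.+2 (x i.+1) (y i.+2)) //; last by lia.
    by apply: serre_mul; [apply: (@comm i.+2 i)|apply: (@comm i.+1 i.+2)|apply: (@comm i.+1 i)|apply: (@comm i.+1 i.+2)|apply: osc_serre_xy] => //; lia.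
- split.
  + move=> i j il jl ij; apply: (@osc_far i.+1 i j.+1 j) => //; lia.
  + move=> i il; rewrite /oscF (@comm i.+1 i (x i.+1) (y i)) //; [|lia|lia].
    by apply: serre_mul; [apply: (@comm i i.+2)|apply: (@comm i.+1 i)|apply: (@comm i.+1 i.+2)|apply: (@comm i.+1 i)|apply: osc_serre_xy] => //; lia.
  + move=> i il; rewrite /oscF (@comm i.+1 i (x i.+1) (y i)) //; [|lia|lia].
    by apply: serre_mul; [apply: (@comm i.+2 i)|apply: (@comm i.+1 i.+2)|apply: (@comm i.+1 i)|apply: (@comm i.+1 i.+2)|apply: osc_serre_yx] => //; lia.
Qed.

End Oscillator.

(** * The representation on a quantum torus *)

Section Exponents.
Variables (n m : nat).

(* Site [(c, p)] is the [p]-th oscillator of the [c]-th tensor factor; the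
   component [true] of an exponent is the power of [T], [false] that of [x]. *)
Definition site := ('I_m.+1 * 'I_n.+1)%type.
Definition expo := {ffun site * bool -> int}.

Definition co (c p : nat) (b : bool) (a : expo) : int := a ((inord c, inord p), b).
Definition ev (c p : nat) (b : bool) : expo := [ffun i => (i == ((inord c, inord p), b))%:Z].
(** Monomials are normally ordered with powers of x to the left of powers of T; the power of q in a
    product comes from moving the T-part of [a] past the x-part of [b]. *)
Definition om (a b : expo) : int := \sum_(i : site) a (i, true) * b (i, false).

Lemma omDl a b c : om (a + b) c = om a c + om b c.
Proof. by rewrite /om -big_split; apply: eq_bigr => i _; rewrite ffunE mulrDl. Qed.
Lemma omDr a b c : om a (b + c) = om a b + om a c.
Proof. by rewrite /om -big_split; apply: eq_bigr => i _; rewrite ffunE mulrDr. Qed.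
Lemma omNl a b : om (- a) b = - om a b.
Proof. by rewrite /om -sumrN; apply: eq_bigr => i _; rewrite ffunE mulNr. Qed.
Lemma omNr a b : om a (- b) = - om a b.
Proof. by rewrite /om -sumrN; apply: eq_bigr => i _; rewrite ffunE mulrN. Qed.
Lemma om0r a : om a 0 = 0.
Proof. by rewrite /om big1 // => i _; rewrite ffunE mulr0. Qed.
Lemma om0l a : om 0 a = 0.
Proof. by rewrite /om big1 // => i _; rewrite ffunE mul0r. Qed.

Lemma om_evxl c p b : om (ev c p false) b = 0.
Proof. by rewrite /om big1 // => i _; rewrite ffunE xpair_eqE andbF mul0r. Qed.
Lemma om_evTr c p a : om a (ev c p true) = 0.
Proof. by rewrite /om big1 // => i _; rewrite ffunE xpair_eqE andbF mulr0. Qed.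
Lemma om_evTl c p b : om (ev c p true) b = co c p false b.
Proof.
rewrite /om (bigD1 (inord c, inord p)) //= ffunE eqxx mul1r big1 ?addr0 // => i ic.
by rewrite ffunE xpair_eqE (negbTE ic) mul0r.
Qed.
Lemma om_evxr c p a : om a (ev c p false) = co c p true a.
Proof.
rewrite /om (bigD1 (inord c, inord p)) //= ffunE eqxx mulr1 big1 ?addr0 // => i ic.
by rewrite ffunE xpair_eqE (negbTE ic) mulr0.
Qed.

Lemma coD c p b x y : co c p b (x + y) = co c p b x + co c p b y.
Proof. by rewrite /co ffunE. Qed.
Lemma coN c p b x : co c p b (- x) = - co c p b x.
Proof. by rewrite /co ffunE. Qed.
Lemma co_sum c p b (I : Type) (r : seq I) (f : I -> expo) :
  co c p b (\sum_(i <- r) f i) = \sum_(i <- r) co c p b (f i).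
Proof.
elim: r => [|i r IH]; first by rewrite !big_nil /co ffunE.
by rewrite !big_cons coD IH.
Qed.

Lemma inord_eqE (d i j : nat) : (i <= d)%N -> (j <= d)%N ->
  (inord i == inord j :> 'I_d.+1) = (i == j).
Proof. by move=> id jd; rewrite -val_eqE /= !inordK. Qed.

Lemma co_ev c p b c' p' b' : (c <= m)%N -> (c' <= m)%N -> (p <= n)%N -> (p' <= n)%N ->
  co c p b (ev c' p' b') = [&& c == c', p == p' & b == b'].
Proof.
move=> cm cm' pn pn'; rewrite /co ffunE !xpair_eqE !inord_eqE //.
by rewrite andbA.
Qed.

Lemma co_ev_copy c p b c' p' b' : (c <= m)%N -> (c' <= m)%N -> c != c' ->
  co c p b (ev c' p' b') = 0.
Proof.
by move=> cm cm' cc; rewrite /co ffunE !xpair_eqE inord_eqE // (negbTE cc).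
Qed.

Definition shiftT c i : expo := ev c i true - ev c i.+1 true.
Definition Kexp r i : expo := \sum_(c < r) shiftT c i.
(* The [c]-th summand of the iterated coproduct of [E_i] or [F_i] splits into
   two monomials because [y = (q - q^-1)^-1 x^-1 (T - T^-1)]. *)
Definition Eexp c i (s : bool) : expo :=
  Kexp c i + (ev c i false - ev c i.+1 false + (if s then ev c i.+1 true else - ev c i.+1 true)).
Definition Fexp r c i (s : bool) : expo :=
  ev c i.+1 false - ev c i false + (if s then ev c i true else - ev c i true)
  - (Kexp r i - Kexp c.+1 i).

Lemma Kexp_recr r i : Kexp r.+1 i = Kexp r i + shiftT r i.
Proof. exact: big_ord_recr. Qed.

End Exponents.

(** * Iterated coproduct inside the quantum torus *)

Section TorusRepresentation.
Variables (k : fieldType) (q : k) (n m : nat).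
Hypotheses (q0 : q != 0) (qq : q - q^-1 != 0).
Let kap := (q - q^-1)^-1.
Notation G := (expo n m).
Notation om := (@om n m).
Notation ev := (@ev n m).
Notation co := (@co n m).
Notation tm := (@tmon k q G om).
Notation B := (fendo k G).
Notation tmM := (tmonM q0 (@omDl n m) (@omDr n m)).

Definition supported (S : pred (site n m)) (a : G) := forall i, ~~ S i.1 -> a i = 0.

Lemma supported_om (S S' : pred (site n m)) a b : (forall i, S i -> ~~ S' i) ->
  supported S a -> supported S' b -> om a b = 0.
Proof.
move=> SS' Sa Sb; rewrite /om big1 // => i _.
have [/SS' Si|Si] := boolP (S i); last by rewrite Sa // mul0r.
by rewrite Sb ?mulr0.
Qed.

Lemma tsupp_disjoint (S S' : pred (site n m)) (u v : B) : (forall i, S i -> ~~ S' i) ->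
  tsupp q om (supported S) u -> tsupp q om (supported S') v -> u * v = v * u.
Proof.
move=> SS' Hu Hv; have S'S i : S' i -> ~~ S i by apply: contraL; apply: SS'.
elim: Hu => [|c _ y [a Sa ->] _ IH]; first by rewrite mul0r mulr0.
rewrite mulrDl mulrDr IH; congr (_ + _); rewrite -scalerAl -scalerAr; congr (_ *: _).
elim: Hv => [|d _ z [b Sb ->] _ IH']; first by rewrite mul0r mulr0.
rewrite mulrDl mulrDr IH'; congr (_ + _); rewrite -scalerAl -scalerAr; congr (_ *: _).
rewrite (tmon_comm q0 (@omDl n m) (@omDr n m)).
by rewrite (supported_om SS') // (supported_om S'S) // subrr expr0z scale1r.
Qed.

Lemma supportedD S a b : supported S a -> supported S b -> supported S (a + b).
Proof. by move=> Sa Sb i Si; rewrite ffunE Sa // Sb // addr0. Qed.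
Lemma supportedN S a : supported S a -> supported S (- a).
Proof. by move=> Sa i Si; rewrite ffunE Sa // oppr0. Qed.
Lemma supported_ev (S : pred (site n m)) c p b : S (inord c, inord p) -> supported S (ev c p b).
Proof. by move=> Sc [i b'] Si; rewrite ffunE xpair_eqE; case: eqP => //= ic; rewrite -ic (negbTE Si) in Sc. Qed.

Definition opX c p : B := tm (ev c p false).
Definition opT c p : B := tm (ev c p true).
Definition opTi c p : B := tm (- ev c p true).
Definition opY c p : B := kap *: (tm (- ev c p false) * (opT c p - opTi c p)).

Lemma osc_gen_supp (S : pred (site n m)) c p u : S (inord c, inord p) ->
  osc_gen (opX c) (opY c) (opT c) (opTi c) p u -> tsupp q om (supported S) u.
Proof.
move=> Sc; have He b := supported_ev b Sc.
have HeN b := supportedN (He b).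
case=> ->; rewrite /opX /opY /opT /opTi; try by apply: tsupp_mon.
apply: lspanZ; rewrite mulrBr.
by apply: lspanB; apply: (tsuppM q0 _ _ (Q1 := supported S) (Q2 := supported S));
  try exact: omDl; try exact: omDr; try (by apply: tsupp_mon); apply: supportedD.
Qed.

Lemma copy_rel c : (c <= m)%N ->
  uqrel q n (oscE (opX c) (opY c)) (oscF (opX c) (opY c))
    (oscK (opT c) (opTi c)) (oscKi (opT c) (opTi c)).
Proof.
move=> cm.
have TTi p : opT c p * opTi c p = 1.
  by rewrite /opT /opTi tmM omNr om_evTr oppr0 expr0z scale1r subrr (tmon0 q (@omDl n m)).
have TiT p : opTi c p * opT c p = 1.
  by rewrite /opT /opTi tmM om_evTr expr0z scale1r addNr (tmon0 q (@omDl n m)).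
have cop p b : (p <= n)%N -> co c p b (ev c p b) = 1 by move=> pn; rewrite co_ev // !eqxx.
have Tx' p : (p <= n)%N -> opT c p * tm (ev c p false) = q *: (tm (ev c p false) * opT c p).
  move=> pn; rewrite (tmon_comm q0 (@omDl n m) (@omDr n m)) om_evTl om_evxl cop //.
have TxN p : (p <= n)%N -> opT c p * tm (- ev c p false) = q^-1 *: (tm (- ev c p false) * opT c p).
  move=> pn; rewrite (tmon_comm q0 (@omDl n m) (@omDr n m)) omNr omNl om_evTl om_evxl cop //.
have TiTc p : opT c p * opTi c p = opTi c p * opT c p by rewrite TTi TiT.
have TixN p : (p <= n)%N -> opTi c p * tm (- ev c p false) = q *: (tm (- ev c p false) * opTi c p).
  move=> pn; have qi0 : q^-1 != 0 by rewrite invr_eq0.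
  by rewrite (comm_scale_inv qi0 (TTi p) (TiT p) (TxN p pn)) invrK.
have Xx p : tm (ev c p false) * tm (- ev c p false) = 1.
  by rewrite tmM om_evxl expr0z scale1r subrr (tmon0 q (@omDl n m)).
have xX p : tm (- ev c p false) * tm (ev c p false) = 1.
  by rewrite tmM omNl om_evxl oppr0 expr0z scale1r addNr (tmon0 q (@omDl n m)).
apply: osc_rel => //.
- move=> p r u v pn rn pr gu gv.
  apply: (@tsupp_disjoint (pred1 (inord c, inord p)) (pred1 (inord c, inord r))).
  + by move=> i /eqP -> /=; rewrite xpair_eqE !inord_eqE // (negbTE pr) andbF.
  + by apply: osc_gen_supp gu; rewrite /= eqxx.
  + by apply: osc_gen_supp gv; rewrite /= eqxx.
- by move=> p _; apply: TTi.
- by move=> p _; apply: TiT.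
- move=> p pn; rewrite /opY -scalerAr -scalerAl scalerA [_ * kap]mulrC -scalerA; congr (_ *: _).
  rewrite mulrA TxN // -!scalerAl -!mulrA; congr (_ *: (_ * _)).
  by rewrite mulrBr mulrBl TiTc.
- by move=> p pn; rewrite /opY -scalerAr mulrA Xx mul1r.
- move=> p pn; rewrite /opY -scalerAl; congr (_ *: _).
  have e1 : opT c p * opX c p = q *: (opX c p * opT c p) by exact: Tx'.
  have e2 : opTi c p * opX c p = q^-1 *: (opX c p * opTi c p).
    by apply: (comm_scale_inv _ (TTi p) (TiT p)).
  rewrite -mulrA mulrBl e1 e2 mulrBr -!scalerAr !mulrA xX !mul1r //.
Qed.

Lemma oscE_mon c i : oscE (opX c) (opY c) i =
  kap *: (tm (ev c i false - ev c i.+1 false + ev c i.+1 true)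
          - tm (ev c i false - ev c i.+1 false - ev c i.+1 true)).
Proof.
rewrite /oscE /opX /opY -scalerAr mulrA; congr (_ *: _).
rewrite tmM om_evxl expr0z scale1r mulrBr /opT /opTi !tmM omNr !om_evTr.
by rewrite oppr0 expr0z !scale1r.
Qed.

Lemma oscF_mon c i : oscF (opX c) (opY c) i =
  kap *: (tm (ev c i.+1 false - ev c i false + ev c i true)
          - tm (ev c i.+1 false - ev c i false - ev c i true)).
Proof.
rewrite /oscF /opX /opY -scalerAr mulrA; congr (_ *: _).
rewrite tmM om_evxl expr0z scale1r mulrBr /opT /opTi !tmM omNr !om_evTr.
by rewrite oppr0 expr0z !scale1r.
Qed.

Definition repE r i : B :=
  \sum_(c < r) kap *: (tm (Eexp n m c i true) - tm (Eexp n m c i false)).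
Definition repF r i : B :=
  \sum_(c < r) kap *: (tm (Fexp n m r c i true) - tm (Fexp n m r c i false)).
Definition repK r i : B := tm (Kexp n m r i).
Definition repKi r i : B := tm (- Kexp n m r i).

Lemma om_Tr r i a : om a (Kexp n m r i) = 0.
Proof.
elim: r => [|r IH]; first by rewrite /Kexp big_ord0 om0r.
by rewrite Kexp_recr omDr IH /shiftT omDr omNr !om_evTr subrr.
Qed.

Lemma oscK_mon c i : oscK (opT c) (opTi c) i = tm (shiftT n m c i).
Proof. by rewrite /oscK /opT /opTi tmM omNr om_evTr oppr0 expr0z scale1r. Qed.

Lemma oscKi_mon c i : oscKi (opT c) (opTi c) i = tm (- shiftT n m c i).
Proof. by rewrite /oscKi /opT /opTi tmM om_evTr expr0z scale1r /shiftT opprB addrC. Qed.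

Lemma co_Kexp_copy c p b r i : (c <= m)%N -> (r <= c)%N -> co c p b (Kexp n m r i) = 0.
Proof.
move=> cm rc; rewrite /Kexp co_sum big1 // => c' _; have lt := ltn_ord c'.
by rewrite /shiftT coD coN !co_ev_copy ?subrr //; lia.
Qed.

Lemma repE_recr r i : (r <= m)%N ->
  repE r.+1 i = repE r i + repK r i * oscE (opX r) (opY r) i.
Proof.
move=> rm; rewrite /repE big_ord_recr /=; congr (_ + _).
rewrite oscE_mon -scalerAr; congr (_ *: _).
by rewrite mulrBr !tmM /Eexp !omDr !omNr !om_evxr !co_Kexp_copy // !om_evTr oppr0 !addr0 expr0z !scale1r.
Qed.

Lemma repF_recr r i : (r <= m)%N ->
  repF r.+1 i = oscF (opX r) (opY r) i + repF r i * oscKi (opT r) (opTi r) i.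
Proof.
move=> rm; rewrite /repF big_ord_recr /= addrC; congr (_ + _).
  by rewrite oscF_mon /Fexp subrr !subr0.
rewrite mulr_suml; apply: eq_bigr => c _; rewrite oscKi_mon -scalerAl; congr (_ *: _).
rewrite mulrBl !tmM /shiftT !omNr !omDr !omNr !om_evTr subrr oppr0 expr0z !scale1r.
by rewrite /Fexp Kexp_recr /shiftT; congr (tm _ - tm _);
  rewrite -[RHS]addrA; congr (_ + _); rewrite -opprD; congr (- _); rewrite addrAC.
Qed.

Lemma repK_recr r i : repK r.+1 i = repK r i * oscK (opT r) (opTi r) i.
Proof.
rewrite oscK_mon /repK tmM Kexp_recr /shiftT omDr omNr !om_evTr subrr expr0z scale1r //.
Qed.

Lemma repKi_recr r i : repKi r.+1 i = repKi r i * oscKi (opT r) (opTi r) i.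
Proof.
rewrite oscKi_mon /repKi tmM Kexp_recr /shiftT omNr omDr omNr !om_evTr subrr oppr0 expr0z scale1r.
by rewrite opprD.
Qed.

Lemma shiftT_supp c i (S : pred (site n m)) : (forall p, S (inord c, p)) ->
  supported S (shiftT n m c i).
Proof. by move=> H; apply: supportedD; [|apply: supportedN]; apply: supported_ev. Qed.

Lemma supported_sum (S : pred (site n m)) (I : Type) (r : seq I) (f : I -> G) :
  (forall i, supported S (f i)) -> supported S (\sum_(i <- r) f i).
Proof.
move=> H; elim: r => [|i r IH]; first by rewrite big_nil => j _; rewrite ffunE.
by rewrite big_cons; apply: supportedD.
Qed.

Lemma rep_supp r u (S : pred (site n m)) : (forall c p, (c < r)%N -> S (inord c, p)) ->
  uq_gen n (repE r) (repF r) (repK r) (repKi r) u -> tsupp q om (supported S) u.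
Proof.
move=> HS [i [_ H]].
have HT c : (c < r)%N -> supported S (shiftT n m c i).
  by move=> cr; apply: shiftT_supp => p; apply: HS.
have HK r' : (r' <= r)%N -> supported S (Kexp n m r' i).
  by move=> r'r; apply: supported_sum => c; apply: HT; apply: leq_trans r'r.
have He c p b : (c < r)%N -> supported S (ev c p b).
  by move=> cr; apply: supported_ev; apply: HS.
have HEs c s : (c < r)%N -> supported S (Eexp n m c i s).
  move=> cr; apply: supportedD; first exact/HK/ltnW.
  apply: supportedD; last by case: s; [|apply: supportedN]; apply: He.
  by apply: supportedD; [|apply: supportedN]; apply: He.
have HFs c s : (c < r)%N -> supported S (Fexp n m r c i s).
  move=> cr; apply: supportedD; last first.
    by apply: supportedN; apply: supportedD; [|apply: supportedN]; apply: HK.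
  apply: supportedD; last by case: s; [|apply: supportedN]; apply: He.
  by apply: supportedD; [|apply: supportedN]; apply: He.
case: H => ->.
- by apply: lspan_sum => c _; apply/lspanZ/lspanB; apply: tsupp_mon; apply: HEs.
- by apply: lspan_sum => c _; apply/lspanZ/lspanB; apply: tsupp_mon; apply: HFs.
- exact/tsupp_mon/HK.
- exact/tsupp_mon/supportedN/HK.
Qed.

Lemma copy_supp c u (S : pred (site n m)) : (forall p, S (inord c, p)) ->
  uq_gen n (oscE (opX c) (opY c)) (oscF (opX c) (opY c))
    (oscK (opT c) (opTi c)) (oscKi (opT c) (opTi c)) u -> tsupp q om (supported S) u.
Proof.
move=> HS [i [_ H]].
have He p b : supported S (ev c p b) by apply: supported_ev.
have HT : supported S (shiftT n m c i) by apply: shiftT_supp.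
have H1 p p' : supported S (ev c p false - ev c p' false).
  by apply: supportedD; [|apply: supportedN]; apply: He.
case: H => ->; rewrite ?oscE_mon ?oscF_mon ?oscK_mon ?oscKi_mon.
- apply/lspanZ/lspanB; apply: tsupp_mon; apply: supportedD => //; exact/supportedN/He.
- apply/lspanZ/lspanB; apply: tsupp_mon; apply: supportedD => //; exact/supportedN/He.
- exact: tsupp_mon.
- exact/tsupp_mon/supportedN.
Qed.

(** The empty coproduct is the trivial representation, with E and F zero and K equal to 1. Each
    further copy is added by [coproduct_rel]; it commutes with the previous ones because their
    supports use different sites. *)
Lemma rep_rel r : (r <= m.+1)%N -> uqrel q n (repE r) (repF r) (repK r) (repKi r).
Proof.
elim: r => [_|r IH rm].
  have e0 : repE 0 = fun=> 0 by apply/funext => i; rewrite /repE big_ord0.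
  have f0 : repF 0 = fun=> 0 by apply/funext => i; rewrite /repF big_ord0.
  have k0 : repK 0 = fun=> 1 by apply/funext => i; rewrite /repK /Kexp big_ord0 (tmon0 q (@omDl n m)).
  have ki0 : repKi 0 = fun=> 1.
    by apply/funext => i; rewrite /repKi /Kexp big_ord0 oppr0 (tmon0 q (@omDl n m)).
  rewrite e0 f0 k0 ki0; split=> *; rewrite ?mul0r ?mulr0 ?mulr1 ?scaler0 ?subrr //.
  - by rewrite scaler0; case: ifP.
  - by split=> *; rewrite /serre ?mul0r ?mulr0 ?scaler0 ?addr0 ?subr0.
  - by split=> *; rewrite /serre ?mul0r ?mulr0 ?scaler0 ?addr0 ?subr0.
have rm' : (r <= m)%N by [].
have -> : repE r.+1 = coE (repE r) (repK r) (oscE (opX r) (opY r)).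
  by apply/funext => i; apply: repE_recr.
have -> : repF r.+1 = coF (repF r) (oscF (opX r) (opY r)) (oscKi (opT r) (opTi r)).
  by apply/funext => i; apply: repF_recr.
have -> : repK r.+1 = coK (repK r) (oscK (opT r) (opTi r)).
  by apply/funext => i; apply: repK_recr.
have -> : repKi r.+1 = coKi (repKi r) (oscKi (opT r) (opTi r)).
  by apply/funext => i; apply: repKi_recr.
apply: (coproduct_rel q0 (IH (ltnW rm)) (copy_rel rm')) => u v gu gv.
pose S : pred (site n m) := [pred s | val s.1 < r]%N.
pose S' : pred (site n m) := [pred s | val s.1 == r]%N.
apply: (@tsupp_disjoint S S').
- by move=> s; rewrite /S /S' /=; apply: contraL => /eqP ->; rewrite ltnn.
- by apply: rep_supp gu => c p cr; rewrite /S /= inordK //; apply: leq_trans rm; apply: ltnW.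
- by apply: copy_supp gv => p; rewrite /S' /= inordK.
Qed.

End TorusRepresentation.

(** * Leading terms of root vectors *)

Section QcommBilinear.
Variables (k : fieldType) (A : algType k) (t : k).

Lemma qcommDl (x y z : A) : qcomm t (x + y) z = qcomm t x z + qcomm t y z.
Proof. by rewrite /qcomm; ncpoly k; ring. Qed.
Lemma qcommDr (x y z : A) : qcomm t x (y + z) = qcomm t x y + qcomm t x z.
Proof. by rewrite /qcomm; ncpoly k; ring. Qed.
Lemma qcomm_suml (I : Type) (r : seq I) (f : I -> A) z :
  qcomm t (\sum_(i <- r) f i) z = \sum_(i <- r) qcomm t (f i) z.
Proof.
elim: r => [|i r IH]; first by rewrite !big_nil /qcomm mul0r mulr0 scaler0 subrr.
by rewrite !big_cons qcommDl IH.
Qed.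
Lemma qcomm_sumr (I : Type) (r : seq I) (f : I -> A) z :
  qcomm t z (\sum_(i <- r) f i) = \sum_(i <- r) qcomm t z (f i).
Proof.
elim: r => [|i r IH]; first by rewrite !big_nil /qcomm mul0r mulr0 scaler0 subrr.
by rewrite !big_cons qcommDr IH.
Qed.

End QcommBilinear.

(** * Leading exponents of abstract root vectors *)

Section RootLeads.
Variables (k : fieldType) (q : k) (G : zmodType) (om : G -> G -> int).
Hypotheses (q0 : q != 0).
Hypotheses (omDl : forall a b c, om (a + b) c = om a c + om b c).
Hypotheses (omDr : forall a b c, om a (b + c) = om a b + om a c).
Variable pos : G -> bool.
Hypotheses (pos0 : ~~ pos 0) (posD : forall a b, pos a -> pos b -> pos (a + b)).
Notation tm := (@tmon k q G om).
Notation B := (fendo k G).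
Notation supp := (@tsupp k q G om).
Notation tlt := (tlt pos).

Definition commexp a b := om a b - om b a.

Lemma commexpDr a b c : commexp a (b + c) = commexp a b + commexp a c.
Proof. by rewrite /commexp omDl omDr; ring. Qed.

Lemma supp_tmon_swap (Q : G -> Prop) (u : B) a s : (forall b, Q b -> commexp a b = s) ->
  supp Q u -> u * tm a = q ^ (- s) *: (tm a * u).
Proof.
move=> H; elim=> [|c _ v [b Qb ->] _ IH]; first by rewrite mul0r mulr0 scaler0.
rewrite mulrDl mulrDr IH scalerDr; congr (_ + _).
rewrite -scalerAl -scalerAr scalerA mulrC -scalerA; congr (_ *: _).
by rewrite (tmon_comm q0 omDl omDr) -(H _ Qb) /commexp opprB.
Qed.

Variables (deg deg' : G -> int).
Hypotheses (degD : forall a b, deg (a + b) = deg a + deg b).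
Hypotheses (deg'D : forall a b, deg' (a + b) = deg' a + deg' b).
Hypothesis deg_tlt : forall a b, deg a < deg b -> tlt a b.
Hypothesis deg'_tlt : forall a b, deg a = deg b -> deg' a < deg' b -> tlt a b.

Variables (n : nat) (y : nat -> nat -> G) (kap : k) (sg : int) (E : nat -> B).
Let th := q ^ sg.
Hypotheses (kap0 : kap != 0) (th2 : 1 - th * th != 0).
Hypothesis EE : forall i, (i < n)%N -> exists2 R, supp (fun a => deg a < 2) R &
  E i = \sum_(c < n - i) kap *: tm (y i c) + R.
Hypothesis deg_y : forall i c, (i + c < n)%N -> deg (y i c) = 2.
Hypothesis deg'_y : forall i c, (i + c < n)%N -> deg' (y i c) = c.
Hypothesis y_next : forall i c c', (i + c < n)%N -> (i.+1 + c' < n)%N ->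
  commexp (y i.+1 c') (y i c) = if (c <= c')%N then - sg else sg.
Hypothesis y_far : forall i j c c', (i.+1 < j)%N -> (i + c < n)%N -> (j + c' < n)%N ->
  commexp (y j c') (y i c) = 0.

Definition rexp l j c := \sum_(i < j.+1) y (l + i) c.

(* The exponents occurring in the part of [e_{l,l+j}] whose last letter
   belongs to copy [c]. *)
Definition rsupp l j c (a : G) : Prop :=
  [/\ deg a = (2 * j.+1)%N, deg' a <= (c * j.+1)%N,
    (forall c', (l + j.+1 + c' < n)%N ->
      commexp (y (l + j.+1) c') a = if (c <= c')%N then - sg else sg)
  & (forall i c', (l + j.+1 < i)%N -> (i + c' < n)%N -> commexp (y i c') a = 0)].

Lemma rexpS l j c : rexp l j.+1 c = y (l + j.+1) c + rexp l j c.
Proof. by rewrite /rexp big_ord_recr addrC. Qed.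

Lemma rsuppS l j c c' a : (c <= c')%N -> (l + j.+1 + c' < n)%N ->
  rsupp l j c a -> rsupp l j.+1 c' (y (l + j.+1) c' + a).
Proof.
move=> cc' ln [da da' ca fa]; split.
- by rewrite degD deg_y // da; lia.
- rewrite deg'D deg'_y //; nia.
- move=> c'' ln'; rewrite commexpDr fa //; last by lia.
  by rewrite addr0 [(l + j.+2)%N]addnS y_next //; lia.
- move=> i c'' ln' ic; rewrite commexpDr fa ?addr0 ?y_far //; lia.
Qed.

Lemma rsupp_rexp l j c : (l + j + c < n)%N ->
  rsupp l j c (rexp l j c) /\ deg' (rexp l j c) = (c * j.+1)%N.
Proof.
elim: j => [|j IH] ln; last first.
  have [|H H'] := IH; first by lia.
  rewrite rexpS; split; first by apply: (rsuppS (leqnn c)).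
  by rewrite deg'D H' deg'_y //; lia.
rewrite /rexp big_ord_recl big_ord0 addr0 /= !addn0 in ln *.
split; last by rewrite deg'_y //; lia.
split.
- by rewrite deg_y.
- by rewrite deg'_y //; lia.
- by move=> c' ln'; rewrite addn1 y_next //; lia.
- by move=> i c' li ln'; rewrite y_far //; lia.
Qed.

(** The parameter q^sg cancels the commutation factor exactly when the new letter lies in an earlier
    copy. Otherwise the factor is its inverse, and 1 - th^2, which is nonzero, remains. *)
Lemma qcomm_rsupp l j c c' (u : B) : (l + j.+1 + c' < n)%N -> supp (rsupp l j c) u ->
  qcomm th (tm (y (l + j.+1) c')) u =
  if (c <= c')%N then (1 - th * th) *: (tm (y (l + j.+1) c') * u) else 0.
Proof.
move=> ln Hu; rewrite /qcomm.
have H b : rsupp l j c b -> commexp (y (l + j.+1) c') b = if (c <= c')%N then - sg else sg.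
  by case=> _ _ /(_ c' ln).
rewrite (supp_tmon_swap H Hu); case: ifP => _; rewrite scalerA.
  by rewrite opprK -/th scalerBl scale1r.
by rewrite /th -expfzDr // subrr expr0z scale1r subrr.
Qed.

(* The q-commutator with a letter from a smaller copy vanishes, so only words
   whose letters lie in weakly increasing copies survive; [Z c] collects those
   ending in copy [c]. *)
Lemma qroot_parts l j : (l + j < n)%N -> exists (Z : nat -> B) (R : B),
  [/\ qroot th E l j = \sum_(c < n - (l + j)) Z c + R,
      supp (fun a => deg a < (2 * j.+1)%N) R
    & forall c, (c < n - (l + j))%N -> exists2 d : k, d != 0 & exists2 W : B,
        supp (fun a => rsupp l j c a /\ deg' a < (c * j.+1)%N) W
        & Z c = d *: tm (rexp l j c) + W].
Proof.
elim: j => [|j IH] ln.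
  rewrite addn0 in ln *; have [R HR HE] := EE ln.
  exists (fun c => kap *: tm (y l c)), R; split=> // c cn.
  exists kap => //; exists 0; first exact: lspan_zero.
  by rewrite addr0 /rexp big_ord_recl big_ord0 addr0 addn0.
have [|Z [R [HZ HR Zc]]] := IH; first by lia.
have [|R' HR' HE] := EE (i := l + j.+1); first by lia.
set n' := (n - (l + j.+1))%N in HE *.
have n'S : (n - (l + j) = n'.+1)%N by rewrite /n'; lia.
rewrite n'S in HZ Zc.
set y' := y (l + j.+1) in HE.
have ln' c : (c < n')%N -> (l + j.+1 + c < n)%N by rewrite /n'; lia.
have suppZ c : (c < n'.+1)%N -> supp (rsupp l j c) (Z c).
  move=> cn; have [d _ [W HW ->]] := Zc c cn; apply: lspanD.
    by apply/lspanZ/tsupp_mon; case: (@rsupp_rexp l j c) => //; lia.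
  by apply: tsuppW HW => a [].
set SA := \sum_(c < n') _ in HE; set SZ := \sum_(c < n'.+1) _ in HZ.
have sA : supp (fun a => deg a <= 2) SA.
  by apply: lspan_sum => c _; apply/lspanZ/tsupp_mon; rewrite deg_y // ln'.
have sZ : supp (fun a => deg a <= (2 * j.+1)%N) SZ.
  by apply: lspan_sum => c _; apply: tsuppW (suppZ c (ltn_ord c)) => a [->].
have sR : supp (fun a => deg a <= (2 * j.+1)%N) R by apply: tsuppW HR => a /ltW.
have sM Q1 Q2 (Q : G -> Prop) u v : (forall a b, Q1 a -> Q2 b -> Q (a + b)) ->
    supp Q1 u -> supp Q2 v -> supp Q (qcomm th u v).
  move=> HQ Hu Hv; apply: lspanB; first exact: (tsuppM q0 omDl omDr HQ).
  by apply: lspanZ; apply: (tsuppM q0 omDl omDr _ Hv Hu) => a b Ha Hb; rewrite addrC; apply: HQ.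
exists (fun c' => \sum_(c < n'.+1)
    (if (c <= c')%N then (kap * (1 - th * th)) *: (tm (y' c') * Z c) else 0)),
  (qcomm th SA R + qcomm th R' (SZ + R)).
split.
- rewrite /= HZ HE qcommDl qcommDr -addrA; congr (_ + _).
  rewrite qcomm_suml; apply: eq_bigr => c' _; rewrite qcomm_sumr; apply: eq_bigr => c _.
  rewrite (_ : qcomm th (kap *: _) _ = kap *: qcomm th (tm (y' c')) (Z c)); last first.
    by rewrite /qcomm; ncpoly k; ring.
  rewrite (@qcomm_rsupp l j c c') ?ln' //; last exact: suppZ.
  by case: ifP => _; rewrite ?scaler0 // scalerA.
- apply: lspanD.
    by apply: (sM _ _ _ _ _ _ sA HR) => a b Ha Hb; rewrite degD; lia.
  apply: (sM _ _ _ _ _ _ HR' (lspanD sZ sR)) => a b Ha Hb; rewrite degD; lia.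
- move=> c' c'n; have c'n1 : (c' < n'.+1)%N by apply: ltnW.
  have [d d0 [W HW HZc]] := Zc c' c'n1.
  exists (kap * (1 - th * th) * d * q ^ om (y' c') (rexp l j c')).
    by rewrite !mulf_neq0 // expfz_neq0.
  exists ((kap * (1 - th * th)) *: (tm (y' c') * W) + \sum_(c < n'.+1 | val c != c')
    (if (c <= c')%N then (kap * (1 - th * th)) *: (tm (y' c') * Z c) else 0)); last first.
    rewrite (bigD1 (Ordinal c'n1)) //= leqnn addrA; congr (_ + _).
    rewrite HZc (mulrDr (tm (y' c'))) scalerDr; congr (_ + _).
    by rewrite -scalerAr (tmonM q0 omDl omDr) !scalerA rexpS.
  have sy : supp (eq (y' c')) (tm (y' c')) by apply: tsupp_mon.
  apply: lspanD.
    apply: lspanZ; apply: (tsuppM q0 omDl omDr _ sy HW) => _ a <- [Ha Ha'].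
    split; first by apply: (rsuppS (leqnn c') (ln' _ c'n)).
    by rewrite deg'D deg'_y ?ln' //; lia.
  apply: lspan_sum => c cc'; case: ifP => [le|_]; last exact: lspan_zero.
  have {cc' le} lt : (c < c')%N by rewrite ltn_neqAle cc'.
  apply: lspanZ; apply: (tsuppM q0 omDl omDr _ sy (suppZ c (ltn_ord c))) => _ a <- Ha.
  split; first by apply: rsuppS Ha; [apply: ltnW | apply: ln'].
  by case: Ha => _ Ha' _ _; rewrite deg'D deg'_y ?ln' //; nia.
Qed.

(** All the parts [Z c] of [qroot_parts] have the same degree, and their leading [deg'] grows with
    [c]; the last admissible copy n - 1 - (l+j) wins. *)
Lemma lead_qroot l j : (l + j < n)%N ->
  lead q om pos (rexp l j (n - (l + j).+1)) (qroot th E l j).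
Proof.
move=> ln; have [Z [R [-> HR Zc]]] := qroot_parts ln.
set c := (n - (l + j).+1)%N; have nS : (n - (l + j) = c.+1)%N by rewrite /c; lia.
rewrite nS in Zc *.
have lnc c' : (c' <= c)%N -> (l + j + c' < n)%N by rewrite /c; lia.
have [[dr _ _ _] dr'] := rsupp_rexp (lnc c (leqnn c)).
rewrite big_ord_recr /= -addrA addrC -addrA.
have [d d0 [W HW ->]] := Zc c (ltnSn c).
exists d => //; exists (W + (R + \sum_(c' < c) Z c')); last by rewrite -addrA.
apply: lspanD; first by apply: tsuppW HW => a [[da _ _ _] da']; apply: deg'_tlt; rewrite ?dr ?dr'.
apply: lspanD; first by apply: tsuppW HR => a da; apply: deg_tlt; rewrite dr.
apply: lspan_sum => c' _; have lt := ltn_ord c'.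
have [d' _ [W' HW' ->]] := Zc c' (ltnW lt).
have [[er _ _ _] er'] := rsupp_rexp (lnc c' (ltnW lt)).
apply: lspanD.
  by apply/lspanZ/tsupp_mon; apply: deg'_tlt; rewrite ?dr ?er // dr' er'; nia.
by apply: tsuppW HW' => a [[da _ _ _] da']; apply: deg'_tlt; rewrite ?dr ?dr' //; nia.
Qed.

End RootLeads.

(** * Exponents of root vectors *)

Section Weights.
Variables (n m : nat).
Hypothesis Hm : m.+1 = (2 * n)%N.
Notation G := (expo n m).
Notation om := (@om n m).
Notation ev := (@ev n m).
Notation cf := (@co n m).
Notation Ke := (Kexp n m).
Notation Ee := (Eexp n m).
Notation Fe := (Fexp n m m.+1).

Definition weight (w : nat -> nat -> bool -> int) (a : G) : int :=
  \sum_i w (val i.1.1) (val i.1.2) i.2 * a i.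

Lemma weightD w a b : weight w (a + b) = weight w a + weight w b.
Proof. by rewrite /weight -big_split; apply: eq_bigr => i _; rewrite ffunE mulrDr. Qed.
Lemma weightN w a : weight w (- a) = - weight w a.
Proof. by rewrite /weight -sumrN; apply: eq_bigr => i _; rewrite ffunE mulrN. Qed.
Lemma weight_sum w (I : Type) (r : seq I) (f : I -> G) :
  weight w (\sum_(i <- r) f i) = \sum_(i <- r) weight w (f i).
Proof.
elim: r => [|i r IH]; last by rewrite !big_cons weightD IH.
by rewrite !big_nil /weight big1 // => i _; rewrite ffunE mulr0.
Qed.

Lemma weight_ev w c p b : (c <= m)%N -> (p <= n)%N -> weight w (ev c p b) = w c p b.
Proof.
move=> cm pn; rewrite /weight (bigD1 ((inord c, inord p), b)) //= ffunE eqxx mulr1.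
rewrite big1 ?addr0 => [|i /negbTE ic]; last by rewrite ffunE ic mulr0.
by rewrite !inordK.
Qed.

(* The first [n] copies make the [E_i] with [i + c < n] dominant, the last
   [n] copies do the same for the [F_i]. *)
Definition wdeg (c p : nat) (b : bool) : int :=
  if b then 1 else if (c < n)%N then (n - c - p)%N%:Z else - (2 * n - c - p)%N%:Z.
(** The tie-breaker among monomials of equal degree: the index of the copy within its half, counted
    with the power of T, so that later copies win. *)
Definition wdeg' (c p : nat) (b : bool) : int :=
  if b then (if (c < n)%N then c else c - n)%N%:Z else 0.

Lemma weight_Kexp w r i : (r <= m.+1)%N -> (i < n)%N ->
  (forall c, w c i true = w c i.+1 true) -> weight w (Ke r i) = 0.
Proof.
move=> rm il H; rewrite weight_sum big1 // => c _; have lt := ltn_ord c.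
by rewrite /shiftT weightD weightN !weight_ev ?H ?subrr //; lia.
Qed.

Lemma weight_Eexp w c i s : (c <= m)%N -> (i < n)%N ->
  (forall c, w c i true = w c i.+1 true) ->
  weight w (Ee c i s) = w c i false - w c i.+1 false + (if s then w c i.+1 true else - w c i.+1 true).
Proof.
move=> cm il H; have il' := ltnW il; rewrite /Eexp !weightD weightN weight_Kexp //; last exact: leqW.
by rewrite !weight_ev // add0r; case: s; rewrite ?weightN weight_ev.
Qed.

Lemma weight_Fexp w c i s : (c <= m)%N -> (i < n)%N ->
  (forall c, w c i true = w c i.+1 true) ->
  weight w (Fe c i s) = w c i.+1 false - w c i false + (if s then w c i true else - w c i true).
Proof.
move=> cm il H; have il' := ltnW il; rewrite /Fexp !weightD !weightN weightD weightN.
rewrite !weight_Kexp // !(subr0, oppr0, addr0) !weight_ev //.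
by case: s; rewrite ?weightN weight_ev.
Qed.

Lemma deg_Eexp c i s : (c <= m)%N -> (i < n)%N ->
  weight wdeg (Ee c i s) =
  (if (c < n)%N then (i + c < n)%N%:Z else - (i + c < 2 * n)%N%:Z) + (if s then 1 else -1).
Proof.
move=> cm il; rewrite weight_Eexp // /wdeg; congr (_ + _).
case: ifP => cn; case: ltnP => /= H; lia.
Qed.

Lemma deg_Fexp c i s : (c <= m)%N -> (i < n)%N ->
  weight wdeg (Fe c i s) =
  (if (c < n)%N then - (i + c < n)%N%:Z else (i + c < 2 * n)%N%:Z) + (if s then 1 else -1).
Proof.
move=> cm il; rewrite weight_Fexp // /wdeg; congr (_ + _).
case: ifP => cn; case: ltnP => /= H; lia.
Qed.

Lemma om_Eexp a c i s : om a (Ee c i s) = cf c i true a - cf c i.+1 true a.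
Proof.
rewrite /Eexp !omDr omNr om_Tr !om_evxr add0r.
by case: s; rewrite ?omNr om_evTr ?oppr0 addr0.
Qed.

Lemma om_Fexp a c i s : om a (Fe c i s) = cf c i.+1 true a - cf c i true a.
Proof.
rewrite /Fexp !omDr !omNr omDr omNr !om_Tr !(subr0, oppr0, addr0) !om_evxr.
by case: s; rewrite ?omNr om_evTr ?oppr0 addr0.
Qed.

Lemma co_Kexp_true c p r i : (c <= m)%N -> (p <= n)%N -> (r <= m.+1)%N -> (i < n)%N ->
  cf c p true (Ke r i) = (c < r)%N%:Z * ((p == i)%:Z - (p == i.+1)%:Z).
Proof.
move=> cm pn rm il; have il' := ltnW il; rewrite /Kexp co_sum.
elim: r rm => [|r IH] rm; first by rewrite big_ord0 mul0r.
rewrite big_ord_recr /= (IH (ltnW rm)) /shiftT coD coN !co_ev // ?eqxx ?andbT.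
rewrite ltnS.
by case: (ltngtP c r) => /= _; rewrite ?mul0r ?mul1r ?subrr ?addr0 ?add0r.
Qed.

Lemma co_Kexp_false c p r i : cf c p false (Ke r i) = 0.
Proof.
rewrite /Kexp co_sum big1 // => c' _; rewrite /shiftT coD coN /co !ffunE.
by rewrite !xpair_eqE !andbF subrr.
Qed.

Lemma co_Eexp c p c' i : (c <= m)%N -> (c' <= m)%N -> (p <= n)%N -> (i < n)%N ->
  cf c p true (Ee c' i true) =
  (c < c')%N%:Z * ((p == i)%:Z - (p == i.+1)%:Z) + ((c == c') && (p == i.+1))%:Z.
Proof.
move=> cm cm' pn il; have il' := ltnW il.
rewrite /Eexp !coD coN co_Kexp_true ?(leqW cm') // !co_ev // !andbF subrr add0r.
by rewrite andbT.
Qed.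

Lemma co_Fexp c p c' i : (c <= m)%N -> (c' <= m)%N -> (p <= n)%N -> (i < n)%N ->
  cf c p true (Fe c' i true) =
  ((c == c') && (p == i))%:Z - (c' < c)%N%:Z * ((p == i)%:Z - (p == i.+1)%:Z).
Proof.
move=> cm cm' pn il; have il' := ltnW il.
rewrite /Fexp !coD !coN coD coN !co_Kexp_true // !co_ev // !andbF subrr add0r andbT.
congr (_ - _); rewrite -mulrBl; congr (_ * _).
by case: (ltngtP c' c) => ?; rewrite ltnS; lia.
Qed.

Lemma Eexp_next i c c' : (i + c < n)%N -> (i.+1 + c' < n)%N ->
  commexp om (Ee c' i.+1 true) (Ee c i true) = if (c <= c')%N then - 1 else 1.
Proof.
move=> ic ic'; rewrite /commexp !om_Eexp !co_Eexp; try lia.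
by case: (ltngtP c c') => _ /=; lia.
Qed.

Lemma Eexp_far i j c c' : (i.+1 < j)%N -> (i + c < n)%N -> (j + c' < n)%N ->
  commexp om (Ee c' j true) (Ee c i true) = 0.
Proof.
move=> ij ic jc; rewrite /commexp !om_Eexp !co_Eexp; lia.
Qed.

Lemma Fexp_next i c c' : (i + c < n)%N -> (i.+1 + c' < n)%N ->
  commexp om (Fe (n + c') i.+1 true) (Fe (n + c) i true) = if (c <= c')%N then - (-1) else (-1).
Proof.
move=> ic ic'; rewrite /commexp !om_Fexp !co_Fexp; try lia.
by rewrite !ltn_add2l !eqn_add2l; case: (ltngtP c c') => _ /=; lia.
Qed.

Lemma Fexp_far i j c c' : (i.+1 < j)%N -> (i + c < n)%N -> (j + c' < n)%N ->
  commexp om (Fe (n + c') j true) (Fe (n + c) i true) = 0.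
Proof.
move=> ij ic jc; rewrite /commexp !om_Fexp !co_Fexp; lia.
Qed.

End Weights.

Lemma In_mapP (I : eqType) (T : Type) (F : I -> T) (s : seq I) (x : T) :
  List.In x [seq F i | i <- s] -> exists2 i, i \in s & x = F i.
Proof.
elim: s => //= i s IH [<-|/IH[j js ->]]; first by exists i; rewrite ?mem_head.
by exists j; rewrite // inE js orbT.
Qed.

Lemma In_map (I : eqType) (T : Type) (F : I -> T) (s : seq I) i :
  i \in s -> List.In (F i) [seq F i | i <- s].
Proof.
elim: s => //= j s IH; rewrite inE => /orP[/eqP ->|/IH]; by [left | right].
Qed.

(** * The order on exponents *)

Section ExponentOrder.
Variables (n m : nat).
Hypothesis Hm : m.+1 = (2 * n)%N.
Notation G := (expo n m).
Notation om := (@om n m).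
Notation deg := (weight (@wdeg n)).
Notation deg' := (weight (@wdeg' n)).

(** The two weights decide every comparison that matters for root vectors; the coordinates after
    them only make the order total. *)
Definition exponent_order : seq (G -> int) :=
  deg :: deg' :: [seq (fun a : G => a i) | i <- index_enum (site n m * bool)%type].

Definition tpos : G -> bool := lexpos exponent_order.

Fact exponent_order_additive f : List.In f exponent_order -> additive_fun f.
Proof.
rewrite /exponent_order /=; case=> [<-|[<-|H]] a b; try exact: weightD.
by have [i _ ->] := In_mapP H; rewrite ffunE.
Qed.

Fact tpos0 : ~~ tpos 0. Proof. exact/lexpos0/exponent_order_additive. Qed.

Fact tposD a b : tpos a -> tpos b -> tpos (a + b).
Proof. exact/lexposD/exponent_order_additive. Qed.

Fact tpos_total a : a != 0 -> tpos a || tpos (- a).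
Proof.
apply: lexpos_total; first exact: exponent_order_additive.
move=> H; apply/ffunP => i; rewrite ffunE; apply: (H (fun a : G => a i)).
by right; right; apply: (In_map (fun i (a : G) => a i)); apply: mem_index_enum.
Qed.

Fact deg_tlt a b : deg a < deg b -> tlt tpos a b.
Proof. by move=> ab; rewrite /tlt /tpos /= weightD weightN subr_gt0 ab. Qed.

Fact deg'_tlt a b : deg a = deg b -> deg' a < deg' b -> tlt tpos a b.
Proof.
move=> e ab; rewrite /tlt /tpos /= !weightD !weightN e subrr eqxx subr_gt0 ab.
by rewrite orbT.
Qed.

Definition yE i c := Eexp n m c i true.
Definition yF i c := Fexp n m m.+1 (n + c) i true.

Lemma deg_yE i c : (i + c < n)%N -> deg (yE i c) = 2.
Proof. move=> ic; rewrite deg_Eexp; try lia; case: ifP; lia. Qed.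
Lemma deg_yF i c : (i + c < n)%N -> deg (yF i c) = 2.
Proof. move=> ic; rewrite deg_Fexp; try lia; case: ifP; lia. Qed.
Lemma deg'_yE i c : (i + c < n)%N -> deg' (yE i c) = c.
Proof.
move=> ic; rewrite weight_Eexp //; try lia.
by rewrite /wdeg' subrr add0r (_ : (c < n)%N) //; lia.
Qed.
Lemma deg'_yF i c : (i + c < n)%N -> deg' (yF i c) = c.
Proof.
move=> ic; rewrite weight_Fexp //; try lia.
by rewrite /wdeg' subrr add0r ltnNge leq_addr /= addKn.
Qed.

Definition rootE_exp l j := rexp yE l j (n - (l + j).+1).
Definition rootF_exp l j := rexp yF l j (n - (l + j).+1).

(** The x-exponents of consecutive letters telescope, leaving the two ends l and l+j+1. *)
Lemma co_rexpE c p l j d : (c <= m)%N -> (p <= n)%N -> (l + j < n)%N -> (d <= m)%N ->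
  co c p false (rexp yE l j d) = (c == d)%:Z * ((p == l)%:Z - (p == (l + j.+1)%N)%:Z).
Proof.
move=> cm pn ln dm; elim: j ln => [|j IH] ln.
  rewrite /rexp big_ord_recl big_ord0 addr0 addn0 addn1 /yE /Eexp !coD coN co_Kexp_false.
  rewrite !co_ev //; try lia; rewrite ?andbF ?andbT /=; case: eqP => /= _; lia.
rewrite rexpS coD IH; last by lia.
rewrite /yE /Eexp !coD coN co_Kexp_false !co_ev //; lia.
Qed.

Lemma co_rexpF c p l j d : (c <= m)%N -> (p <= n)%N -> (l + j < n)%N -> (n + d <= m)%N ->
  co c p false (rexp yF l j d) = (c == n + d)%N%:Z * ((p == (l + j.+1)%N)%:Z - (p == l)%:Z).
Proof.
move=> cm pn ln dm; elim: j ln => [|j IH] ln.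
  rewrite /rexp big_ord_recl big_ord0 addr0 addn0 addn1 /yF /Fexp !coD !coN coD coN !co_Kexp_false.
  rewrite !co_ev //; try lia; rewrite ?andbF ?andbT /=; case: eqP => /= _; lia.
rewrite rexpS coD IH; last by lia.
rewrite /yF /Fexp !coD !coN coD coN !co_Kexp_false !co_ev //; lia.
Qed.

End ExponentOrder.

Section TorusLeads.
Variables (k : fieldType) (q : k) (n m : nat).
Hypotheses (q0 : q != 0) (qq : q - q^-1 != 0) (Hm : m.+1 = (2 * n)%N).
Notation G := (expo n m).
Notation om := (@om n m).
Let omDl := @omDl n m.
Let omDr := @omDr n m.
Notation deg := (weight (@wdeg n)).
Notation deg' := (weight (@wdeg' n)).
Notation tpos := (@tpos n m).
Notation yE := (@yE n m).
Notation yF := (@yF n m).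
Notation tm := (@tmon k q G om).
Notation supp := (@tsupp k q G om).
Let kap := (q - q^-1)^-1.

(** [tp] and [tn] are the two monomials of each copy, from T and T^-1 in [y]. Only the T-monomials
    of the [l] copies from [off] on are kept; the window starts at 0 for E_i and at n for F_i. *)
Lemma split_top (tp tn : nat -> G) M off l : (off + l <= M)%N ->
  (forall c, (c < M)%N -> deg (tn c) < 2) ->
  (forall c, (c < M)%N -> ~~ (off <= c < off + l)%N -> deg (tp c) < 2) ->
  exists2 R, supp (fun a => deg a < 2) R &
    \sum_(c < M) kap *: (tm (tp c) - tm (tn c)) = \sum_(c < l) kap *: tm (tp (off + c)%N) + R.
Proof.
move=> lM Hn Hp.
exists (\sum_(c < M | ~~ (off <= c < off + l)%N) kap *: tm (tp c)
        + \sum_(c < M) - (kap *: tm (tn c))).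
  apply: lspanD; apply: lspan_sum => c.
    by move=> Hc; apply/lspanZ/tsupp_mon/Hp.
  by move=> _; apply/lspanN/lspanZ/tsupp_mon/Hn.
rewrite addrA; transitivity (\sum_(c < M) kap *: tm (tp c) + \sum_(c < M) - (kap *: tm (tn c))).
  by rewrite -big_split; apply: eq_bigr => c _; rewrite scalerBr.
congr (_ + _); rewrite (bigID (fun c : 'I_M => off <= c < off + l)%N) /=; congr (_ + _).
rewrite -(big_mkord (fun c => off <= c < off + l)%N (fun c => kap *: tm (tp c))).
rewrite -(big_mkord xpredT (fun c => kap *: tm (tp (off + c)%N))).
transitivity (\sum_(off <= c < off + l) kap *: tm (tp c)).
  rewrite [RHS](big_nat_widen _ _ M) // [RHS](big_nat_widenl _ 0) //.
  by apply: eq_bigl => c; rewrite andbC.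
by rewrite -{1}[off]add0n big_addn addKn; apply: eq_bigr => c _; rewrite addnC.
Qed.

Lemma one_sub_sqr (t : k) : t - t^-1 != 0 -> 1 - t * t != 0.
Proof.
have [->|t0] := eqVneq t 0; first by rewrite mulr0 subr0 oner_neq0.
apply: contraNneq => H; have : t^-1 * (1 - t * t) = 0 by rewrite H mulr0.
by rewrite mulrBr mulr1 mulrA mulVf // mul1r => /eqP; rewrite subr_eq0 => /eqP ->; rewrite subrr.
Qed.

Lemma lead_rootE l j : (l + j < n)%N ->
  lead q om tpos (rexp yE l j (n - (l + j).+1)) (qroot q (repE q n m m.+1) l j).
Proof.
move=> ln; rewrite -[X in qroot X]expr1z.
apply: (@lead_qroot k q G om q0 omDl omDr tpos (@tpos0 n m) deg deg' _ _ (@deg_tlt n m) (@deg'_tlt n m) n yE kap 1) => //.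
- exact: weightD.
- exact: weightD.
- by rewrite invr_eq0.
- by rewrite expr1z one_sub_sqr.
- move=> i il; have [|c cm|c cm Hc|R HR HE] := @split_top (fun c => Eexp n m c i true)
    (fun c => Eexp n m c i false) m.+1 0 (n - i).
  + by rewrite Hm; lia.
  + by rewrite deg_Eexp //; case: ifP => ?; lia.
  + by rewrite deg_Eexp //; case: ifP => ?; lia.
  by exists R.
- exact: deg_yE.
- exact: deg'_yE.
- move=> i c c' ic ic'; rewrite Eexp_next //; lia.
- move=> i i' c c' ii' ic ic'; rewrite Eexp_far //; lia.
Qed.

Lemma lead_rootF l j : (l + j < n)%N ->
  lead q om tpos (rexp yF l j (n - (l + j).+1)) (qroot q^-1 (repF q n m m.+1) l j).
Proof.
move=> ln; rewrite -[X in qroot X^-1]expr1z invr_expz.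
apply: (@lead_qroot k q G om q0 omDl omDr tpos (@tpos0 n m) deg deg' _ _ (@deg_tlt n m) (@deg'_tlt n m) n yF kap (-1)) => //.
- exact: weightD.
- exact: weightD.
- by rewrite invr_eq0.
- rewrite -invr_expz expr1z one_sub_sqr // invrK -opprB oppr_eq0 //.
- move=> i il; have [|c cm|c cm Hc|R HR HE] := @split_top (fun c => Fexp n m m.+1 c i true)
    (fun c => Fexp n m m.+1 c i false) m.+1 n (n - i).
  + by rewrite Hm; lia.
  + by rewrite deg_Fexp //; case: ifP => ?; lia.
  + by rewrite deg_Fexp //; case: ifP => ?; lia.
  by exists R.
- exact: deg_yF.
- exact: deg'_yF.
- move=> i c c' ic ic'; rewrite Fexp_next //; lia.
- move=> i i' c c' ii' ic ic'; rewrite Fexp_far //; lia.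
Qed.

End TorusLeads.

(** * Dimension of finite spans *)

Section Dimension.
Variable A : algType C.

Definition spanned (s : seq A) : A -> Prop := lspan (fun y => y \in s).

Lemma inspanP x s : inspan x s <-> spanned s x.
Proof.
split=> [[c ->]|].
  by apply: lspan_sum => i _; apply/lspanZ/lspan_mem/mem_nth.
elim=> [|c y z ys _ [d ->]].
  by exists (fun=> 0); rewrite big1 // => i _; rewrite scale0r.
have ylt : (index y s < size s)%N by rewrite index_mem.
exists (fun i => (if i == Ordinal ylt then c else 0) + d i).
under [in RHS]eq_bigr do rewrite scalerDl.
rewrite big_split /=; congr (_ + _).
rewrite (bigD1 (Ordinal ylt)) //= eqxx nth_index // big1 ?addr0 // => i /negbTE ->.
exact: scale0r.
Qed.

Definition free_fam w (u : 'I_w -> A) : Prop :=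
  forall c : 'I_w -> C, \sum_(i < w) c i *: u i = 0 -> forall i, c i = 0.

Lemma spanned_trans s r x : (forall y, y \in s -> spanned r y) -> spanned s x -> spanned r x.
Proof. by move=> H Hx; apply: (lspan_map (f := id) _ _ Hx). Qed.

(** The coordinates of the [u i] over [r] form a matrix with [w] rows; with fewer columns than rows
    its left kernel would contain a linear relation among the [u i]. *)
Lemma steinitz w (u : 'I_w -> A) r : free_fam u -> (forall i, spanned r (u i)) ->
  (w <= size r)%N.
Proof.
move=> fu Hu; rewrite leqNgt; apply/negP => rw.
have H i : exists c : 'I_(size r) -> C, u i = \sum_(j < size r) c j *: r`_j.
  exact/inspanP.
have [M HM] := boolp.choice H.
pose X := \matrix_(i < w, j < size r) M i j.
have : kermx X != 0.
  by rewrite -mxrank_eq0 mxrank_ker subn_eq0 -ltnNge; apply: leq_ltn_trans rw; apply: rank_leq_col.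
case/rowV0Pn => v /sub_kermxP vX v0; case/eqP: v0; apply/rowP => i; rewrite mxE.
apply: (fu (fun i => v 0 i)); under eq_bigr do rewrite HM scaler_sumr.
rewrite exchange_big /= big1 // => j _; under eq_bigr do rewrite scalerA.
rewrite -scaler_suml; have := congr1 (fun Y : 'rV_(size r) => Y 0 j) vX.
rewrite !mxE; under eq_bigr do rewrite mxE; by move=> ->; rewrite scale0r.
Qed.

Lemma dimspan_le s r : (forall x, x \in s -> spanned r x) -> (dimspan s <= size r)%N.
Proof.
move=> H; apply/bigmax_leqP => m /asboolP fm.
by apply: (steinitz fm) => i; apply: H; apply: (mem_mask (m := m)); apply: mem_nth.
Qed.

Lemma lin_free_cons x r : lin_free r -> ~ spanned r x -> lin_free (x :: r).
Proof.
move=> fr nx c; rewrite big_ord_recl /= => H.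
have c0 : c ord0 = 0.
  apply: contrapT => /eqP c0; apply: nx.
  rewrite -[x]scale1r -(mulVf c0) -scalerA; apply: lspanZ.
  move/eqP: H; rewrite addr_eq0 => /eqP ->; apply: lspanN.
  apply: lspan_sum => i _; apply/lspanZ/lspan_mem.
  exact: (@mem_nth _ 0 r i (ltn_ord i)).
move: H; rewrite c0 scale0r add0r => H i.
by case: (unliftP ord0 i) => [j ->|-> //]; apply: (fr (fun j => c (lift ord0 j))).
Qed.

Lemma basis_mask s : exists m : (size s).-tuple bool,
  lin_free (mask m s) /\ forall x, x \in s -> spanned (mask m s) x.
Proof.
elim: s => [|x s [m [fm sm]]].
  by exists [tuple]; split=> // c _ i; case: i (ltn_ord i).
have [xs|nx] := EM (spanned (mask m s) x).
  exists [tuple of false :: m]; split=> //= y.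
  by rewrite inE => /orP[/eqP -> //|/sm].
exists [tuple of true :: m]; split=> /=; first exact: lin_free_cons.
move=> y; rewrite inE => /orP[/eqP ->|/sm]; first by apply: lspan_mem; rewrite mem_head.
by apply: lspan_sub => z zm; rewrite inE zm orbT.
Qed.

Lemma dimspan_ge w (u : 'I_w -> A) s : free_fam u -> (forall i, spanned s (u i)) ->
  (w <= dimspan s)%N.
Proof.
move=> fu Hu; have [m [fm sm]] := basis_mask s.
apply: (@leq_trans (size (mask m s))).
  by apply: (steinitz fu) => i; apply: (spanned_trans sm).
by apply: (leq_bigmax_cond m); apply/asboolP.
Qed.

Lemma dimspan_basis s : exists u : 'I_(dimspan s) -> A,
  free_fam u /\ forall i, spanned s (u i).
Proof.
have [m [fm sm]] := basis_mask s.
have -> : dimspan s = size (mask m s).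
  apply/eqP; rewrite eqn_leq dimspan_le //=.
  by apply: (leq_bigmax_cond m); apply/asboolP.
exists (fun i => (mask m s)`_i); split=> // i.
by apply/lspan_mem/(mem_mask (m := m))/mem_nth.
Qed.

Lemma dimspan_sub s r : (forall x, x \in s -> spanned r x) -> (dimspan s <= dimspan r)%N.
Proof.
move=> H; have [u [fu su]] := dimspan_basis s.
by apply: (dimspan_ge fu) => i; apply: (spanned_trans H).
Qed.

Lemma prodspan_mem (s t : seq A) v w : v \in s -> w \in t -> v * w \in prodspan s t.
Proof. by move=> vs wt; apply/allpairsP; exists (v, w). Qed.

Lemma prodspanP (s t : seq A) x : x \in prodspan s t ->
  exists v w, [/\ v \in s, w \in t & x = v * w].
Proof. by case/allpairsP => -[v w] [/= vs wt ->]; exists v, w. Qed.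

Lemma spanned_prod (s t : seq A) x y : spanned s x -> spanned t y ->
  spanned (prodspan s t) (x * y).
Proof.
move=> Hx Hy; apply: lspan_mulr Hx => v vs; apply: lspan_mull Hy => w wt.
by apply/lspan_mem/prodspan_mem.
Qed.

(** Powers are built by multiplying on the right, whereas the inequalities of LD have V on the left
    of W = V^m. *)
Lemma powspan_comm (s : seq A) m :
  dimspan (powspan s m.+1) = dimspan (prodspan s (powspan s m)).
Proof.
have H1 : forall m x, x \in powspan s m.+1 -> spanned (prodspan s (powspan s m)) x.
  elim=> [|{}m IH] x.
    move=> /prodspanP[v [w [/= vs ws ->]]]; move: vs; rewrite inE => /eqP ->.
    by rewrite mul1r -[w]mulr1; apply/lspan_mem/prodspan_mem; rewrite ?mem_head.
  move=> /prodspanP[v [w [/IH Hv ws ->]]].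
  apply: lspan_mulr Hv => _ /prodspanP[a [b [as_ bm ->]]].
  by rewrite -mulrA; apply/lspan_mem/prodspan_mem => //; apply: prodspan_mem.
have H2 : forall m x, x \in prodspan s (powspan s m) -> spanned (powspan s m.+1) x.
  elim=> [|{}m IH] x /prodspanP[v [w [vs wm ->]]].
    move: wm; rewrite inE => /eqP ->.
    by rewrite mulr1 -[v]mul1r; apply/lspan_mem/prodspan_mem; rewrite ?mem_head.
  have [a [b [am bs ->]]] := prodspanP wm.
  rewrite mulrA; have Hv : spanned (powspan s m.+1) (v * a).
    by apply: IH; apply: prodspan_mem.
  by apply: lspan_mulr Hv => u um; apply/lspan_mem/prodspan_mem.
by apply/eqP; rewrite eqn_leq !dimspan_sub //; [exact: H2 | exact: H1].
Qed.

Lemma dimspan_pow0 (s : seq A) : (0 < dimspan (powspan s 0))%N.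
Proof.
apply: (@dimspan_ge 1 (fun=> 1)) => [c|i]; last by apply: lspan_mem; rewrite mem_head.
rewrite big_ord_recl big_ord0 addr0 => /eqP; rewrite scaler_eq0 oner_eq0 orbF => /eqP c0 i.
by rewrite ord1.
Qed.

End Dimension.

(** * Isoperimetry in a lattice *)

Lemma sum_count_fibers (T S : eqType) (f : T -> S) (a : pred T) (r : seq S) (t : seq T) :
  uniq r -> (forall x, x \in t -> f x \in r) ->
  (\sum_(z <- r) count (fun x => (f x == z) && a x) t = count a t)%N.
Proof.
move=> ur; elim: t => [|x t IH] H /=; first by rewrite big1.
rewrite big_split /= IH; last by move=> y yt; apply: H; rewrite inE yt orbT.
congr (_ + _)%N; case: (a x); last by rewrite big1 // => z _; rewrite andbF.
transitivity (count_mem (f x) r); last by rewrite count_uniq_mem // H // mem_head.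
by rewrite -sum1_count [RHS]big_mkcond; apply: eq_bigr => z _; rewrite andbT eq_sym /=; case: eqP.
Qed.

Section Isoperimetry.
Variable J : finType.
Notation vec := {ffun J -> int}.

Definition unitv (p : J) : vec := [ffun j => (j == p)%:Z].

Definition boundary p (T : seq vec) : nat := count (fun t => t + unitv p \notin T) T.

(** Walking from [t] in direction [p] must leave the finite set; [t'] is a point just before an
    exit. *)
Lemma boundary_top (T : seq vec) p t : t \in T -> exists t' : vec,
  [/\ t' \in T, t' + unitv p \notin T & forall j, j != p -> t' j = t j].
Proof.
move=> tT; pose f k : vec := t + unitv p *+ k.
have [k fk] : exists k, f k \notin T.
  apply: contrapT => nH.
  have H k : f k \in T by apply: contrapT => /negP fk; apply: nH; exists k.
  suff : (size (map f (iota 0 (size T).+1)) <= size T)%N by rewrite size_map size_iota ltnn.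
  apply: uniq_leq_size => [|_ /mapP[k _ ->] //].
  rewrite map_inj_uniq ?iota_uniq // => k l /addrI /(congr1 (fun g : vec => g p)).
  by rewrite !ffunMnE !ffunE eqxx; lia.
elim: k fk => [|k IH]; first by rewrite /f mulr0n addr0 tT.
have [fk fk1|] := boolP (f k \in T); last by move=> /IH.
exists (f k); split=> // [|j jp].
  by rewrite /f -addrA -mulrSr.
by rewrite /f !ffunE ffunMnE ffunE (negbTE jp) mul0rn addr0.
Qed.

(** Distinct points of a hyperplane slice lie on distinct lines in direction [p], and each such line
    holds a boundary point. *)
Lemma fiber_le_boundary (T : seq vec) p z : uniq T ->
  (size [seq t <- T | (t : vec) p == z] <= boundary p T)%N.
Proof.
move=> uT; have H (t : vec) : exists t' : vec, t \in T ->
    [/\ t' \in T, t' + unitv p \notin T & forall j, j != p -> t' j = t j].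
  have [/(@boundary_top _ p)[t' Ht']|_] := boolP (t \in T); first by exists t'.
  by exists t.
have [top Htop] := boolp.choice H.
rewrite -(size_map top) /boundary -size_filter; apply: uniq_leq_size.
  rewrite map_inj_in_uniq ?filter_uniq // => t t'.
  rewrite !mem_filter => /andP[/eqP tz tT] /andP[/eqP t'z t'T] e.
  have [_ _ Ht] := Htop t tT; have [_ _ Ht'] := Htop t' t'T.
  apply/ffunP => j; have [->|jp] := eqVneq j p; first by rewrite tz t'z.
  by rewrite -Ht // -Ht' // e.
move=> x /mapP[t]; rewrite mem_filter => /andP[_ tT] ->.
by have [t'T nt' _] := Htop t tT; rewrite mem_filter nt'.
Qed.

(* Induction on the number of directions: if some boundary is at least
   [lam ^ (d - 1)] it alone suffices; otherwise every hyperplane slice is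
   smaller than [lam ^ (d - 1)] and the induction hypothesis applies to it. *)
Lemma isoperimetry (R : realFieldType) (lam : R) (ds : seq J) (T : seq vec) :
  0 < lam -> uniq ds -> uniq T ->
  (forall t t' : vec, t \in T -> t' \in T -> forall j, j \notin ds -> t j = t' j) ->
  (size T)%:R < lam ^+ size ds ->
  (size T)%:R <= lam * \sum_(p <- ds) (boundary p T)%:R.
Proof.
move=> lam0; elim: ds T => [|p ds IH] T.
  move=> _ _ _; rewrite expr0 ltrn1 ltnS leqn0 => /nilP ->.
  by rewrite big_nil mulr0.
move=> /= /andP[pds uds] uT agree small; rewrite big_cons mulrDr.
have sum_ge0 (T' : seq vec) : 0 <= lam * \sum_(p <- ds) (boundary p T')%:R :> R.
  by apply: mulr_ge0; [apply: ltW | apply: sumr_ge0].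
have [big|slim] := lerP (lam ^+ size ds) (boundary p T)%:R.
  apply: (@le_trans _ _ (lam * (boundary p T)%:R)); last by rewrite lerDl.
  by apply: ltW; apply: (lt_le_trans small); rewrite exprS ler_pM2l.
apply: (@le_trans _ _ (lam * \sum_(p <- ds) (boundary p T)%:R)); last first.
  by rewrite lerDr mulr_ge0 // ltW.
pose zs := undup [seq (t : vec) p | t <- T].
pose slice z := [seq t <- T | (t : vec) p == z].
have zsP t : t \in T -> (t : vec) p \in zs by move=> tT; rewrite mem_undup (map_f (fun t : vec => t p)).
have fibers a : (\sum_(z <- zs) count (fun t : vec => (t p == z) && a t) T = count a T)%N.
  by apply: sum_count_fibers => //; apply: undup_uniq.
have slice_bound z : (size (slice z))%:R <= lam * \sum_(p <- ds) (boundary p (slice z))%:R.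
  apply: IH => //; first exact: filter_uniq.
    move=> t t'; rewrite !mem_filter => /andP[/eqP tz tT] /andP[/eqP t'z t'T] j jds.
    have [->|jp] := eqVneq j p; first by rewrite tz t'z.
    by apply: agree => //; rewrite inE negb_or jp.
  by apply: le_lt_trans slim; rewrite ler_nat; apply: fiber_le_boundary.
have -> : size T = (\sum_(z <- zs) size (slice z))%N.
  rewrite -(count_predT T) -fibers; apply: eq_bigr => z _.
  by rewrite size_filter; apply: eq_count => t; rewrite andbT.
rewrite natr_sum; apply: (le_trans (ler_sum _ (fun z _ => slice_bound z))).
rewrite -mulr_sumr exchange_big /= ler_pM2l // big_seq [leRHS]big_seq.
(* A step in a direction other than [p] stays inside its slice, so the boundaries of the slices add
   up to at most the boundary of [T]. *)
apply: ler_sum => p' p'ds; rewrite -natr_sum ler_nat /boundary -fibers leq_sum // => z _.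
rewrite count_filter; apply: sub_count => t /= /andP[]; rewrite mem_filter negb_and.
have -> : (t + unitv p') p == z = (t p == z).
  by rewrite !ffunE (_ : p == p' = false) ?addr0 //; apply: contraNF pds => /eqP ->.
by case: eqP.
Qed.

End Isoperimetry.

(** * Growth and the dimensions GK and LD *)

Section Limsup.
Variable R : realType.

Lemma limn_esup_le (u : nat -> \bar R) (l : R) :
  (forall e : R, 0 < e -> exists N, forall m, (N <= m)%N -> (u m <= (l + e)%:E)%E) ->
  (limn_esup u <= l%:E)%E.
Proof.
move=> H; apply/lee_addgt0Pr => e e0; have [N HN] := H e e0.
apply: (@le_trans _ _ (ereal_sup (u @` [set m | (N <= m)%N])%classic)).
  by apply: ereal_inf_lbound; exists [set m | (N <= m)%N]%classic => //; exists N.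
by apply: ge_ereal_sup => _ [m /= Nm <-]; rewrite -EFinD; apply: HN.
Qed.

Lemma limn_esup_ge (u : nat -> \bar R) (l : R) :
  (forall e : R, 0 < e -> forall N, exists2 m, (N <= m)%N & ((l - e)%:E <= u m)%E) ->
  (l%:E <= limn_esup u)%E.
Proof.
move=> H; apply: le_ereal_inf_tmp => _ [V [N _ NV] <-].
apply/lee_subgt0Pr => e e0; have [m Nm um] := H e e0 N.
apply: (le_trans um); apply: ereal_sup_ubound; exists m => //; exact: NV.
Qed.

Lemma ln_nat_large (a e : R) : 0 < e -> exists N, forall m, (N <= m)%N ->
  (1 < m)%N /\ a <= e * ln m%:R.
Proof.
move=> e0; exists (Num.truncn (expR (a / e))).+2 => m mN.
have m1 : (1 < m)%N by apply: leq_trans mN.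
have mp : 0 < m%:R :> R by rewrite ltr0n; apply: ltnW.
split=> //; rewrite mulrC -ler_pdivrMr // -[leLHS]expRK ler_ln ?posrE ?expR_gt0 //.
apply: ltW; apply: (lt_le_trans (truncnS_gt _)); rewrite ler_nat; exact: ltnW.
Qed.

Lemma growth_limsup_le (D : nat -> nat) (c : R) (d : nat) :
  (forall m, (0 < D m)%N) ->
  (forall m, (0 < m)%N -> (D m)%:R <= c * m%:R ^+ d) ->
  (limn_esup (fun m => (ln (D m)%:R / ln m%:R)%:E) <= (d%:R : R)%:E)%E.
Proof.
move=> D0 HD; have c0 : 0 < c.
  have := HD 1%N isT; rewrite expr1n mulr1; apply: lt_le_trans; rewrite ltr0n; exact: D0.
apply: limn_esup_le => e e0; have [N HN] := ln_nat_large (ln c) e0; exists N => m /HN[m1 Hm].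
have lm : 0 < ln m%:R :> R by rewrite ln_gt0 // ltr1n.
rewrite lee_fin ler_pdivrMr // mulrDl.
have mp : (m%:R : R) \is Num.pos by rewrite posrE ltr0n; lia.
apply: (@le_trans _ _ (ln (c * m%:R ^+ d))).
  rewrite ler_ln ?posrE ?ltr0n ?D0 //; first by apply: HD; lia.
  by rewrite mulr_gt0 // exprn_gt0 // -posrE.
rewrite lnM ?posrE ?exprn_gt0 -?posrE // lnXn -?posrE // mulr_natl addrC lerD2l.
exact: Hm.
Qed.

Lemma growth_limsup_ge (D : nat -> nat) (c d : R) : 0 < c ->
  (forall m, (0 < m)%N -> c * m%:R `^ d <= (D m)%:R) ->
  (d%:E <= limn_esup (fun m => (ln (D m)%:R / ln m%:R)%:E))%E.
Proof.
move=> c0 HD; apply: limn_esup_ge => e e0 N.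
have [N' HN'] := ln_nat_large (- ln c) e0.
exists (maxn N N'); first exact: leq_maxl.
have [m1 Hm] := HN' _ (leq_maxr N N'); set m := maxn N N' in m1 Hm *.
have lm : 0 < ln m%:R :> R by rewrite ln_gt0 // ltr1n.
have mp : 0 < m%:R :> R by rewrite ltr0n; lia.
rewrite lee_fin ler_pdivlMr // mulrBl.
apply: (@le_trans _ _ (ln (c * m%:R `^ d))).
  rewrite lnM ?posrE ?powR_gt0 // ln_powR; move: Hm; lra.
have pm : 0 < c * m%:R `^ d by rewrite mulr_gt0 // powR_gt0.
have HDm : c * m%:R `^ d <= (D m)%:R by apply: HD; lia.
by rewrite ler_ln ?posrE // (lt_le_trans pm).
Qed.

(** From exp x >= 1 + x and ln (1 + 1/m) <= 1/m one gets (m/(m+1))^d >= 1 - d/m for real d. The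
    factor 2^d comes from m + 1 <= 2m in the error term. *)
Lemma powR_step (d : R) (m : nat) : 0 < d -> (0 < m)%N ->
  m.+1%:R `^ d <= m%:R `^ d + d * 2 `^ d * m%:R `^ (d - 1).
Proof.
move=> d0 m0; have mp : 0 < m%:R :> R by rewrite ltr0n.
have Mp : 0 < m.+1%:R :> R by rewrite ltr0n.
have bern : m.+1%:R `^ d * (1 - d / m%:R) <= m%:R `^ d.
  have -> : m%:R `^ d = m.+1%:R `^ d * (m%:R / m.+1%:R) `^ d.
    rewrite -powRM ?divr_ge0 ?(ltW mp) ?(ltW Mp) //.
    by rewrite mulrC divfK // gt_eqF.
  rewrite ler_pM2l ?powR_gt0 //.
  have r0 : 0 < m%:R / m.+1%:R :> R by rewrite divr_gt0.
  rewrite -[X in _ <= X]lnK ?posrE ?powR_gt0 // ln_powR.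
  apply: le_trans (expR_ge1Dx _); rewrite lerD2l -mulrN ler_pM2l //.
  have -> : m%:R / m.+1%:R = (1 + m%:R^-1)^-1 :> R.
    by rewrite -natr1; field; rewrite !gt_eqF // natr1.
  have i0 : 0 < m%:R^-1 :> R by rewrite invr_gt0.
  rewrite lnV ?posrE ?addr_gt0 // lerN2; apply: le_ln1Dx.
  by apply: lt_trans i0; rewrite ltrN10.
have up : m.+1%:R `^ d <= 2 `^ d * m%:R `^ d.
  rewrite -powRM ?(ltW mp) //; apply: ge0_ler_powR; rewrite ?nnegrE ?(ltW d0) ?(ltW Mp) //.
  by rewrite -natrM ler_nat; lia.
have -> : m%:R `^ (d - 1) = m%:R `^ d / m%:R.
  by rewrite powRB ?powRr1 ?(ltW mp) // (gt_eqF mp) implybT.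
have e1 : d / m%:R * m.+1%:R `^ d <= d / m%:R * (2 `^ d * m%:R `^ d).
  by rewrite ler_pM2l // divr_gt0.
have -> : d * 2 `^ d * (m%:R `^ d / m%:R) = d / m%:R * (2 `^ d * m%:R `^ d) by ring.
move: bern; rewrite mulrBr mulr1 (mulrC (m.+1%:R `^ d)); lra.
Qed.

(* [D] dominates the sequence [kap m ^ d], whose increments are of order
   [m ^ (d - 1)], provided [kap] is small enough. *)
Lemma growth_of_increments (D : nat -> nat) (c d : R) : 0 < c -> 1 <= d ->
  (0 < D 0)%N ->
  (forall m, (0 < D m)%N -> (D m)%:R + c * (D m)%:R `^ ((d - 1) / d) <= (D m.+1)%:R) ->
  (forall m, (0 < D m)%N) /\
  exists2 kap : R, 0 < kap & forall m, (0 < m)%N -> kap * m%:R `^ d <= (D m)%:R.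
Proof.
move=> c0 d1 D0 HD; have d0 : 0 < d by lra.
have Dpos m : (0 < D m)%N.
  elim: m => // m IH; rewrite -(ltr0n R); apply: lt_le_trans (HD m IH).
  by rewrite ltr_wpDr ?ltr0n // mulr_ge0 ?powR_ge0 // ltW.
split=> //; pose b : R := c / (d * 2 `^ d).
have b0 : 0 < b by rewrite divr_gt0 // mulr_gt0 // powR_gt0.
(* The bound 1 settles the start m = 1. The bound b^d gives d 2^d kap^(1/d) <= c, which is what lets
   c (kap m^d)^((d-1)/d) dominate the increment of kap m^d. *)
pose kap : R := Num.min 1 (b `^ d).
have k0 : 0 < kap by rewrite lt_min ltr01 powR_gt0.
exists kap => //; elim=> // m IH _; have [->|m0] := posnP m.
  rewrite powR1 mulr1; apply: (@le_trans _ _ 1); first by rewrite ge_min lexx.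
  by rewrite ler1n.
have mp : 0 < m%:R :> R by rewrite ltr0n.
apply: le_trans (HD m (Dpos m)); have {}IH := IH m0.
have ex : (kap * m%:R `^ d) `^ ((d - 1) / d) <= (D m)%:R `^ ((d - 1) / d).
  have e0 : 0 <= (d - 1) / d by rewrite divr_ge0 ?(ltW d0) //; lra.
  by apply: (ge0_ler_powR e0); rewrite ?nnegrE ?mulr_ge0 ?powR_ge0 ?(ltW k0).
have key : kap * (d * 2 `^ d * m%:R `^ (d - 1)) <= c * (kap * m%:R `^ d) `^ ((d - 1) / d).
  rewrite powRM ?powR_ge0 ?(ltW k0) // -powRrM.
  have -> : d * ((d - 1) / d) = d - 1 by field; rewrite gt_eqF.
  rewrite [X in X <= _]mulrA [X in _ <= X]mulrA ler_pM2r ?powR_gt0 //.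
  have -> : (d - 1) / d = 1 - d^-1 by field; rewrite gt_eqF.
  rewrite powRB ?(gt_eqF k0) ?implybT // powRr1 ?(ltW k0) //.
  have kd : kap `^ d^-1 <= b.
    have -> : b = (b `^ d) `^ d^-1 by rewrite -powRrM mulfV ?gt_eqF // powRr1 // ltW.
    apply: ge0_ler_powR; rewrite ?nnegrE ?invr_ge0 ?powR_ge0 ?(ltW d0) ?(ltW k0) //.
    by rewrite ge_min lexx orbT.
  have kd0 : 0 < kap `^ d^-1 by rewrite powR_gt0.
  have -> : c * (kap / kap `^ d^-1) = kap * (c / kap `^ d^-1) by ring.
  rewrite ler_pM2l // ler_pdivlMr //.
  have p2 : 0 < d * 2 `^ d by rewrite mulr_gt0 // powR_gt0.
  apply: (@le_trans _ _ (d * 2 `^ d * b)); first by rewrite ler_pM2l.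
  by rewrite /b mulrC divfK // gt_eqF.
have step := powR_step d0 m0.
have : kap * m.+1%:R `^ d <= kap * (m%:R `^ d + d * 2 `^ d * m%:R `^ (d - 1)).
  by rewrite ler_pM2l.
have : c * (kap * m%:R `^ d) `^ ((d - 1) / d) <= c * (D m)%:R `^ ((d - 1) / d).
  by rewrite ler_pM2l.
rewrite mulrDr; move: key IH; lra.
Qed.

End Limsup.

(** * Comparison of LD with GK *)

Section Dimensions.
Variable A : algType C.
Notation R := Rdefinitions.R.

Definition isoperimetric (s : seq A) (c d : R) : Prop := forall t, (0 < dimspan t)%N ->
  (dimspan t)%:R + c * powR (dimspan t)%:R ((d - 1) / d) <= (dimspan (prodspan s t))%:R.

Lemma isoperimetric_GKdim s c d : subframe s -> 0 < c -> 1 <= d ->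
  isoperimetric s c d -> (d%:E <= GKdim A)%E.
Proof.
move=> fs c0 d1 H; pose D m := dimspan (powspan s m).
have [] := @growth_of_increments R D c d c0 d1 (dimspan_pow0 s).
  by move=> m Dm; rewrite {3}/D powspan_comm; apply: H.
move=> _ [kap k0 HD]; apply: (le_trans (growth_limsup_ge k0 HD)).
by apply: ereal_sup_ubound; exists s.
Qed.

Lemma subframe_pow_pos (s : seq A) m : subframe s -> (0 < dimspan (powspan s m))%N.
Proof.
move=> /inspanP s1; have : spanned (powspan s m) 1.
  elim: m => [|m IH]; first by apply: lspan_mem; rewrite mem_head.
  by rewrite -[1]mulr1; apply: spanned_prod.
move=> H1; apply: (@dimspan_ge _ 1 (fun=> 1)) => // c.
rewrite big_ord_recl big_ord0 addr0 => /eqP; rewrite scaler_eq0 oner_eq0 orbF => /eqP c0 i.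
by rewrite ord1.
Qed.

Lemma GKdim_le (d : nat) :
  (forall s : seq A, subframe s -> exists c : R, forall m, (0 < m)%N ->
    (dimspan (powspan s m))%:R <= c * m%:R ^+ d) -> (GKdim A <= (d%:R)%:E)%E.
Proof.
move=> H; apply: ge_ereal_sup => _ [s fs <-]; have [c Hc] := H s fs.
by apply: (growth_limsup_le _ Hc) => m; apply: subframe_pow_pos.
Qed.

Lemma LD_stable_of_bounds (d : nat) : (0 < d)%N ->
  (forall s : seq A, subframe s -> exists c : R, forall m, (0 < m)%N ->
    (dimspan (powspan s m))%:R <= c * m%:R ^+ d) ->
  (exists s c, [/\ subframe s, 0 < c & isoperimetric s c d%:R]) ->
  LD_stable A /\ LDdeg A = (d%:R)%:E.
Proof.
move=> d0 /GKdim_le GK [s [c [fs c0 iso]]].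
have d1 : 1 <= d%:R :> R by rewrite ler1n.
have GKd : GKdim A = (d%:R)%:E.
  by apply/le_anti; rewrite GK /= (isoperimetric_GKdim fs c0 d1 iso).
suff LDd : LDdeg A = (d%:R)%:E by split=> //; rewrite /LD_stable LDd GKd.
(* The clause giving LD the value 0 is excluded: for the frame [s] the inequality is strict on every
   nonzero W. *)
rewrite /LDdeg; case: asboolP => [H|_].
  have [t [t0 Ht]] := H s fs; have := iso t t0; rewrite Ht gerDl leNgt.
  by rewrite mulr_gt0 // powR_gt0 // ltr0n.
apply/le_anti/andP; split.
  apply: ge_ereal_sup => _ [r fr <-]; apply: ge_ereal_sup => _ [e [e0 [b b0 Hb]] <-].
  (* The growth estimate is stated for exponents at least 1; smaller ones are below d because d >=
     1. *)
  have [e1|/ltW e1] := leP e 1; first by rewrite lee_fin (le_trans e1).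
  by rewrite -GKd; apply: (isoperimetric_GKdim fr b0 e1 Hb).
apply: (@le_trans _ _ (ereal_sup [set e%:E | e in [set e : R | 0 < e /\
            exists2 c : R, 0 < c & isoperimetric s c e]])%classic).
  by apply: ereal_sup_ubound; exists d%:R => //; split; [rewrite ltr0n | exists c].
by apply: ereal_sup_ubound; exists s.
Qed.

End Dimensions.

(** * From leading exponents to isoperimetry *)

Section LeadingExponents.
Variables (q : C) (G : zmodType) (om : G -> G -> int).
Hypotheses (q0 : q != 0).
Hypotheses (omDl : forall a b c, om (a + b) c = om a c + om b c).
Hypotheses (omDr : forall a b c, om a (b + c) = om a b + om a c).
Variable pos : G -> bool.
Hypotheses (pos0 : ~~ pos 0) (posD : forall a b, pos a -> pos b -> pos (a + b)).
Hypothesis pos_total : forall a, a != 0 -> pos a || pos (- a).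
Notation lead := (@lead C q G om pos).
Notation supp := (@tsupp C q G om).
Notation tlt := (tlt pos).

Variables (A : algType C) (f : A -> fendo C G).
Hypothesis f_lin : forall (c : C) x y, f (c *: x + y) = c *: f x + f y.
Hypothesis f_mul : forall x y, f (x * y) = f x * f y.

Variables (J : finType) (v : J -> G) (g : J -> A).
Notation vec := {ffun J -> int}.
Definition vexp (a : vec) : G := \sum_p v p *~ a p.
Hypothesis v_free : forall a : vec, vexp a = 0 -> a = 0.
Hypothesis g_lead : forall p, lead (v p) (f (g p)).
Variables (X : vec -> Prop) (mon : vec -> A).
Hypothesis mon_lead : forall a, X a -> lead (vexp a) (f (mon a)).
Hypothesis mon_span : forall x, lspan (fun y => exists2 a, X a & y = mon a) x.

Lemma f_zero : f 0 = 0.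
Proof. by have := f_lin (-1) 0 0; rewrite scaler0 addr0 scaleN1r addNr. Qed.

Lemma f_scale c x : f (c *: x) = c *: f x.
Proof. by rewrite -[c *: x]addr0 f_lin f_zero addr0. Qed.

Lemma f_sub x y c : f (x - c *: y) = f x - c *: f y.
Proof. by rewrite addrC -scaleNr f_lin scaleNr addrC. Qed.

Lemma f_sum (I : Type) (r : seq I) (F : I -> A) : f (\sum_(i <- r) F i) = \sum_(i <- r) f (F i).
Proof.
elim: r => [|i r IH]; first by rewrite !big_nil f_zero.
by rewrite !big_cons -[F i]scale1r f_lin IH !scale1r.
Qed.

Lemma vexpD a b : vexp (a + b) = vexp a + vexp b.
Proof. by rewrite /vexp -big_split; apply: eq_bigr => p _; rewrite ffunE mulrzDr. Qed.

Lemma vexp_inj : injective vexp.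
Proof.
move=> a b ab; apply/eqP; rewrite -subr_eq0; apply/eqP/v_free; rewrite vexpD ab -vexpD subrr.
by rewrite /vexp big1 // => p _; rewrite ffunE mulr0z.
Qed.

Lemma vexp_unit p : vexp (unitv p) = v p.
Proof.
rewrite /vexp (bigD1 p) //= ffunE eqxx mulr1z big1 ?addr0 // => r rp.
by rewrite ffunE (negbTE rp) mulr0z.
Qed.

Lemma mon_combination x : exists (r : seq vec) (c : vec -> C),
  [/\ uniq r, forall a, a \in r -> X a & x = \sum_(a <- r) c a *: mon a].
Proof.
elim: (mon_span x) => [|d _ y [a Xa ->] _ [r [c [ur Xr ->]]]].
  by exists [::], (fun=> 0); rewrite big_nil.
have [ar|ar] := boolP (a \in r).
  exists r, (fun b => (if b == a then d else 0) + c b); split=> //.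
  under [RHS]eq_bigr do rewrite scalerDl.
  rewrite big_split /=; congr (_ + _); rewrite (bigD1_seq a) //= eqxx big1 ?addr0 // => b /negbTE ->.
  exact: scale0r.
exists (a :: r), (fun b => if b == a then d else c b); split=> /=; first by rewrite ar.
  by move=> b; rewrite inE => /orP[/eqP->|/Xr].
rewrite big_cons eqxx; congr (_ + _); rewrite !big_seq; apply: eq_bigr => b br.
by rewrite (_ : b == a = false) //; apply: contraNF ar => /eqP <-.
Qed.

(** A nonzero combination of the monomials [mon] inherits one of their leading exponents. In
    particular [f] is injective, and leading exponents never leave the lattice spanned by [v]. *)
Lemma elt_lead x : x != 0 -> exists a, lead (vexp a) (f x).
Proof.
have [r [c [ur Xr ->]]] := mon_combination x => x0.
have [||c0|[a _]] := @lead_sum _ q _ om _ posD pos_total _ r vexp (f \o mon) c ur.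
- by move=> a b _ _; apply: vexp_inj.
- by move=> a /Xr /mon_lead.
- by case/eqP: x0; rewrite big_seq big1 // => a /c0 ->; rewrite scale0r.
move=> H; exists a; rewrite f_sum; under eq_bigr do rewrite f_scale.
exact: H.
Qed.

Lemma exists_maximal w (a : 'I_w.+1 -> G) : exists m, forall i, ~~ tlt (a m) (a i).
Proof.
suff [m Hm] : exists m, forall i, i \in enum 'I_w.+1 -> ~~ tlt (a m) (a i).
  by exists m => i; apply: Hm; rewrite mem_enum.
elim: (enum _) => [|j s [m Hm]]; first by exists ord0.
have [mj|mj] := boolP (tlt (a m) (a j)); last first.
  by exists m => i; rewrite inE => /orP[/eqP->|/Hm].
exists j => i; rewrite inE => /orP[/eqP->|/Hm]; first exact: tlt_irr.
by apply: contra => /(tlt_trans posD mj).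
Qed.

(** Gaussian elimination by leading exponents: a vector with the largest one is kept, and multiples
    of it are subtracted to push all the others strictly below. *)
Lemma echelon w (u : 'I_w -> A) : free_fam u -> exists (T : seq vec) (y : vec -> A),
  [/\ uniq T, size T = w & forall a, a \in T ->
     lspan (fun x => exists i, x = u i) (y a) /\ lead (vexp a) (f (y a))].
Proof.
elim: w u => [|w IH] u fu; first by exists [::], (fun=> 0).
have u0 i : u i != 0.
  apply/eqP => ui; have := fu (fun j => (j == i)%:R); rewrite (bigD1 i) //= eqxx scale1r ui.
  rewrite big1 ?addr0 => [/(_ erefl i)/eqP|j /negbTE ->]; last exact: scale0r.
  by rewrite eqxx oner_eq0.
have [al Hal] := boolp.choice (fun i => elt_lead (u0 i)).
have [m Hm] := exists_maximal (vexp \o al).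
have H j : exists c : C, supp (tlt^~ (vexp (al m))) (f (u (lift m j) - c *: u m)).
  have [e|ne] := eqVneq (al (lift m j)) (al m).
    have [|c Hc] := lead_cancel (u := f (u (lift m j))) _ (Hal m); first by rewrite -e.
    by exists c; rewrite f_sub.
  exists 0; rewrite scale0r subr0; apply: (lead_supp posD (Hal _)).
  have : vexp (al (lift m j)) != vexp (al m) by rewrite (inj_eq vexp_inj).
  by move=> /(tlt_total pos_total); rewrite (negbTE (Hm _)) orbF.
have [c Hc] := boolp.choice H.
pose u' j := u (lift m j) - c j *: u m.
have fu' : free_fam u'.
  move=> d Hd j; pose e i := if unlift m i is Some j then d j else - \sum_j d j * c j.
  have := fu e _ (lift m j); rewrite /e liftK; apply.
  rewrite (bigD1_ord m) //= unlift_none.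
  transitivity (- (\sum_j d j * c j) *: u m + \sum_j d j *: u (lift m j)).
    by congr (_ + _); apply: eq_bigr => i _; rewrite liftK.
  rewrite -[RHS]Hd /u'; under [RHS]eq_bigr do rewrite scalerBr scalerA.
  by rewrite sumrB scaleNr addrC scaler_suml.
have [T [y [uT sT HT]]] := IH u' fu'.
have low a : a \in T -> tlt (vexp a) (vexp (al m)).
  move=> /HT[ya la]; apply: (lead_supp_lt omDr pos0 la).
  by apply: (lspan_map f_lin _ ya) => _ [j ->]; apply: Hc.
have mT : al m \notin T.
  by apply/negP => /low; rewrite (negbTE (tlt_irr pos0 _)).
exists (al m :: T), (fun a => if a == al m then u m else y a); split=> /=.
- by rewrite mT.
- by rewrite sT.
move=> a; rewrite inE; case: eqP => [-> _|_ /= /HT[ya la]].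
  by split=> //; apply: lspan_mem; exists m.
split=> //; apply: (lspan_map (f := id) _ _ ya) => // _ [j ->].
rewrite /u'; apply: lspanB; first by apply: lspan_mem; exists (lift m j).
by apply/lspanZ/lspan_mem; exists m.
Qed.

Lemma leads_dimspan (L : seq vec) (z : vec -> A) (s : seq A) : uniq L ->
  (forall a, a \in L -> spanned s (z a) /\ lead (vexp a) (f (z a))) ->
  (size L <= dimspan s)%N.
Proof.
move=> uL H; pose fam (i : 'I_(size L)) := z (nth 0 L i).
have mL (i : 'I_(size L)) : nth 0 L i \in L by apply: mem_nth.
apply: (@dimspan_ge _ _ fam) => [c Hc i|i]; last by case: (H _ (mL i)).
have [||c0|[j _]] := @lead_sum _ q _ om _ posD pos_total _
    (enum 'I_(size L)) (fun i => vexp (nth 0 L i)) (f \o fam) c (enum_uniq _).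
- move=> j l _ _ /vexp_inj /eqP; rewrite nth_uniq // => /eqP; exact: val_inj.
- by move=> j _; case: (H _ (mL j)).
- by apply: c0; rewrite mem_enum.
have -> : \sum_(i' <- enum 'I_(size L)) c i' *: (f \o fam) i' = f (\sum_i' c i' *: fam i').
  by rewrite f_sum big_enum; apply: eq_bigr => i' _; rewrite f_scale.
by rewrite Hc f_zero => /(lead_neq0 omDr pos0).
Qed.

(** Each direction p gives D - w >= [boundary p T]. Summed over the d directions, isoperimetry with
    lam = 2 w^(1/d) yields w <= 2 w^(1/d) d (D - w), whence the constant 1/(2d). *)
Lemma isoperimetric_of_leads (s : seq A) : (0 < #|J|)%N -> spanned s 1 ->
  (forall p, spanned s (g p)) ->
  isoperimetric s (2 * #|J|%:R)^-1 #|J|%:R.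
Proof.
move=> J0 s1 sg t t0; set w := dimspan t in t0 *; set D := dimspan (prodspan s t).
have [u [fu su]] := dimspan_basis t.
have [T [y [uT sT HT]]] := echelon fu.
have yt a : a \in T -> spanned t (y a).
  by move=> /HT[ya _]; apply: (lspan_map (f := id) _ _ ya) => // _ [i ->]; apply: su.
have bd p : (w + boundary p T <= D)%N.
  (* The exponents of [T] are realised in the product by 1 times [y a], the new ones by [g p] times
     [y a] for [a] in [L]; together they are pairwise distinct. *)
  pose L : seq vec := [seq a <- T | (a : vec) + unitv p \notin T].
  have -> : (w + boundary p T = size (T ++ [seq ((a : vec) + unitv p)%R | a <- L]))%N.
    by rewrite size_cat sT size_map size_filter.
  apply: (@leads_dimspan _ (fun a : vec => if a \in T then y a else g p * y (a - unitv p))).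
    rewrite cat_uniq uT (map_inj_uniq (addIr _)) filter_uniq ?andbT //=.
    apply/hasPn => b /mapP[a]; rewrite mem_filter => /andP[aT _] ->; exact: aT.
  move=> b; rewrite mem_cat => /orP[bT|/mapP[a]].
    rewrite bT; case: (HT b bT) => _ lb; split=> //.
    by rewrite -[y b]mul1r; apply: spanned_prod => //; apply: yt.
  rewrite mem_filter => /andP[naT aT] ->; rewrite (negbTE naT) addrK; split.
    by apply: spanned_prod => //; apply: yt.
  rewrite f_mul addrC vexpD vexp_unit; apply: (leadM q0 omDl omDr posD) => //.
  by case: (HT a aT).
pose d := #|J|; have d0 : 0 < d%:R :> Rdefinitions.R by rewrite ltr0n.
have w0 : 0 < w%:R :> Rdefinitions.R by rewrite ltr0n.
pose mu : Rdefinitions.R := powR w%:R (d%:R^-1).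
have mu0 : 0 < mu by rewrite powR_gt0.
have mud : mu ^+ d = w%:R.
  by rewrite -powR_mulrn ?(ltW mu0) // -powRrM mulVf ?gt_eqF // powRr1 // ltW.
(* The factor 2 makes the hypothesis w < lam^d of [isoperimetry] strict, since mu^d = w. *)
have iso : w%:R <= 2 * mu * \sum_(p <- enum J) (boundary p T)%:R.
  rewrite -{1}(sT : size T = w); apply: isoperimetry => //; rewrite ?enum_uniq ?mulr_gt0 //.
    by move=> a b _ _ p; rewrite mem_enum.
  rewrite -cardE -/d sT exprMn mud ltr_pMl // exprn_egt1 ?ltr1n //.
  by rewrite -lt0n.
have sumle : \sum_(p <- enum J) (boundary p T)%:R <= d%:R * (D%:R - w%:R) :> Rdefinitions.R.
  rewrite big_enum /=; apply: (@le_trans _ _ (\sum_(p in J) (D%:R - w%:R))).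
    by apply: ler_sum => p _; rewrite lerBrDl -natrD ler_nat; apply: bd.
  by rewrite sumr_const mulr_natl.
have -> : (d%:R - 1) / d%:R = 1 - d%:R^-1 :> Rdefinitions.R by field; rewrite gt_eqF.
rewrite powRB ?(gt_eqF w0) ?implybT // powRr1 ?(ltW w0) // -/mu.
rewrite addrC -lerBrDr.
have -> : (2 * d%:R)^-1 * (w%:R / mu) = w%:R / (2 * mu * d%:R) :> Rdefinitions.R.
  by field; rewrite !gt_eqF.
rewrite ler_pdivrMr ?mulr_gt0 //; apply: (le_trans iso).
apply: (@le_trans _ _ (2 * mu * (d%:R * (D%:R - w%:R)))).
  by rewrite ler_pM2l ?mulr_gt0.
by rewrite le_eqVlt; apply/orP; left; apply/eqP; ring.
Qed.

End LeadingExponents.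

(** * Generation *)

Section GeneratedSubalgebra.
Variables (k : fieldType) (A : algType k) (gen : A -> Prop).

Definition gen_word (x : A) : Prop :=
  exists2 gs : seq A, (forall g, g \in gs -> gen g) & x = \prod_(g <- gs) g.

Definition generated : pred A := fun x => `[< lspan gen_word x >].

Fact generated_closed : GRing.subsemialg_closed generated.
Proof.
split; [|split| |].
- by apply/asboolP/lspan_mem; exists [::]; rewrite ?big_nil.
- by apply/asboolP/lspan_zero.
- by move=> x y /asboolP Hx /asboolP Hy; apply/asboolP/lspanD.
- by move=> c x /asboolP Hx; apply/asboolP/lspanZ.
- move=> x y /asboolP Hx /asboolP Hy; apply/asboolP.
  apply: lspan_mulr Hx => _ [gs Hgs ->]; apply: lspan_mull Hy => _ [hs Hhs ->].
  apply: lspan_mem; exists (gs ++ hs); last by rewrite big_cat.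
  by move=> g; rewrite mem_cat => /orP[/Hgs|/Hhs].
Qed.

Lemma generated_gen x : gen x -> generated x.
Proof.
move=> gx; apply/asboolP/lspan_mem; exists [:: x]; last by rewrite big_seq1.
by move=> g; rewrite inE => /eqP ->.
Qed.

Definition gensub := {x : A | generated x}.
HB.instance Definition _ := SubChoice.on gensub.
HB.instance Definition _ :=
  GRing.SubChoice_isSubAlgebra.Build k A generated gensub generated_closed.

End GeneratedSubalgebra.

Section Generation.
Variables (N : nat) (q : C) (A : algType C) (E F K Ki : 'I_N.-1 -> A).
Hypothesis Uq : is_Uq_sl q E F K Ki.

Definition Uq_gen (x : A) : Prop :=
  exists i, [\/ x = E i, x = F i, x = K i | x = Ki i].

(* By the universal property, composing [A -> gensub] with the inclusion gives the identity. *)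
Lemma Uq_generated x : lspan (gen_word Uq_gen) x.
Proof.
have [rel univ] := Uq.
pose B : algType C := gensub Uq_gen.
have iv (z : B) := valP z.
have gE i : generated Uq_gen (E i) by apply: generated_gen; exists i; apply: Or41.
have gF i : generated Uq_gen (F i) by apply: generated_gen; exists i; apply: Or42.
have gK i : generated Uq_gen (K i) by apply: generated_gen; exists i; apply: Or43.
have gKi i : generated Uq_gen (Ki i) by apply: generated_gen; exists i; apply: Or44.
pose E' i : B := Sub (E i) (gE i); pose F' i : B := Sub (F i) (gF i).
pose K' i : B := Sub (K i) (gK i); pose Ki' i : B := Sub (Ki i) (gKi i).
have inj : injective (val : B -> A) by apply: val_inj.
have vM (u v : B) : val (u * v) = val u * val v by rewrite rmorphM.
have vD (u v : B) : val (u + v) = val u + val v by rewrite raddfD.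
have vB (u v : B) : val (u - v) = val u - val v by rewrite raddfB.
have vZ (c : C) (u : B) : val (c *: u) = c *: val u by rewrite linearZ.
have v1 : val (1 : B) = 1 by rewrite rmorph1.
have v0 : val (0 : B) = 0 by rewrite raddf0.
have rel' : Uq_relations q E' F' K' Ki'.
  have [[r1 r2] r3 r4 r5 r6] := rel.
  split.
  - split=> [i|i j]; last by apply: inj; rewrite !vM /= r2.
    by split; apply: inj; rewrite vM v1 /=; case: (r1 i).
  - by move=> i j; apply: inj; rewrite !vM vZ /= r3.
  - by move=> i j; apply: inj; rewrite !vM vZ /= r4.
  - by move=> i j; apply: inj; rewrite vB !vM /= r5; case: eqP => _; rewrite ?vZ ?vB ?v0.
  move=> i j; have [r6a r6b] := r6 i j; split.
    by move=> /r6a [h1 h2]; split; apply: inj; rewrite vD vB vZ !vM v0.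
  by move=> /r6b [h1 h2]; split; apply: inj; rewrite !vM.
have [f [flin fM f1 fg _]] := univ B E' F' K' Ki' rel'.
have [h [_ _ _ _ huniq]] := univ A E F K Ki rel.
have e1 : x = h x by apply: (huniq id).
have e2 : val (f x) = h x.
  apply: (huniq (fun y => val (f y))).
  - by move=> a u v; rewrite flin vD vZ.
  - by move=> u v; rewrite fM vM.
  - by rewrite f1 v1.
  - by move=> i; case: (fg i) => -> -> -> ->.
rewrite e1 -e2.
exact/asboolP/iv.
Qed.

End Generation.

(** * The enveloping algebra *)

Section RootIndices.
Variable n' : nat.
Notation n := n'.+1.

(* [(l, j)] stands for the positive root [alpha_l + ... + alpha_(l+j)]. *)
Definition rootidx := {x in [pred x : 'I_n * 'I_n | val x.1 + val x.2 < n]%N}.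
Definition pbwidx := (rootidx + 'I_n + rootidx)%type.

Definition rowi (x : rootidx) : nat := val (val x).1.
Definition coli (x : rootidx) : nat := val (val x).2.

Definition rootidx0 : rootidx.
Proof. by exists (ord0, ord0); rewrite inE. Defined.

(** Pairs that are not roots may be sent to a wrong index; ordered monomials only read exponents
    with l + j < n. *)
Definition mkroot (l j : nat) : rootidx := insubd rootidx0 (inord l, inord j).

Lemma rootidxP (x : rootidx) : (rowi x + coli x < n)%N.
Proof. exact: (valP x). Qed.

Lemma mkrootK (x : rootidx) : mkroot (rowi x) (coli x) = x.
Proof. by rewrite /rowi /coli /mkroot !inord_val -surjective_pairing valKd. Qed.

Lemma mkroot_val l j : (l + j < n)%N ->
  rowi (mkroot l j) = l /\ coli (mkroot l j) = j.
Proof.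
by move=> lj; rewrite /rowi /coli /mkroot insubdK ?inE /= !inordK //; lia.
Qed.

Lemma sum_rootidx (V : nmodType) (F : nat -> nat -> V) :
  \sum_(x : rootidx) F (rowi x) (coli x) = \sum_(l < n) \sum_(j < n - l) F l j.
Proof.
rewrite -(big_sub _ (fun x : 'I_n * 'I_n => F (val x.1) (val x.2))) /=.
rewrite -(pair_big_dep xpredT (fun l j : 'I_n => val l + val j < n)%N (fun l j => F (val l) (val j))) /=.
apply: eq_bigr => l _; have ln : (n - l <= n)%N by rewrite leq_subr.
transitivity (\sum_(j < n | (j < n - l)%N) F l j); first by apply: eq_bigl => j; rewrite ltn_subRL.
by rewrite (big_ord_narrow ln).
Qed.

(** Two triangles of n(n+1)/2 roots and n torus directions: n(n+1) + n = (n+1)^2 - 1. *)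
Lemma card_pbwidx : #|pbwidx : finType| = (n'.+2 ^ 2 - 1)%N.
Proof.
have c : #|rootidx : finType| = (\sum_(l < n) (n - l))%N.
  rewrite -sum1_card (sum_rootidx (fun _ _ => 1%N : nat)).
  by apply: eq_bigr => l _; rewrite sum1_card card_ord.
have s r : ((\sum_(l < r) (r - l)) * 2 = r * r.+1)%N.
  elim: r => [|r IH]; first by rewrite big_ord0.
  rewrite big_ord_recl /= subn0; under eq_bigr do rewrite /bump /= subSS.
  by rewrite mulnDl IH; lia.
rewrite !card_sum card_ord c; have := s n; nia.
Qed.

End RootIndices.

Arguments rowi {n'} x : simpl never.
Arguments coli {n'} x : simpl never.

Section UqRelationsConversion.
Variables (n' : nat) (q : C).
Notation n := n'.+1.

Lemma cartanE (i j : 'I_n) : cartan i j = cartann i j.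
Proof. by []. Qed.

Definition natfam (T : Type) (x : 'I_n -> T) (i : nat) : T := x (inord i).

Lemma Uq_relations_uqrel (A : algType C) (E F K Ki : 'I_n -> A) :
  Uq_relations q E F K Ki -> uqrel q n (natfam E) (natfam F) (natfam K) (natfam Ki).
Proof.
move=> [[r1 r2] r3 r4 r5 r6].
have cE i j : (i < n)%N -> (j < n)%N -> cartan (inord i : 'I_n) (inord j) = cartann i j.
  by move=> il jl; rewrite cartanE !inordK.
have adj i : (i.+1 < n)%N -> cartann i i.+1 = -1 by move=> il; rewrite cartann_adj ?eqxx.
have adj' i : (i.+1 < n)%N -> cartann i.+1 i = -1 by move=> il; rewrite cartann_adj ?eqxx ?orbT.
have conv (x y : A) : x ^+ 2 * y - (q + q^-1) *: (x * y * x) + y * x ^+ 2 = 0 -> serre q x y.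
  by rewrite /serre !expr2 (mulrA y).
split=> [i il|i il|i j il jl|i j il jl|i j il jl|i j il jl||].
- by case: (r1 (inord i)).
- by case: (r1 (inord i)).
- exact: r2.
- by rewrite -cE // scalerAl -r3 -!mulrA; case: (r1 (inord i)) => _ ->; rewrite mulr1.
- by rewrite -cE // scalerAl -r4 -!mulrA; case: (r1 (inord i)) => _ ->; rewrite mulr1.
- by rewrite r5 -val_eqE /= !inordK.
- split=> [i j il jl ij|i il|i il].
  + by case: (r6 (inord i) (inord j)) => _ []; rewrite ?cE ?cartann_far.
  + by apply: conv; case: (r6 (inord i) (inord i.+1)) => [] []; rewrite ?cE ?adj // ltnW.
  + by apply: conv; case: (r6 (inord i.+1) (inord i)) => [] []; rewrite ?cE ?adj' // ltnW.
- split=> [i j il jl ij|i il|i il].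
  + by case: (r6 (inord i) (inord j)) => _ []; rewrite ?cE ?cartann_far.
  + by apply: conv; case: (r6 (inord i) (inord i.+1)) => [] []; rewrite ?cE ?adj // ltnW.
  + by apply: conv; case: (r6 (inord i.+1) (inord i)) => [] []; rewrite ?cE ?adj' // ltnW.
Qed.

Lemma uqrel_Uq_relations (A : algType C) (E F K Ki : nat -> A) :
  uqrel q n E F K Ki ->
  Uq_relations q (fun i : 'I_n => E i) (fun i : 'I_n => F i)
    (fun i : 'I_n => K i) (fun i : 'I_n => Ki i).
Proof.
move=> rel; have [farE upE dnE] := uq_E rel; have [farF upF dnF] := uq_F rel.
have conv (x y : A) : serre q x y -> x ^+ 2 * y - (q + q^-1) *: (x * y * x) + y * x ^+ 2 = 0.
  by rewrite /serre !expr2 (mulrA y).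
split.
- split=> [i|i j]; last exact: (uq_KK rel).
  by rewrite (uq_KKi rel) ?(uq_KiK rel).
- by move=> i j; rewrite (uq_KE rel) // -scalerAl -mulrA (uq_KKi rel) // mulr1.
- by move=> i j; rewrite (uq_KF rel) // -scalerAl -mulrA (uq_KKi rel) // mulr1.
- by move=> i j; rewrite (uq_EF rel).
move=> i j; rewrite cartanE /cartann; split; case: eqP => // ij; case: orP => // h _.
  have {h} [h|h] : j = i.+1 :> nat \/ i = j.+1 :> nat by case: h => /eqP ->; [left | right].
    have ji := ltn_ord j; rewrite h in ji *.
    by split; apply: conv; [apply: upE | apply: upF].
  have ji := ltn_ord i; rewrite h in ji *.
  by split; apply: conv; [apply: dnE | apply: dnF].
have [lt|lt] : (i.+1 < j)%N \/ (j.+1 < i)%N.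
  case: (ltngtP i.+1 j) => h1; [by left | | by case: h; left; apply/eqP].
  right; rewrite ltn_neqAle; apply/andP; split.
    by apply/negP => /eqP e; case: h; right; apply/eqP.
  by rewrite ltn_neqAle -ltnS h1 andbT; apply/eqP => e; apply: ij.
  by split; [apply: farE | apply: farF].
by split; symmetry; [apply: farE | apply: farF].
Qed.

End UqRelationsConversion.

Lemma eq_umon_in (k : fieldType) (A : algType k) (t : k) (E : nat -> A) b b' l r :
  (forall i j, (l <= i)%N -> (i + j < l + r)%N -> b i j = b' i j) ->
  umon t E b l r = umon t E b' l r.
Proof.
elim: r l => //= r IH l H; congr (_ * _).
  by apply: eq_bigr => j _; rewrite H //; have := ltn_ord j; lia.
by apply: IH => i j li ij; apply: H; lia.
Qed.

(** * PBW data of the enveloping algebra and the two bounds *)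

Section Main.
Variables (n' : nat) (q : C) (A : algType C).
Notation n := n'.+1.
Variables (E F K Ki : 'I_n -> A).
Hypotheses (q0 : q != 0) (q_root : forall k : nat, (0 < k)%N -> q ^+ k != 1).
Hypothesis Uq : is_Uq_sl (N := n'.+2) q E F K Ki.

Let qq : q - q^-1 != 0.
Proof.
apply: contraNneq (q_root (isT : (0 < 2)%N)) => /eqP; rewrite subr_eq0 => /eqP e.
by rewrite expr2 {2}e mulfV.
Qed.

Let q2 : q + q^-1 != 0.
Proof.
apply: contraNneq (q_root (isT : (0 < 4)%N)) => /eqP; rewrite addr_eq0 => /eqP e.
have q2e : q ^+ 2 = -1 by rewrite expr2 {2}e mulrN mulfV.
by rewrite (exprM q 2 2) q2e sqrrN expr1n.
Qed.

(** Copies are indexed by ['I_m.+1], so there are 2n of them, n for the E_i and n for the F_i. *)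
Let m := (2 * n').+1.
Let Hm : m.+1 = (2 * n)%N. Proof. by rewrite /m; lia. Qed.

Notation En := (natfam E).
Notation Fn := (natfam F).
Notation Kn := (natfam K).
Notation Kin := (natfam Ki).
Notation G := (expo n m).
Notation om := (@om n m).
Notation B := (fendo C G).
Notation pos := (@tpos n m).
Notation lead := (@lead C q G om pos).
Let omDl := @omDl n m.
Let omDr := @omDr n m.
Let posD := @tposD n m.

Let rel : uqrel q n En Fn Kn Kin.
Proof. by case: Uq => /Uq_relations_uqrel. Qed.

Lemma torus_morphism : exists f : A -> B,
  [/\ forall (c : C) x y, f (c *: x + y) = c *: f x + f y,
      forall x y, f (x * y) = f x * f y, f 1 = 1
    & forall i, (i < n)%N -> [/\ f (En i) = repE q n m m.+1 i, f (Fn i) = repF q n m m.+1 i,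
        f (Kn i) = repK q n m m.+1 i & f (Kin i) = repKi q n m m.+1 i]].
Proof.
have [_ univ] := Uq.
have [f [f1 f2 f3 f4 _]] := univ _ _ _ _ _ (uqrel_Uq_relations (rep_rel n q0 qq (leqnn m.+1))).
exists f; split=> // i il; have := f4 (inord i); rewrite inordK //.
Qed.

Definition pbw_exp (p : pbwidx n') : G :=
  match p with
  | inl (inl x) => rootE_exp n m (rowi x) (coli x)
  | inl (inr i) => Kexp n m m.+1 (val i)
  | inr x => rootF_exp n m (rowi x) (coli x)
  end.

Definition pbw_gen (p : pbwidx n') : A :=
  match p with
  | inl (inl x) => qroot q En (rowi x) (coli x)
  | inl (inr i) => Kn (val i)
  | inr x => qroot q^-1 Fn (rowi x) (coli x)
  end.

Notation vec := {ffun pbwidx n' -> int}.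

Definition pbw_valid (a : vec) : Prop :=
  (forall x, 0 <= a (inl (inl x))) /\ (forall x, 0 <= a (inr x)).

(** The absolute values make this total on integer vectors; its leading exponent is [vexp pbw_exp a]
    when [a] is valid. *)
Definition pbw_mon (a : vec) : A :=
  pbwmon q n En Fn Kn Kin (fun l j => `|a (inr (mkroot n' l j))|%N)
    (fun i => a (inl (inr (inord i)))) (fun l j => `|a (inl (inl (mkroot n' l j)))|%N).

Lemma sum_pbwidx (V : nmodType) (f : pbwidx n' -> V) :
  \sum_p f p = \sum_x f (inl (inl x)) + \sum_i f (inl (inr i)) + \sum_x f (inr x).
Proof. by rewrite big_sumType /= big_sumType. Qed.

(** The x-exponents see only root vectors and determine their coefficients copy by copy; the
    coefficients of the K_i are then read from the T-exponents. *)
Lemma pbw_exp_free (a : vec) : vexp pbw_exp a = 0 -> a = 0.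
Proof.
rewrite /vexp => H.
have coM c p b (y : G) (z : int) : co c p b (y *~ z) = co c p b y * z.
  by rewrite /co ffunMzE mulrzz.
have {}H c p b : \sum_(r : pbwidx n') co c p b (pbw_exp r) * a r = 0.
  have := congr1 (co c p b) H; rewrite co_sum => e.
  transitivity (co c p b (0 : G)); last by rewrite /co ffunE.
  by rewrite -e; apply: eq_bigr => r _; rewrite coM.
have aE x0 : a (inl (inl x0)) = 0.
  have lt0 := rootidxP x0; set l0 := rowi x0 in lt0 *; set j0 := coli x0 in lt0 *.
  (* This copy carries only the positive roots with last letter l0 + j0. Their x-exponents are +1 at
     the first letter and -1 at l0 + j0 + 1, so position l0 isolates the root [x0]. *)
  have := H (n - (l0 + j0).+1)%N l0 false; rewrite sum_pbwidx.
  rewrite [X in _ + X + _]big1 => [|i _]; last by rewrite /= co_Kexp_false mul0r.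
  rewrite [X in _ + _ + X]big1 => [|x _]; last first.
    have ltx := rootidxP x; by rewrite /= (co_rexpF Hm); lia.
  rewrite !addr0 (bigD1 x0) //= (co_rexpE Hm); try lia.
  rewrite !eqxx mul1r (_ : (l0 == (l0 + j0.+1)%N) = false) ?subr0 ?mul1r; last by apply/negbTE/eqP; lia.
  rewrite big1 ?addr0 // => x xx0; have ltx := rootidxP x; rewrite (co_rexpE Hm); try lia.
  set l := rowi x in ltx *; set j := coli x in ltx *.
  suff -> : (n - (l0 + j0).+1 == n - (l + j).+1)%N%:Z * ((l0 == l)%:Z - (l0 == (l + j.+1)%N)%:Z) = 0.
    by rewrite mul0r.
  case: eqP => [e|_]; last by rewrite mul0r.
  rewrite (_ : (l0 == (l + j.+1)%N) = false); last by apply/negbTE/eqP; lia.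
  case: eqP => [el|_]; last by rewrite subrr mulr0.
  case/eqP: xx0; rewrite -(mkrootK x) -(mkrootK x0) -/l -/l0 -/j -/j0 el.
  by congr mkroot; lia.
have aF x0 : a (inr x0) = 0.
  have lt0 := rootidxP x0; set l0 := rowi x0 in lt0 *; set j0 := coli x0 in lt0 *.
  have := H (n + (n - (l0 + j0).+1))%N l0 false; rewrite sum_pbwidx.
  rewrite [X in X + _ + _]big1 => [|x _]; last by rewrite aE mulr0.
  rewrite [X in _ + X + _]big1 => [|i _]; last by rewrite /= co_Kexp_false mul0r.
  rewrite !add0r (bigD1 x0) //= (co_rexpF Hm); try lia.
  rewrite !eqxx mul1r (_ : (l0 == (l0 + j0.+1)%N) = false) ?sub0r; last by apply/negbTE/eqP; lia.
  rewrite big1 ?addr0 ?mulN1r => [/eqP|x xx0]; first by rewrite oppr_eq0 => /eqP.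
  have ltx := rootidxP x; rewrite (co_rexpF Hm); try lia.
  set l := rowi x in ltx *; set j := coli x in ltx *.
  suff -> : (n + (n - (l0 + j0).+1) == n + (n - (l + j).+1))%N%:Z * ((l0 == (l + j.+1)%N)%:Z - (l0 == l)%:Z) = 0.
    by rewrite mul0r.
  case: eqP => [e|_]; last by rewrite mul0r.
  rewrite (_ : (l0 == (l + j.+1)%N) = false); last by apply/negbTE/eqP; lia.
  case: eqP => [el|_]; last by rewrite subrr mulr0.
  case/eqP: xx0; rewrite -(mkrootK x) -(mkrootK x0) -/l -/l0 -/j -/j0 el.
  by congr mkroot; lia.
(* In copy 0 the exponent of K_i is +1 at T_i and -1 at T_(i+1), a triangular system solved by
   induction on the position. *)
have aK i : (i < n)%N -> a (inl (inr (inord i))) = 0.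
  elim: i => [|i IH] il; have := H 0%N _ true; rewrite ?sum_pbwidx.
    move=> /(_ 0%N); rewrite sum_pbwidx.
    rewrite [X in X + _ + _]big1 => [|x _]; last by rewrite aE mulr0.
    rewrite [X in _ + _ + X]big1 => [|x _]; last by rewrite aF mulr0.
    rewrite add0r addr0 (bigD1 (inord 0)) //= inordK // co_Kexp_true //.
    rewrite (_ : (0 < m.+1)%N%:Z * ((0%N == 0%N)%:Z - (0%N == 1%N)%:Z) = 1) // mul1r.
    rewrite big1 ?addr0 // => j j0.
    rewrite co_Kexp_true // mul1r subr0 (_ : (0%N == j) = false) ?mul0r //.
    by apply: contraNF j0 => /eqP e; rewrite -val_eqE /= inordK // -e.
  move=> /(_ i.+1); rewrite sum_pbwidx.
  rewrite [X in X + _ + _]big1 => [|x _]; last by rewrite aE mulr0.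
  rewrite [X in _ + _ + X]big1 => [|x _]; last by rewrite aF mulr0.
  rewrite add0r addr0 (bigD1 (inord i.+1)) //= inordK // co_Kexp_true //; last exact: ltnW.
  rewrite eqxx mul1r (_ : (i.+1 == i.+2) = false) ?subr0 ?mul1r; last by rewrite ltn_eqF.
  rewrite big1 ?addr0 // => j j0.
  have [ej|nej] := eqVneq (val j) i.
    by rewrite -[j]inord_val ej IH ?mulr0 // ltnW.
  rewrite co_Kexp_true //; last exact: ltnW.
  rewrite mul1r eqSS (_ : (i.+1 == j) = false) ?sub0r; last first.
    by apply: contraNF j0 => /eqP e; rewrite -val_eqE /= inordK // -e.
  by rewrite eq_sym (negbTE nej) oppr0 mul0r.
apply/ffunP => -[[x|i]|x]; rewrite ffunE ?aE ?aF //.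
by rewrite -(inord_val i) aK.
Qed.

Section WithMorphism.
Variable f : A -> B.
Hypothesis f_lin : forall (c : C) x y, f (c *: x + y) = c *: f x + f y.
Hypothesis f_mul : forall x y, f (x * y) = f x * f y.
Hypothesis f_one : f 1 = 1.
Hypothesis f_gen : forall i, (i < n)%N ->
  [/\ f (En i) = repE q n m m.+1 i, f (Fn i) = repF q n m m.+1 i,
      f (Kn i) = repK q n m m.+1 i & f (Kin i) = repKi q n m m.+1 i].

Let f_exp x r : f (x ^+ r) = f x ^+ r.
Proof. by elim: r => [|r IH]; rewrite ?expr0 // !exprS f_mul IH. Qed.

Let f_prod (I : Type) (r : seq I) (g : I -> A) : f (\prod_(i <- r) g i) = \prod_(i <- r) f (g i).
Proof. by elim: r => [|i r IH]; rewrite ?big_nil // !big_cons f_mul IH. Qed.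

Lemma f_qroot t (X : nat -> A) (Y : nat -> B) l j : (forall i, (i < n)%N -> f (X i) = Y i) ->
  (l + j < n)%N -> f (qroot t X l j) = qroot t Y l j.
Proof.
move=> XY; elim: j => [|j IH] lj; first by rewrite /= XY //; lia.
rewrite /= /qcomm (f_sub f_lin) !f_mul XY // IH //; lia.
Qed.

Lemma pbw_gen_lead p : lead (pbw_exp p) (f (pbw_gen p)).
Proof.
case: p => [[x|i]|x] /=.
- rewrite (@f_qroot _ _ (repE q n m m.+1)) ?rootidxP // => [|i /f_gen[]//].
  exact: (lead_rootE q0 qq Hm (rootidxP x)).
- have [_ _ -> _] := f_gen (ltn_ord i); exact: lead_mon.
- rewrite (@f_qroot _ _ (repF q n m m.+1)) ?rootidxP // => [|i /f_gen[]//].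
  exact: (lead_rootF q0 qq Hm (rootidxP x)).
Qed.

Lemma umon_lead t (X : nat -> A) (ex : nat -> nat -> G) (b : nat -> nat -> nat) l r :
  (l + r = n)%N -> (forall i j, (i + j < n)%N -> lead (ex i j) (f (qroot t X i j))) ->
  lead (\sum_(i < r) \sum_(j < r - i) ex (l + i)%N j *+ b (l + i)%N j) (f (umon t X b l r)).
Proof.
move=> lr H; elim: r l lr => [|r IH] l lr.
  by rewrite big_ord0 /= f_one; apply: (lead1 q omDl).
rewrite big_ord_recl /= f_mul; apply: (leadM q0 omDl omDr posD).
  rewrite /rowmon f_prod subn0 addn0.
  rewrite (eq_bigr (fun j : 'I_r.+1 => f (qroot t X l j) ^+ b l j)) => [|j _]; last exact: f_exp.
  have Hj (j : 'I_r.+1) : lead (ex l j *+ b l j) (f (qroot t X l j) ^+ b l j).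
    by apply: (leadX q0 omDl omDr posD); apply: H; have := ltn_ord j; lia.
  exact: (lead_prod q0 omDl omDr posD).
have -> : \sum_(i < r) \sum_(j < r.+1 - bump 0 i) ex (l + bump 0 i)%N j *+ b (l + bump 0 i)%N j =
    \sum_(i < r) \sum_(j < r - i) ex (l.+1 + i)%N j *+ b (l.+1 + i)%N j.
  by apply: eq_bigr => i _; rewrite /bump /= subSS addnA addn1.
by apply: IH; lia.
Qed.

Lemma kmon_lead (c : nat -> int) :
  lead (\sum_(i < n) Kexp n m m.+1 i *~ c i) (f (kmon n Kn Kin c)).
Proof.
rewrite /kmon f_prod; apply: (lead_prod q0 omDl omDr posD) => i.
have [_ _ fK fKi] := f_gen (ltn_ord i); case: (c i) => r; rewrite /kpow f_exp.
  rewrite fK -pmulrn; apply: (leadX q0 omDl omDr posD); exact: lead_mon.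
rewrite fKi NegzE mulrNz -pmulrn -mulNrn; apply: (leadX q0 omDl omDr posD); exact: lead_mon.
Qed.

Lemma pbw_mon_lead a : pbw_valid a -> lead (vexp pbw_exp a) (f (pbw_mon a)).
Proof.
move=> [aE aF]; rewrite /vexp sum_pbwidx addrC addrA /pbw_mon /pbwmon f_mul f_mul.
have rootpart (ex : nat -> nat -> G) (u : rootidx n' -> int) : (forall x, 0 <= u x) ->
    \sum_x ex (rowi x) (coli x) *~ u x =
    \sum_(i < n) \sum_(j < n - i) ex (0 + i)%N j *+ `|u (mkroot n' (0 + i) j)|%N.
  move=> u0; rewrite -(@sum_rootidx n' _ (fun l j => ex l j *+ `|u (mkroot n' l j)|%N)).
  by apply: eq_bigr => x _; rewrite mkrootK -{1}(gez0_abs (u0 x)) -pmulrn.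
rewrite addrAC; apply: (leadM q0 omDl omDr posD).
  apply: (leadM q0 omDl omDr posD).
    rewrite (rootpart (rootF_exp n m) (fun x => a (inr x)) aF).
    apply: (@umon_lead q^-1 Fn (rootF_exp n m) (fun l j => `|a (inr (mkroot n' l j))|%N) 0 n) => // i j ij.
    rewrite (@f_qroot _ _ (repF q n m m.+1)) // => [|l /f_gen[]//].
    exact: (lead_rootF q0 qq Hm).
  rewrite (eq_bigr (fun i : 'I_n => Kexp n m m.+1 i *~ a (inl (inr (inord i))))) => [|i _].
    exact: kmon_lead.
  by rewrite inord_val.
rewrite (rootpart (rootE_exp n m) (fun x => a (inl (inl x))) aE).
apply: (@umon_lead q En (rootE_exp n m) (fun l j => `|a (inl (inl (mkroot n' l j)))|%N) 0 n) => // i j ij.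
rewrite (@f_qroot _ _ (repE q n m m.+1)) // => [|l /f_gen[]//].
exact: (lead_rootE q0 qq Hm).
Qed.

End WithMorphism.

Definition pbw_bounded M (x : A) :=
  exists a, [/\ pbw_valid a, forall p, (`|a p| <= M)%N & x = pbw_mon a].

Lemma pbw_le_bounded M x : pbw_le q n En Fn Kn Kin M x -> pbw_bounded M x.
Proof.
move=> [a [c [b [aM cM bM ->]]]].
pose al : vec := [ffun p : pbwidx n' => match p with
  | inl (inl x) => (b (rowi x) (coli x))%:Z
  | inl (inr i) => c (val i)
  | inr x => (a (rowi x) (coli x))%:Z end].
exists al; split.
- by split=> y; rewrite ffunE.
- by case=> [[y|i]|y]; rewrite ffunE /=; [exact: bM | exact: cM | exact: aM].
rewrite /pbw_mon /pbwmon; congr (_ * _ * _).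
- apply: eq_umon_in => l j _ lj; rewrite ffunE.
  by have [-> ->] := mkroot_val lj.
- by apply: eq_bigr => i _; rewrite ffunE /= inordK.
- apply: eq_umon_in => l j _ lj; rewrite ffunE.
  by have [-> ->] := mkroot_val lj.
Qed.

Definition words_le L (x : A) := exists gs : seq A,
  [/\ forall g, g \in gs -> uq_gen n En Fn Kn Kin g, (size gs <= L)%N & x = \prod_(g <- gs) g].

Lemma words_le_mul L L' x y : lspan (words_le L) x -> lspan (words_le L') y ->
  lspan (words_le (L + L')) (x * y).
Proof.
move=> Hx Hy; apply: lspan_mulr Hx => _ [gs [Hgs sL ->]].
apply: lspan_mull Hy => _ [hs [Hhs sL' ->]]; apply: lspan_mem.
exists (gs ++ hs); split; last by rewrite big_cat.
  by move=> g; rewrite mem_cat => /orP[/Hgs|/Hhs].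
by rewrite size_cat leq_add.
Qed.

Lemma words_leW L L' x : (L <= L')%N -> lspan (words_le L) x -> lspan (words_le L') x.
Proof.
by move=> LL'; apply: lspan_sub => y [gs [Hgs sL ->]]; exists gs; split=> //; apply: leq_trans LL'.
Qed.

Lemma words_exhaust x : exists L, lspan (words_le L) x.
Proof.
elim: (Uq_generated Uq x) => [|c _ y [gs Hgs ->] _ [L HL]]; first by exists 0%N; apply: lspan_zero.
exists (maxn (size gs) L); apply: lspanD; last by apply: words_leW HL; apply: leq_maxr.
apply/lspanZ/lspan_mem; exists gs; split; [|exact: leq_maxl|by []].
move=> g /Hgs[i Hi]; exists (val i); split; first exact: ltn_ord.
by rewrite /natfam !inord_val.
Qed.

Lemma words_bounded L x : lspan (words_le L) x -> lspan (pbw_bounded L) x.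
Proof.
apply: (lspan_map (f := id)) => // _ [gs [Hgs sL ->]].
have := gens_span q0 rel q2 Hgs; apply: lspan_sub => y Hy; apply: pbw_le_bounded.
have [a [c [b [aM cM bM ->]]]] := Hy; exists a, c, b.
split=> // [l j|l|l j].
- exact: leq_trans (aM l j) sL.
- exact: leq_trans (cM l) sL.
- exact: leq_trans (bM l j) sL.
Qed.

Lemma pbw_mon_span x : lspan (fun y => exists2 a, pbw_valid a & y = pbw_mon a) x.
Proof.
have [L /words_bounded] := words_exhaust x.
by apply: lspan_sub => y [a [va _ ->]]; exists a.
Qed.

Notation d := #|pbwidx n' : finType|.

(** The box also lists exponent vectors that are not [pbw_valid], which is harmless since only an
    upper bound on its size is drawn from it. *)
Definition pbw_box M : seq A :=
  [seq pbw_mon [ffun p => (val (b p))%:Z - M%:Z] | b : {ffun pbwidx n' -> 'I_(2 * M).+1}].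

Lemma pbw_boxP M x : pbw_bounded M x -> x \in pbw_box M.
Proof.
move=> [a [_ aM ->]]; apply/mapP.
exists [ffun p => inord (absz (a p + M%:Z))]; first by rewrite mem_enum.
congr pbw_mon; apply/ffunP => p; rewrite !ffunE.
have aMB (z : int) : (`|z| <= M)%N ->
    z = `|(z + M%:Z)%R|%N%:Z - M%:Z /\ (`|(z + M%:Z)%R| < (2 * M).+1)%N.
  by clear; lia.
by have [az bz] := aMB _ (aM p); rewrite /= inordK.
Qed.

Lemma size_pbw_box M : size (pbw_box M) = ((2 * M).+1 ^ d)%N.
Proof. by rewrite size_image card_ffun card_ord. Qed.

Lemma growth_bound (s : seq A) : exists c : Rdefinitions.R, forall r, (0 < r)%N ->
  (dimspan (powspan s r))%:R <= c * r%:R ^+ d.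
Proof.
have [L HL] : exists L, forall x, x \in s -> lspan (words_le L) x.
  elim: s => [|x s [L HL]]; first by exists 0%N.
  have [L' HL'] := words_exhaust x; exists (maxn L' L) => y.
  rewrite inE => /orP[/eqP->|/HL]; first by apply: words_leW HL'; apply: leq_maxl.
  by apply: words_leW; apply: leq_maxr.
have Hpow r x : x \in powspan s r -> lspan (words_le (r * L)) x.
  elim: r x => [|r IH] x.
    by rewrite inE => /eqP ->; apply: lspan_mem; exists [::]; split; rewrite ?big_nil.
  by move=> /prodspanP[v [w [/IH Hv /HL Hw ->]]]; rewrite mulSn addnC; apply: words_le_mul.
(* [V^r] lies in the span of the words of length at most r L, hence of a box with (2 r L + 1)^d
   elements, and 2 r L + 1 <= (2 L + 1) r for r >= 1. *)
exists ((2 * L).+1%:R ^+ d) => r r0; rewrite -natrX -natrX -natrM ler_nat -expnMn.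
apply: (@leq_trans (size (pbw_box (r * L)))).
  apply: dimspan_le => x /Hpow /words_bounded; apply: lspan_sub; exact: pbw_boxP.
by rewrite size_pbw_box leq_exp2r ?card_pbwidx //; nia.
Qed.

Lemma Uq_sl_LD_stable : LD_stable A /\ LDdeg A = ((n'.+2 ^ 2 - 1)%N%:R)%:E.
Proof.
rewrite -card_pbwidx; have d0 : (0 < d)%N by rewrite card_pbwidx; lia.
apply: LD_stable_of_bounds => // [s _|]; first exact: growth_bound.
pose s := 1 :: [seq pbw_gen p | p : pbwidx n'].
have s1 : spanned s 1 by apply: lspan_mem; rewrite mem_head.
exists s, (2 * d%:R)^-1; split.
- exact/inspanP.
- by rewrite invr_gt0 mulr_gt0 // ltr0n.
have [f [f1 f2 f3 f4]] := torus_morphism.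
apply: (isoperimetric_of_leads q0 omDl omDr (@tpos0 n m) posD (@tpos_total n m) f1 f2
  pbw_exp_free (pbw_gen_lead f1 f2 f4) (pbw_mon_lead f1 f2 f3 f4) pbw_mon_span) => // p.
by apply: lspan_mem; rewrite inE (map_f pbw_gen) ?mem_enum ?orbT.
Qed.

End Main.

Theorem theorem6p5 (N : nat) (q : C) (A : algType C) (E F K Ki : 'I_N.-1 -> A) :
  (2 <= N)%N -> q != 0 -> (forall k : nat, (0 < k)%N -> q ^+ k != 1) ->
  is_Uq_sl q E F K Ki ->
  LD_stable A /\ LDdeg A = ((N ^ 2 - 1)%N%:R)%:E.
Proof.
case: N E F K Ki => [|[|n']] // E F K Ki _ q0 q_root Uq.
exact: (Uq_sl_LD_stable q0 q_root Uq).
Qed.
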